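(* Let $\tilde\rho_h$ be a solution of the semidiscrete problem: $\tilde\rho_h=\rho_h-\pi\phi:\mathbb R_+\to W_h$, $\tilde\rho_h(0)=\pi\tilde\rho^0$, and $$(\tilde\rho_{h,t},w_h)+(K(|\nabla\rho_h|)\nabla\rho_h,\nabla w_h)=(\tilde f,w_h)\qquad\forall w_h\in W_h,\ t>0 .$$ Put $\mathfrak g(t)=\|\tilde f(t)\|^{\lambda}+\|\phi(t)\|_1^2$. Then there exists a positive constant $C$ such that for all $t>0$ $$\|\tilde\rho_h(t)\|\le C\Big(1+\|\tilde\rho^0\|+(\mathrm{Env}\,\mathfrak g(t))^{1/\beta}\Big).$$ Furthermore, $$\limsup_{t\to\infty}\|\tilde\rho_h(t)\|^2\le C\Big(1+\limsup_{t\to\infty}\mathfrak g(t)\Big)^{2/\beta}.$$ If $\limsup_{t\to\infty}\|\tilde f(t)\|=\limsup_{t\to\infty}\|\phi(t)\|_1=0$, then $\limsup_{t\to\infty}\|\tilde\rho_h(t)\|^2=0$.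
   Context: Setting. $\Omega\subset\mathbb R^d$ ($d\ge2$) is open and bounded with smooth boundary $\Gamma$; $\mathbb R_+=[0,\infty)$. $(\cdot,\cdot)$ and $\|\cdot\|$ are the $L^2(\Omega)$ inner product and norm (for scalar or vector functions), $\|\cdot\|_{m,q}$ is the $W^{m,q}(\Omega)$ norm (so $\|\cdot\|_{0,q}$ is the $L^q(\Omega)$ norm), and $\|\cdot\|_m=\|\cdot\|_{m,2}$. For a function of $(x,t)$, $u(t)=u(\cdot,t)$; subscript $t$ is the time derivative. Nonlinearity. Fix $N\ge1$, reals $0=\alpha_0<\alpha_1<\dots<\alpha_N$, coefficients $a_i\ge0$ with $a_0,a_N>0$, and $g(s)=\sum_{i=0}^N a_is^{\alpha_i}$, $s\ge0$, $\deg g=\alpha_N$. For $\xi\ge0$, $K(\xi)=1/g(s(\xi))$, where $s=s(\xi)\ge0$ is the unique nonnegative solution of $s\,g(s)=\xi$. Set $a=\frac{\alpha_N}{\alpha_N+1}$, $\beta=2-a$, $\lambda=\frac{2-a}{1-a}$. Standing assumption (Degree Condition): $a\le\frac4{d+2}$ (equivalently $\deg g\le\frac4{d-2}$), so that $W^{1,\beta}(\Omega)$ embeds continuously in $L^2(\Omega)$. Data. $f(x,t)$ is a source, $\rho^0(x)$ an initial datum, $\psi$ a Dirichlet datum on $\Gamma\times\mathbb R_+$, and $\phi(x,t)$ an extension of $\psi$ to $\Omega\times\mathbb R_+$. Set $\tilde f=f-\phi_t$, $\phi^0=\phi(\cdot,0)$, $\tilde\rho^0=\rho^0-\phi^0$.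 The data are regular enough that all quantities occurring in the statement are defined, and those required to be continuous in time are. Discretization. $\mathcal T_h$ is a member of a globally quasiuniform family of triangulations of $\Omega$, $h$ its maximal element diameter; $W_h\subset H_0^1(\Omega)$ is the finite element space of continuous piecewise polynomials of degree $r$ over $\mathcal T_h$. $\pi$ is the $L^2$-projection onto $W_h$: $(\pi w,v_h)=(w,v_h)$ for all $v_h\in W_h$. It is assumed to satisfy, with constants $C_0,C_1>0$: $\|\pi w\|_s\le C_0\|w\|_s$ for $w\in H^s(\Omega)$, $s\in\{0,1\}$; and $\|\pi w-w\|_{0,q}\le C_1h^m\|w\|_{m,q}$ for $w\in W^{m,q}(\Omega)$, $0\le m\le r+1$, $1\le q\le\infty$. Envelope. $\mathrm{Env}(F)$ denotes a continuous, increasing function on the interval of definition of $F$ with $\mathrm{Env}(F)(t)\ge F(t)$ for all $t$; $\mathrm{Env}\,\mathfrak g(t)$ is its value at $t$. Constants. $C$ depends only on the exponents and coefficients of $g$, on $d$, $\Omega$ and on the constants $C_0,C_1$ (and quasiuniformity constants); it does not depend on the data, on $t$, or otherwise on $h$. *)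

(* Defs.v *)
From HB Require Import structures.
From mathcomp Require Import all_boot all_order all_algebra.
From mathcomp Require Import all_classical all_reals all_analysis.

Set Implicit Arguments.
Unset Strict Implicit.
Unset Printing Implicit Defensive.
Import Order.TTheory GRing.Theory Num.Theory.
Import numFieldNormedType.Exports.
Local Open Scope classical_set_scope.
Local Open Scope ring_scope.

(* The sigma-algebra on 'rV[R]_n is the product of the Borel sigma-algebras,
   i.e., the one generated by the coordinates. *)
Definition measure_row_display : measure_display -> measure_display.
Proof. exact. Qed.

Section row_measurable.
Context (R : realType) (n : nat).

Let coord (i : 'I_n) (x : 'rV[R]_n) : measurableTypeR R := x ord0 i.

Let row_set0 : g_sigma_preimage coord set0.
Proof. exact: sigma_algebra0. Qed.

Let row_setC A : g_sigma_preimage coord A -> g_sigma_preimage coord (~` A).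
Proof. exact: sigma_algebraC. Qed.

Let row_bigcup (F : (set 'rV[R]_n)^nat) :
  (forall i, g_sigma_preimage coord (F i)) ->
  g_sigma_preimage coord (\bigcup_i F i).
Proof. exact: sigma_algebra_bigcup. Qed.

HB.instance Definition _ :=
  @isMeasurable.Build (measure_row_display (R.-ocitv.-measurable).-sigma)
    'rV[R]_n (g_sigma_preimage coord) row_set0 row_setC row_bigcup.

End row_measurable.

Section row_measurable_lemmas.
Context (R : realType).

Lemma measurable_coord n (i : 'I_n) :
  measurable_fun [set: 'rV[R]_n] (fun x : 'rV[R]_n => (x ord0 i : measurableTypeR R)).
Proof.
move=> _ Y mY; rewrite setTI; apply: sub_sigma_algebra => /=.
rewrite -bigcup_seq/=; exists i => /=; first by rewrite mem_index_enum.
by exists Y => //; rewrite setTI.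
Qed.

Lemma measurable_rowP d (T : measurableType d) n (f : T -> 'rV[R]_n) :
  (forall i, measurable_fun [set: T] (fun x => (f x ord0 i : measurableTypeR R))) ->
  measurable_fun [set: T] f.
Proof.
move=> mf _ A mA; rewrite setTI.
suff : preimage_set_system [set: T] f (@measurable _ 'rV[R]_n) `<=` measurable.
  by apply; exists A => //; rewrite setTI.
rewrite /measurable/= -g_sigma_preimage_comp.
apply: smallest_sub; first exact: sigma_algebra_measurable.
case: n => [|n] in f A mf mA *; first by rewrite big_ord0.
rewrite -bigcup_mkord_ord; apply: bigcup_sub => i Ii.
by move=> B [C mC <-]; exact: mf.
Qed.

Definition row_cons n (p : R * 'rV[R]_n) : 'rV[R]_n.+1 :=
  \row_i if unlift ord0 i is Some j then p.2 ord0 j else p.1.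

Definition row_behead n (x : 'rV[R]_n.+1) : 'rV[R]_n :=
  \row_j x ord0 (lift ord0 j).

Lemma row_consK n (p : R * 'rV[R]_n) :
  (row_cons p ord0 ord0, row_behead (row_cons p)) = p.
Proof.
case: p => a v; rewrite /row_cons !mxE unlift_none/=; congr pair.
by apply/rowP => j; rewrite !mxE liftK.
Qed.

Lemma row_beheadK n (x : 'rV[R]_n.+1) :
  row_cons (x ord0 ord0, row_behead x) = x.
Proof.
apply/rowP => i; rewrite !mxE; case: unliftP => [j ->|->//].
by rewrite !mxE.
Qed.

Lemma measurable_row_cons n :
  measurable_fun [set: measurableTypeR R * 'rV[R]_n] (@row_cons n).
Proof.
apply: measurable_rowP => i; rewrite /row_cons.
under eq_fun do rewrite mxE.
case: (unlift ord0 i) => [j|].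
  by apply: (measurableT_comp (measurable_coord j)); exact: measurable_snd.
exact: measurable_fst.
Qed.

Lemma measurable_row_uncons n :
  measurable_fun [set: 'rV[R]_n.+1]
    (fun x => ((x ord0 ord0 : measurableTypeR R), row_behead x)).
Proof.
apply: measurable_fun_pair; first exact: measurable_coord.
apply: measurable_rowP => i.
under eq_fun do rewrite mxE.
exact: measurable_coord.
Qed.

End row_measurable_lemmas.

Section lebesgue_row.
Context (R : realType).

Section step.
Context (n : nat) (mu : {sigma_finite_measure set 'rV[R]_n -> \bar R}).

Definition lebesgue_step : set 'rV[R]_n.+1 -> \bar R :=
  pushforward (@lebesgue_measure R \x mu)%E (@row_cons R n).

Let step0 : lebesgue_step set0 = 0%E.
Proof. by rewrite /lebesgue_step /pushforward preimage_set0 measure0. Qed.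

Let step_ge0 A : (0 <= lebesgue_step A)%E.
Proof. exact: (measure_ge0 (@lebesgue_measure R \x mu)%E). Qed.

Let step_sigma_additive : semi_sigma_additive lebesgue_step.
Proof.
move=> F mF tF mUF; rewrite /lebesgue_step /pushforward preimage_bigcup.
have mc A : measurable A -> measurable (@row_cons R n @^-1` A).
  by move=> mA; rewrite -[X in measurable X]setTI; exact: measurable_row_cons.
apply: (@measure_semi_sigma_additive _ _ _ (@lebesgue_measure R \x mu)%E).
- by move=> k; exact: mc (mF k).
- apply/trivIsetP => /= i j _ _ ij; rewrite -preimage_setI.
  by move/trivIsetP : tF => /(_ _ _ _ _ ij) ->//; rewrite preimage_set0.
- by rewrite -preimage_bigcup; exact: mc mUF.
Qed.

HB.instance Definition _ :=
  isMeasure.Build _ _ _ lebesgue_step step0 step_ge0 step_sigma_additive.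

Let step_sigma_finite : sigma_finite setT lebesgue_step.
Proof.
have /sigma_finiteP[F [TF ndF Foo]] := sigma_finiteT (@lebesgue_measure R).
have /sigma_finiteP[G [TG ndG Goo]] := sigma_finiteT mu.
pose g (x : 'rV[R]_n.+1) := ((x ord0 ord0 : measurableTypeR R), row_behead x).
exists (fun k => g @^-1` (F k `*` G k)) => [|k].
  apply/esym; rewrite -subTset => x _.
  have : [set: measurableTypeR R] (g x).1 by [].
  rewrite TF => -[i _ Fi]; have : [set: 'rV[R]_n] (g x).2 by [].
  rewrite TG => -[j _ Gj]; exists (maxn i j) => //; split.
    by move: Fi; exact/subsetPset/ndF/leq_maxl.
  by move: Gj; exact/subsetPset/ndG/leq_maxr.
have [mFk Fkoo] := Foo k; have [mGk Gkoo] := Goo k; split.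
  rewrite -[X in measurable X]setTI; apply: measurable_row_uncons => //.
  exact: measurableX.
rewrite /lebesgue_step /pushforward -comp_preimage.
rewrite (_ : g \o _ = id); last by apply/funext => p; rewrite /g/= row_consK.
by rewrite preimage_id product_measure1E// lte_mul_pinfty// ge0_fin_numE.
Qed.

HB.instance Definition _ :=
  @Measure_isSigmaFinite.Build _ _ _ lebesgue_step step_sigma_finite.

End step.

(* lebesgue_row n is the n-fold product of the one-dimensional Lebesgue
   measure, transported from R * (R * ... ) to row vectors. *)
Fixpoint lebesgue_row (n : nat) : {sigma_finite_measure set 'rV[R]_n -> \bar R} :=
  match n with
  | 0 => \d_(0 : 'rV[R]_0)
  | n'.+1 => lebesgue_step (lebesgue_row n')
  end.

Lemma lebesgue_row_box n (A : 'I_n -> set (measurableTypeR R)) :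
  (forall i, measurable (A i)) ->
  lebesgue_row n [set x | forall i, A i (x ord0 i)] =
  (\prod_i lebesgue_measure (A i))%E.
Proof.
elim: n A => [A _|n ih A mA].
  by rewrite big_ord0 /= diracE mem_set// => -[].
rewrite big_ord_recl -ih//= /lebesgue_step /pushforward.
rewrite (_ : _ @^-1` _ =
    A ord0 `*` [set x : 'rV[R]_n | forall i, A (lift ord0 i) (x ord0 i)]).
  rewrite product_measure1E//.
  rewrite (_ : [set _ | _] = \bigcap_(i in [set: 'I_n])
      ((fun x : 'rV[R]_n => (x ord0 i : measurableTypeR R))
         @^-1` A (lift ord0 i))).
    apply: fin_bigcap_measurable => // i _.
    by rewrite -[X in measurable X]setTI; exact: measurable_coord.
  by apply/seteqP; split => [x h i _|x h i]; exact: (h i).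
apply/seteqP; split => -[t x] /=.
  move=> h; split; first by have := h ord0; rewrite mxE unlift_none.
  by move=> i; have := h (lift ord0 i); rewrite mxE liftK.
by move=> [h0 h] i; rewrite mxE; case: unliftP => [j ->|->] //=.
Qed.

End lebesgue_row.

Section euclidean.
Context (R : realType) (d : nat).
Implicit Types x y : 'rV[R]_d.

(* The norm `|x| of the library on 'rV[R]_d is the sup norm. *)
Definition dotv x y : R := \sum_i x ord0 i * y ord0 i.
Definition enorm x : R := Num.sqrt (dotv x x).

Definition pderiv (i : 'I_d) (f : 'rV[R]_d -> R) : 'rV[R]_d -> R :=
  fun x => 'D_(delta_mx ord0 i) f x.

Definition smooth (f : 'rV[R]_d -> R) : Prop :=
  forall s : seq 'I_d,
    continuous (foldr pderiv f s) /\
    forall i x, derivable (foldr pderiv f s) x (delta_mx ord0 i).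

Definition mdeg (al : 'I_d -> nat) : nat := (\sum_i al i)%N.

Definition pderivn (al : 'I_d -> nat) (f : 'rV[R]_d -> R) : 'rV[R]_d -> R :=
  foldr (fun i g => iter (al i) (pderiv i) g) f (enum 'I_d).

Definition topo_boundary (A : set 'rV[R]_d) : set 'rV[R]_d :=
  closure A `\` interior A.

(* Near each boundary point, Omega is the sublevel set of a smooth function
   with nonvanishing gradient. *)
Definition smooth_boundary (Omega : set 'rV[R]_d) : Prop :=
  forall x0, topo_boundary Omega x0 ->
  exists2 g : 'rV[R]_d -> R, smooth g &
    (exists i, pderiv i g x0 != 0) /\
    \forall x \near x0, Omega x <-> g x < 0.

End euclidean.

Section sobolev.
Context (R : realType) (d : nat) (Omega : set 'rV[R]_d).
Implicit Types (u v w : 'rV[R]_d -> R) (q : \bar R).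

Local Notation mu := (@lebesgue_row R d).

Definition Lq_norm q u : \bar R := 'N[mu]_q [EFin \o (u \_ Omega)].

Definition in_Lq q u : Prop := measurable_fun Omega u /\ (Lq_norm q u < +oo)%E.

(* Real-valued; meaningful for functions in L^2(Omega). *)
Definition L2norm u : R := fine (Lq_norm 2%:E u).

Definition inner u v : R := \int[mu]_(x in Omega) (u x * v x).

Definition test_function (phi : 'rV[R]_d -> R) : Prop :=
  [/\ smooth phi,
      compact (closure [set x | phi x != 0]) &
      closure [set x | phi x != 0] `<=` Omega].

Definition loc_integrable u : Prop :=
  forall A, compact A -> A `<=` Omega -> mu.-integrable A (EFin \o u).

Definition is_weak_deriv (al : 'I_d -> nat) u v : Prop :=
  [/\ loc_integrable u, loc_integrable v &
      forall phi, test_function phi ->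
        inner u (pderivn al phi) = (-1) ^+ mdeg al * inner v phi].

(* A chosen representative of the weak derivative, unique up to a null set of
   Omega; the derivative of order 0 is u itself. *)
Definition weak_deriv (al : 'I_d -> nat) u : 'rV[R]_d -> R :=
  if mdeg al == 0%N then u else get [set v | is_weak_deriv al u v].

Definition grad u (x : 'rV[R]_d) : 'rV[R]_d :=
  \row_i weak_deriv (fun j => (j == i : nat)) u x.

Definition in_W (m : nat) q u : Prop :=
  forall al : 'I_d -> nat, (mdeg al <= m)%N ->
    is_weak_deriv al u (weak_deriv al u) /\ in_Lq q (weak_deriv al u).

Definition W_norm (m : nat) q u : \bar R :=
  match q with
  | p%:E => ((\sum_(al : {ffun 'I_d -> 'I_m.+1} | (mdeg (fun i => al i) <= m)%N)
               Lq_norm q (weak_deriv (fun i => al i) u) `^ p) `^ p^-1)%E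
  | _ => \big[maxe/0%E]_(al : {ffun 'I_d -> 'I_m.+1}
                         | (mdeg (fun i => al i) <= m)%N)
           Lq_norm q (weak_deriv (fun i => al i) u)
  end.

Definition H1norm u : R := fine (W_norm 1 2%:E u).

(* The closure of the test functions in H^1(Omega). *)
Definition in_H10 u : Prop :=
  in_W 1 2%:E u /\
  exists2 phi : ('rV[R]_d -> R)^nat, (forall n, test_function (phi n)) &
    (fun n => W_norm 1 2%:E (phi n \- u)) @ \oo --> 0%E.

(* Curves t |-> u t, t >= 0, in L^2(Omega); at t = 0 the limits below are
   one-sided. *)
Definition L2_continuous_at (u : R -> 'rV[R]_d -> R) (t : R) : Prop :=
  Lq_norm 2%:E (u s \- u t) @[s --> within [set s | 0 <= s] (nbhs t)] --> 0%E.

Definition L2_derivative_at (u : R -> 'rV[R]_d -> R) (t : R) v : Prop :=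
  Lq_norm 2%:E ((fun x => (s - t)^-1 * (u s x - u t x)) \- v)
    @[s --> within [set s | 0 <= s] t^'] --> 0%E.

End sobolev.

Section forchheimer.
Context (R : realType) (N : nat) (al a : 'I_N.+1 -> R).

Definition gpoly (s : R) : R := \sum_i a i * s `^ al i.

Definition s_of (xi : R) : R := get [set s | 0 <= s /\ s * gpoly s = xi].

Definition Kfun (xi : R) : R := (gpoly (s_of xi))^-1.

Definition a_exp : R := al ord_max / (al ord_max + 1).
Definition beta_exp : R := 2 - a_exp.
Definition lambda_exp : R := (2 - a_exp) / (1 - a_exp).

End forchheimer.

Section finite_elements.
Context (R : realType) (d : nat).

Definition barycentric (x : 'rV[R]_d) (j : 'I_d.+1) : R :=
  if unlift ord0 j is Some i then x ord0 i else 1 - \sum_i x ord0 i.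

Definition ref_simplex : set 'rV[R]_d := [set x | forall j, 0 <= barycentric x j].

(* The face spanned by the vertices in J (empty when J is). *)
Definition ref_face (J : {set 'I_d.+1}) : set 'rV[R]_d :=
  ref_simplex `&` [set x | forall j, j \notin J -> barycentric x j = 0].

Definition is_affine_on (A : set 'rV[R]_d) (F : 'rV[R]_d -> 'rV[R]_d) : Prop :=
  exists (M : 'M[R]_d) (b : 'rV[R]_d), forall x, A x -> F x = x *m M + b.

Definition bilipschitz_on (A : set 'rV[R]_d) (F : 'rV[R]_d -> 'rV[R]_d) : Prop :=
  exists lo hi : R, 0 < lo /\ forall x y, A x -> A y ->
    lo * enorm (x - y) <= enorm (F x - F y) <= hi * enorm (x - y).

(* A mesh is given by its element maps: the k-th element is the image of the
   reference simplex under F k. *)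
Definition element nT (F : 'I_nT -> 'rV[R]_d -> 'rV[R]_d) (k : 'I_nT) :
  set 'rV[R]_d := F k @` ref_simplex.

(* As the boundary of Omega is curved, straight simplices cannot cover Omega
   exactly: the elements that touch the boundary may be curved simplices, all
   the others are straight. *)
Record triangulation (Omega : set 'rV[R]_d) nT
    (F : 'I_nT -> 'rV[R]_d -> 'rV[R]_d) : Prop := {
  tri_bilipschitz : forall k, bilipschitz_on ref_simplex (F k);
  tri_straight : forall k, element F k `&` topo_boundary Omega = set0 ->
    is_affine_on ref_simplex (F k);
  tri_cover : \bigcup_k element F k = closure Omega;
  tri_conforming : forall k l, k != l ->
    exists J J' : {set 'I_d.+1},
      [/\ (#|J| <= d)%N, (#|J'| <= d)%N,
          element F k `&` element F l = F k @` ref_face J &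
          element F k `&` element F l = F l @` ref_face J'] }.

Definition diam (A : set 'rV[R]_d) : R :=
  sup [set enorm (p.1 - p.2) | p in A `*` A].

Definition mesh_size nT (F : 'I_nT -> 'rV[R]_d -> 'rV[R]_d) : R :=
  \big[Num.max/0]_k diam (element F k).

(* Every element contains a ball of radius sigma * h, where h is the largest
   diameter in the whole mesh. *)
Definition quasiuniform (sigma : R) nT
    (F : 'I_nT -> 'rV[R]_d -> 'rV[R]_d) : Prop :=
  forall k, exists c, [set x | enorm (x - c) <= sigma * mesh_size F]
                        `<=` element F k.

(* Real polynomials in d variables of total degree at most r. *)
Definition poly_fun (r : nat) (p : 'rV[R]_d -> R) : Prop :=
  exists c : {ffun 'I_d -> 'I_r.+1} -> R, forall x,
    p x = \sum_(al : {ffun 'I_d -> 'I_r.+1} | (mdeg (fun i => al i) <= r)%N)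
            c al * \prod_i x ord0 i ^+ al i.

(* On a straight element a function is a polynomial of degree at most r iff
   its pull-back to the reference simplex is; on a curved element the
   polynomials are those in the reference coordinates. *)
Definition in_FE (Omega : set 'rV[R]_d) (r : nat) nT
    (F : 'I_nT -> 'rV[R]_d -> 'rV[R]_d) (v : 'rV[R]_d -> R) : Prop :=
  [/\ in_H10 Omega v,
      {within closure Omega, continuous v} &
      forall k, exists2 p, poly_fun r p &
        forall x, ref_simplex x -> v (F k x) = p x].

(* The L^2-projection onto W; as the functions of W are bounded, it is defined
   on L^1(Omega), hence on every L^q(Omega), 1 <= q. *)
Definition L2_projection (Omega : set 'rV[R]_d) (W : set ('rV[R]_d -> R))
    (P : ('rV[R]_d -> R) -> 'rV[R]_d -> R) : Prop :=
  forall w, in_Lq Omega 1%:E w ->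
    W (P w) /\ forall v, W v -> inner Omega (P w) v = inner Omega w v.

End finite_elements.

Section semidiscrete.
Context (R : realType) (d N : nat) (al a : 'I_N.+1 -> R).
Context (Omega : set 'rV[R]_d) (W : set ('rV[R]_d -> R)).
Context (P : ('rV[R]_d -> R) -> 'rV[R]_d -> R).
Implicit Types u phi rho : R -> 'rV[R]_d -> R.

Definition tilde_rho rho phi : R -> 'rV[R]_d -> R :=
  fun t => rho t \- P (phi t).

(* phit stands for the time derivative of phi. *)
Definition tilde_f (f phit : R -> 'rV[R]_d -> R) : R -> 'rV[R]_d -> R :=
  fun t => f t \- phit t.

Definition flux (u : 'rV[R]_d -> R) (x : 'rV[R]_d) : 'rV[R]_d :=
  Kfun al a (enorm (grad Omega u x)) *: grad Omega u x.

Record semidiscrete_solution (f phit phi rho : R -> 'rV[R]_d -> R)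
    (rho0 : 'rV[R]_d -> R) : Prop := {
  sol_space : forall t : R, 0 <= t -> W (tilde_rho rho phi t);
  sol_continuous : forall t : R, 0 <= t ->
    L2_continuous_at Omega (tilde_rho rho phi) t;
  sol_initial : forall x, Omega x ->
    tilde_rho rho phi 0 x = P (rho0 \- phi 0) x;
  sol_equation : forall t : R, 0 < t ->
    exists2 rt, W rt /\ L2_derivative_at Omega (tilde_rho rho phi) t rt &
      forall w, W w ->
        inner Omega rt w
        + \int[@lebesgue_row R d]_(x in Omega)
            dotv (flux (rho t) x) (grad Omega w x)
        = inner Omega (tilde_f f phit t) w }.

Definition gfrak (f phit phi : R -> 'rV[R]_d -> R) (t : R) : R :=
  L2norm Omega (tilde_f f phit t) `^ lambda_exp al
  + H1norm Omega (phi t) ^+ 2.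

End semidiscrete.

Definition is_envelope (R : realType) (F E : R -> R) : Prop :=
  [/\ {within `[0, +oo[, continuous E},
      {in `[0, +oo[ &, {homo E : s t / s <= t}} &
      forall t : R, 0 <= t -> F t <= E t].

Definition limsup_infty (R : realType) (F : R -> R) : \bar R :=
  limf_esup (EFin \o F) (@pinfty_nbhs R).

(* Main.v *)
Require Import Defs.
From mathcomp Require Import all_boot all_order all_algebra.
From mathcomp Require Import all_classical all_reals all_analysis.
From mathcomp Require Import measurable_realfun.
From mathcomp Require Import ring lra.

Set Implicit Arguments.
Unset Strict Implicit.
Unset Printing Implicit Defensive.
Import Order.TTheory GRing.Theory Num.Theory.
Import numFieldNormedType.Exports.
Local Open Scope classical_set_scope.
Local Open Scope ring_scope.

(** Why the estimates hold.  Let u be the solution rho_h - pi phi and y = |u|^2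
    its squared L^2 norm.  Testing the equation with u itself gives
      y' / 2 = (f~, u) - (K(|grad rho_h|) grad rho_h, grad u),
    where grad rho_h = grad u + grad (pi phi).

    The flux term is a damping.  Since K(xi) xi = s(xi) grows at least like
    xi^(1-a) for large xi, one has, for every parameter 0 < eps <= 1,
      c eps^a |y - z|^beta <= K(|y|) y . (y - z) + C (eps^2 + |z|^2)
    (flux_coercive).  The parameter is what makes the last claim accessible:
    the degenerate growth only needs to be used for |y| >= eps, the price is a
    weaker damping eps^a and an error eps^2, and the ratio eps^2 / eps^a =
    eps^beta tends to 0 with eps.  Integrating this with y = grad rho_h and
    y - z = grad u, and bounding the integral of |grad u|^beta from below by
    |u|^beta with the Sobolev inequality of W^(1,beta) in L^2, yields
    dissipation.  Young's inequality absorbs (f~, u) into half of the damping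
    and leaves |f~|^lambda; the H^1 stability of pi bounds |grad (pi phi)| by
    the H^1 norm of phi.  The outcome (energy_inequality) is the scalar inequality
      y' <= C eps^2 + D(eps) g(t) - kappa eps^a y^(beta/2).

    The rest is comparison with the level at which the right-hand side
    vanishes: y cannot cross a level above which y' <= 0 (barrier), and reaches
    in finite time a level above which y' <= - eta < 0 (descent).  With eps = 1
    this gives the first bound (g is at most the envelope at time t on all of
    [0, t]) and the second one (g is eventually at most its limsup plus 1).  If
    g tends to 0, the limsup of y is at most a multiple of eps^2 for every eps,
    hence 0.

    Two analytic facts about the space H^1_0 are established on the way.  The
    Sobolev inequality for the exponent 2d/(d+2) is proved for C^1 functions
    with compact support by Gagliardo's argument (gagliardo, sobolev_C1), and
    passes to the closure of the test functions (sobolev_H10); the degree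
    condition says precisely that beta >= 2d/(d+2).  And since a weak derivative
    is a chosen representative, its additivity almost everywhere rests on
    uniqueness, that is on the du Bois-Reymond lemma (du_bois_reymond), which
    needs smooth bumps on boxes. *)

(** * Boxes and measurability in the space of row vectors *)

Section boxes.
Context (R : realType).
Implicit Types n : nat.

Definition obox n (p q : 'I_n -> R) : set 'rV[R]_n :=
  [set x | forall i, p i < x ord0 i < q i].

Definition cbox n (p q : 'I_n -> R) : set 'rV[R]_n :=
  [set x | forall i, p i <= x ord0 i <= q i].

Lemma subset_obox_cbox n (p q : 'I_n -> R) : obox p q `<=` cbox p q.
Proof. by move=> x h i; case/andP: (h i) => /ltW -> /ltW ->. Qed.

Lemma row_set_measurable n (A : 'I_n -> set (measurableTypeR R)) :
  (forall i, measurable (A i)) ->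
  measurable [set x : 'rV[R]_n | forall i, A i (x ord0 i)].
Proof.
move=> mA.
rewrite (_ : [set _ | _] = \bigcap_(i in [set: 'I_n])
    ((fun x : 'rV[R]_n => (x ord0 i : measurableTypeR R)) @^-1` A i)).
  apply: fin_bigcap_measurable => // i _.
  by rewrite -[X in measurable X]setTI; exact: measurable_coord.
by apply/seteqP; split => [x h i _|x h i]; exact: (h i).
Qed.

Lemma measurable_obox n (p q : 'I_n -> R) : measurable (obox p q).
Proof.
rewrite (_ : obox p q = [set x | forall i, `]p i, q i[%classic (x ord0 i)]).
  by apply: (@row_set_measurable _ (fun i => `]p i, q i[%classic)) => i; exact: measurable_itv.
by apply/seteqP; split => x h i; have := h i; rewrite /= in_itv.
Qed.

Lemma measurable_cbox n (p q : 'I_n -> R) : measurable (cbox p q).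
Proof.
rewrite (_ : cbox p q = [set x | forall i, `[p i, q i]%classic (x ord0 i)]).
  by apply: (@row_set_measurable _ (fun i => `[p i, q i]%classic)) => i; exact: measurable_itv.
by apply/seteqP; split => x h i; have := h i; rewrite /= in_itv.
Qed.

Definition rat_box n (c : {ffun 'I_n -> rat * rat}) : set 'rV[R]_n :=
  obox (fun i => ratr (c i).1) (fun i => ratr (c i).2).

Definition rat_cbox n (c : {ffun 'I_n -> rat * rat}) : set 'rV[R]_n :=
  cbox (fun i => ratr (c i).1) (fun i => ratr (c i).2).

(** Open sets are countable unions of boxes with rational corners; the closed
    box is kept inside the open set because local integrability is a condition
    on compact subsets. *)
Lemma open_rat_box n (A : set 'rV[R]_n) x : open A -> A x ->
  exists2 c, rat_box c x & rat_cbox c `<=` A.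
Proof.
move=> oA Ax; have /nbhs_ballP[e /= e0 xeA] : nbhs x A by exact: open_nbhs_nbhs.
have /choice[p hp] : forall i : 'I_n, exists p : rat,
    ratr p \in `](x ord0 i - e / 2), (x ord0 i)[.
  by move=> i; apply: rat_in_itvoo; rewrite ltrBlDr ltrDl divr_gt0.
have /choice[q hq] : forall i : 'I_n, exists q : rat,
    ratr q \in `](x ord0 i), (x ord0 i + e / 2)[.
  by move=> i; apply: rat_in_itvoo; rewrite ltrDl divr_gt0.
exists [ffun i => (p i, q i)] => [i|y hy].
  rewrite ffunE /=; move: (hp i) (hq i); rewrite !in_itv/=.
  by move=> /andP[_ ->] /andP[].
apply: xeA; split => // i j; rewrite (ord1 i) -ball_normE /ball_ /=.
have := hy j; rewrite ffunE /=; move: (hp j) (hq j); rewrite !in_itv/=.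
move=> /andP[h1 h2] /andP[h3 h4] /andP[h5 h6].
by rewrite ltr_norml; apply/andP; split; lra.
Qed.

Lemma open_bigcup_rat_box n (A : set 'rV[R]_n) : open A ->
  A = \bigcup_(c in [set c | rat_cbox c `<=` A]) rat_box c.
Proof.
move=> oA; apply/seteqP; split => [x Ax|x [c /= cA] cx].
  by have [c cx cA] := open_rat_box oA Ax; exists c.
exact/cA/subset_obox_cbox.
Qed.

Lemma open_row_measurable n (A : set 'rV[R]_n) : open A -> measurable A.
Proof.
move=> /open_bigcup_rat_box ->; rewrite bigcup_mkcond.
apply: countable_bigcupT_measurable => // c.
by case: ifP => // _; exact: measurable_obox.
Qed.

Lemma closed_row_measurable n (A : set 'rV[R]_n) : closed A -> measurable A.
Proof. by move/closed_openC/open_row_measurable/measurableC; rewrite setCK. Qed.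

Lemma compact_row_measurable n (A : set 'rV[R]_n) : compact A -> measurable A.
Proof.
move=> cA; apply: closed_row_measurable; exact: compact_closed.
Qed.

Lemma continuous_row_measurable n (f : 'rV[R]_n -> R) : continuous f ->
  measurable_fun [set: 'rV[R]_n] (f : _ -> measurableTypeR R).
Proof.
move=> /continuousP cf; apply: (measurability _ (RGenOpens.measurableE R)).
move=> _ [_ [a [b ->] <-]]; rewrite setTI; apply: open_row_measurable.
exact/cf/interval_open.
Qed.

Lemma row_coord_le n (x : 'rV[R]_n) i : `|x ord0 i| <= `|x|.
Proof.
by rewrite [leRHS]/Num.norm /= mx_normrE; apply/bigmax_geP; right; exists (ord0, i).
Qed.

Lemma bounded_sub_cbox n (A : set 'rV[R]_n) : bounded_set A ->
  exists2 M : R, 0 < M & A `<=` obox (fun=> - M) (fun=> M).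
Proof.
move=> [M [Mr hM]]; exists (`|M| + 2) => [|x Ax i]; first by rewrite ltr_pwDr.
have /hM/(_ _ Ax) h : M < `|M| + 1 by rewrite (le_lt_trans (ler_norm _))// ltrDl.
rewrite -ltr_norml; apply: le_lt_trans (row_coord_le x i) _.
by apply: le_lt_trans h _; rewrite ltrD2l ltr1n.
Qed.

Lemma lebesgue_row_obox n (p q : 'I_n -> R) :
  (lebesgue_row R n (obox p q) < +oo)%E.
Proof.
rewrite (_ : obox p q = [set x | forall i, `]p i, q i[%classic (x ord0 i)]).
  rewrite (@lebesgue_row_box _ _ (fun i => `]p i, q i[%classic)); last first.
    by move=> i; exact: measurable_itv.
  rewrite ltey_eq; apply/orP; left; apply: prode_fin_num => i _.
  by rewrite lebesgue_measure_itv/=; case: ifP.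
by apply/seteqP; split => x h i; have := h i; rewrite /= in_itv.
Qed.

End boxes.

(** * Integration along coordinate lines *)

Section tonelli.
Context (R : realType).
Local Open Scope ereal_scope.
Implicit Types n : nat.

Lemma measurable_row_cons2 n (t : R) :
  measurable_fun [set: 'rV[R]_n] (fun x => row_cons (t, x)).
Proof.
by apply: (measurableT_comp (@measurable_row_cons R n)); exact: measurable_pair1.
Qed.

Lemma ge0_integral_row_cons n (f : 'rV[R]_n.+1 -> \bar R) :
  measurable_fun [set: 'rV[R]_n.+1] f -> (forall x, 0 <= f x) ->
  \int[lebesgue_row R n.+1]_x f x =
  \int[@lebesgue_measure R]_t \int[lebesgue_row R n]_x f (row_cons (t, x)).
Proof.
move=> mf f0.
rewrite (@ge0_integral_pushforward _ _ _ _ _ _ (@measurable_row_cons R n)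
  (@lebesgue_measure R \x lebesgue_row R n) setT f measurableT mf); last first.
  by move=> x _; exact: f0.
rewrite preimage_setT fubini_tonelli1// => [|x]; last exact: f0.
apply: (measurableT_comp mf); exact: measurable_row_cons.
Qed.

Lemma measurable_row_cons_integral n (f : 'rV[R]_n.+1 -> \bar R) :
  measurable_fun [set: 'rV[R]_n.+1] f -> (forall x, 0 <= f x) ->
  measurable_fun [set: R] (fun t => \int[lebesgue_row R n]_x f (row_cons (t, x))).
Proof.
move=> mf f0.
apply: (@measurable_fun_fubini_tonelli_F _ _ _ _ _ (lebesgue_row R n)
  (fun p => f (row_cons p))) => //.
by apply: (measurableT_comp mf); exact: measurable_row_cons.
Qed.

Lemma ge0_integral_row_cons_swap n (f : 'rV[R]_n.+1 -> \bar R) :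
  measurable_fun [set: 'rV[R]_n.+1] f -> (forall x, 0 <= f x) ->
  \int[lebesgue_row R n.+1]_x f x =
  \int[lebesgue_row R n]_x \int[@lebesgue_measure R]_t f (row_cons (t, x)).
Proof.
move=> mf f0; rewrite ge0_integral_row_cons//.
apply: (@fubini_tonelli _ _ _ _ _ (@lebesgue_measure R) (lebesgue_row R n)
  (fun p => f (row_cons p))) => //.
by apply: (measurableT_comp mf); exact: measurable_row_cons.
Qed.

Lemma measurable_row_cons_integral_swap n (f : 'rV[R]_n.+1 -> \bar R) :
  measurable_fun [set: 'rV[R]_n.+1] f -> (forall x, 0 <= f x) ->
  measurable_fun [set: 'rV[R]_n]
    (fun x => \int[@lebesgue_measure R]_t f (row_cons (t, x))).
Proof.
move=> mf f0.
apply: (@measurable_fun_fubini_tonelli_G _ _ _ _ _ (@lebesgue_measure R)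
  (fun p => f (row_cons p))) => //.
by apply: (measurableT_comp mf); exact: measurable_row_cons.
Qed.

Definition row_upd n (i : 'I_n) (x : 'rV[R]_n) (s : R) : 'rV[R]_n :=
  \row_j if j == i then s else x ord0 j.

Lemma row_upd_cons0 n (t s : R) (x : 'rV[R]_n) :
  row_upd ord0 (row_cons (t, x)) s = row_cons (s, x).
Proof.
apply/rowP => j; rewrite !mxE; case: unliftP => [k ->|->]; last by rewrite eqxx.
by rewrite eq_sym (negbTE (neq_lift _ _)).
Qed.

Lemma row_upd_cons_lift n (i : 'I_n) (t s : R) (x : 'rV[R]_n) :
  row_upd (lift ord0 i) (row_cons (t, x)) s = row_cons (t, row_upd i x s).
Proof.
apply/rowP => j; rewrite !mxE; case: unliftP => [k ->|->].
  by rewrite !mxE (inj_eq (@lift_inj _ _)).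
by rewrite (negbTE (neq_lift _ _)).
Qed.

(** By Tonelli, a nonnegative integral only depends on the integrals along the
    lines parallel to one axis.  This is how one-dimensional identities (the
    fundamental theorem of calculus below) become identities in the whole space
    without any integrability assumption. *)
Lemma eq_ge0_integral_lines n (i : 'I_n) (f g : 'rV[R]_n -> \bar R) :
  measurable_fun [set: 'rV[R]_n] f -> measurable_fun [set: 'rV[R]_n] g ->
  (forall x, 0 <= f x) -> (forall x, 0 <= g x) ->
  (forall x, \int[@lebesgue_measure R]_s f (row_upd i x s) =
             \int[@lebesgue_measure R]_s g (row_upd i x s)) ->
  \int[lebesgue_row R n]_x f x = \int[lebesgue_row R n]_x g x.
Proof.
elim: n i f g => [[]//|n ih] i f g mf mg f0 g0 fg.
case: (unliftP ord0 i) => [j ij|i0].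
  rewrite (ge0_integral_row_cons mf f0) (ge0_integral_row_cons mg g0).
  apply: eq_integral => t _; apply: (ih j).
  - by apply: (measurableT_comp mf); exact: measurable_row_cons2.
  - by apply: (measurableT_comp mg); exact: measurable_row_cons2.
  - by move=> x; exact: f0.
  - by move=> x; exact: g0.
  move=> x; have := fg (row_cons (t, x)); rewrite ij.
  under eq_integral do rewrite row_upd_cons_lift.
  by under [in RHS]eq_integral do rewrite row_upd_cons_lift.
rewrite (ge0_integral_row_cons_swap mf f0) (ge0_integral_row_cons_swap mg g0).
apply: eq_integral => x _; have := fg (row_cons (0%R, x)); rewrite i0.
under eq_integral do rewrite row_upd_cons0.
by under [in RHS]eq_integral do rewrite row_upd_cons0.
Qed.

End tonelli.

(** * Hoelder inequalities for nonnegative extended functions *)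

Section hoelder_ge0.
Context d (T : measurableType d) (R : realType) (mu : {measure set T -> \bar R}).
Local Open Scope ereal_scope.
Implicit Types f g : T -> \bar R.

Lemma measurable_poweR_comp f (r : R) : measurable_fun [set: T] f ->
  measurable_fun [set: T] (fun x => f x `^ r).
Proof. exact: (measurableT_comp (measurable_poweR r)). Qed.

Lemma ge0_integral0_poweRM f g (r s : R) : r != 0%R ->
  measurable_fun setT f -> measurable_fun setT g ->
  (forall x, 0 <= f x) -> (forall x, 0 <= g x) -> \int[mu]_x f x = 0 ->
  \int[mu]_x (f x `^ r * g x `^ s) = 0.
Proof.
move=> r0 mf mg f0 g0 If.
have fae : ae_eq mu setT f (cst 0).
  apply/(ae_eq_integral_abs mu measurableT mf); rewrite -[RHS]If.
  by apply: eq_integral => x _; rewrite gee0_abs.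
rewrite (@ge0_ae_eq_integral _ _ _ mu setT _ (cst 0)) ?integral0//.
- by apply: emeasurable_funM; exact: measurable_poweR_comp.
- by move=> x _; rewrite mule_ge0// poweR_ge0.
by apply: filterS fae => x /= fx _; rewrite fx// poweR0r// mul0e.
Qed.

(** Stated with exponents th and 1 - th on the functions and no finiteness
    assumption, so that it can be iterated on functions that are themselves
    integrals; when one of the integrals is 0 or infinite both sides are
    computed directly. *)
Lemma ge0_hoelder f g (th : R) : (0 <= th < 1)%R ->
  measurable_fun setT f -> measurable_fun setT g ->
  (forall x, 0 <= f x) -> (forall x, 0 <= g x) ->
  \int[mu]_x (f x `^ th * g x `^ (1 - th)) <=
  (\int[mu]_x f x) `^ th * (\int[mu]_x g x) `^ (1 - th).
Proof.
move=> /andP[]; rewrite le_eqVlt => /predU1P[<- _ _ _ _ g0|].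
  rewrite poweRe0 mul1e subr0 poweRe1 ?integral_ge0//.
  by under eq_integral do rewrite poweRe0 mul1e poweRe1//.
move=> th0 th1 mf mg f0 g0.
have sh0 : (0 < 1 - th)%R by rewrite subr_gt0.
have If0 : 0 <= \int[mu]_x f x by exact: integral_ge0.
have Ig0 : 0 <= \int[mu]_x g x by exact: integral_ge0.
have [If|If] := eqVneq (\int[mu]_x f x) 0.
  by rewrite ge0_integral0_poweRM ?gt_eqF ?mule_ge0 ?poweR_ge0.
have [Ig|Ig] := eqVneq (\int[mu]_x g x) 0.
  under eq_integral do rewrite muleC.
  by rewrite ge0_integral0_poweRM ?gt_eqF ?mule_ge0 ?poweR_ge0.
have [Ify|Ify] := eqVneq (\int[mu]_x f x) +oo.
  by rewrite Ify poweRyr ?gt_eqF// gt0_mulye ?leey// poweR_gt0// lt0e Ig.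
have [Igy|Igy] := eqVneq (\int[mu]_x g x) +oo.
  by rewrite Igy poweRyr ?(gt_eqF sh0)// gt0_muley ?leey// poweR_gt0// lt0e If.
have intf : mu.-integrable setT f.
  apply/integrableP; split => //; rewrite (eq_integral f) ?ltey//.
  by move=> x _; rewrite gee0_abs.
have intg : mu.-integrable setT g.
  apply/integrableP; split => //; rewrite (eq_integral g) ?ltey//.
  by move=> x _; rewrite gee0_abs.
have ff := integrable_ae measurableT intf.
have gf := integrable_ae measurableT intg.
pose F x := (fine (f x) `^ th)%R; pose G x := (fine (g x) `^ (1 - th))%R.
have mF : measurable_fun setT F.
  apply: (measurableT_comp (measurable_powR th)).
  exact: (measurableT_comp (fine_measurable measurableT)).
have mG : measurable_fun setT G.
  apply: (measurableT_comp (measurable_powR (1 - th))).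
  exact: (measurableT_comp (fine_measurable measurableT)).
have LE : \int[mu]_x (f x `^ th * g x `^ (1 - th)) = 'N[mu]_1[EFin \o (F \* G)%R].
  rewrite Lnorm1; apply: ge0_ae_eq_integral => //.
  - by apply: emeasurable_funM; exact: measurable_poweR_comp.
  - by do 2 apply: measurableT_comp => //; exact: measurable_funM.
  - by move=> x _; rewrite mule_ge0// poweR_ge0.
  near=> x => _; have fx : f x \is a fin_num by move: I; near: x.
  have gx : g x \is a fin_num by move: I; near: x.
  rewrite -(fineK fx) -(fineK gx) !poweR_EFin -EFinM /= ger0_norm//.
  by rewrite mulr_ge0// powR_ge0.
have PE (k : T -> \bar R) (r : R) : (0 < r)%R -> measurable_fun setT k ->
    (forall x, 0 <= k x) -> {ae mu, forall x, setT x -> k x \is a fin_num} ->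
    'N[mu]_(r^-1)%:E[EFin \o (fun x => fine (k x) `^ r)%R] = (\int[mu]_x k x) `^ r.
  move=> r0 mk k0 kf; rewrite unlock /= invrK; congr (_ `^ _).
  apply: ge0_ae_eq_integral => //.
  - apply/measurable_EFinP; apply: (measurableT_comp (measurable_powR _)).
    apply: (measurableT_comp (@normr_measurable R setT)).
    apply: (measurableT_comp (measurable_powR r)).
    exact: (measurableT_comp (fine_measurable measurableT)).
  apply: filterS kf => x /= /(_ I) kx _.
  rewrite ger0_norm ?powR_ge0// -powRrM divff ?gt_eqF// powRr1 ?fineK//.
  by rewrite fine_ge0.
rewrite LE -(PE f)// -(PE g)//; apply: hoelder => //.
- by rewrite invr_gt0.
- by rewrite invr_gt0.
- by rewrite !invrK subrKC.
Unshelve. all: by end_near. Qed.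

Lemma measurable_prode n (G : 'I_n -> T -> \bar R) :
  (forall i, measurable_fun setT (G i)) ->
  measurable_fun setT (fun x => \prod_i G i x).
Proof.
elim: n G => [G _|n ih G mG].
  by under eq_fun do rewrite big_ord0; exact: measurable_cst.
under eq_fun do rewrite big_ord_recl.
by apply: emeasurable_funM => //; exact: ih.
Qed.

(** Peeling off one factor leaves a product with exponents
    1/(n+2) = 1/(n+1) * (1 - 1/(n+2)). *)
Lemma ge0_hoelder_prod n (G : 'I_n.+1 -> T -> \bar R) :
  (forall i, measurable_fun setT (G i)) -> (forall i x, 0 <= G i x) ->
  \int[mu]_x (\prod_i G i x) `^ n.+1%:R^-1 <=
  (\prod_i \int[mu]_x G i x) `^ n.+1%:R^-1.
Proof.
elim: n G => [|n ih] G mG G0.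
  rewrite invr1 big_ord1 poweRe1 ?integral_ge0//.
  by under eq_integral do rewrite big_ord1 poweRe1//.
under eq_integral do rewrite big_ord_recl.
rewrite big_ord_recl poweRM ?prode_ge0 ?integral_ge0//; last first.
  by move=> i _; exact: integral_ge0.
pose th : R := (n.+2%:R^-1)%R.
have thE : (n.+1%:R^-1 * (1 - th) = n.+2%:R^-1 :> R)%R.
  rewrite /th -!natr1; field.
  by rewrite !natr1 !pnatr_eq0.
pose P x := \prod_(i < n.+1) G (lift ord0 i) x.
have P0 x : 0 <= P x by exact: prode_ge0.
have mP : measurable_fun setT P by exact: measurable_prode.
have -> : \int[mu]_x (G ord0 x * P x) `^ n.+2%:R^-1 =
  \int[mu]_x (G ord0 x `^ th * (P x `^ n.+1%:R^-1) `^ (1 - th)).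
  by apply: eq_integral => x _; rewrite poweRM// -poweRrM thE.
apply: le_trans (ge0_hoelder _ _ _ _ _) _ => //.
- by rewrite invr_ge0 ler0n invf_lt1 ?ltr1n.
- exact: measurable_poweR_comp.
- by move=> x; exact: poweR_ge0.
apply: lee_pmul => //; rewrite ?poweR_ge0//.
rewrite -thE [leRHS]poweRrM; apply: gt0_ler_poweR.
- by rewrite subr_ge0 invf_le1 ?ler1n.
- by rewrite in_itv /= leey andbT integral_ge0// => x _; exact: poweR_ge0.
- by rewrite in_itv /= leey andbT poweR_ge0.
exact: ih.
Qed.

End hoelder_ge0.

(** * Gagliardo's inequality *)

Section gagliardo.
Context (R : realType).
Local Open Scope ereal_scope.
Local Notation leb := (@lebesgue_measure R).

Lemma ge0_integral_row1 (f : 'rV[R]_1 -> \bar R) :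
  measurable_fun setT f -> (forall x, 0 <= f x) -> forall x,
  \int[lebesgue_row R 1]_x f x = \int[leb]_s f (row_upd ord0 x s).
Proof.
move=> mf f0 x; rewrite ge0_integral_row_cons//; apply: eq_integral => t _.
rewrite integral_dirac//; last first.
  by apply: (measurableT_comp mf); exact: measurable_row_cons2.
rewrite diracE mem_set// mul1e; congr f; apply/rowP => i; rewrite !mxE.
by case: unliftP => [[]//|->]; rewrite ord1.
Qed.

(** Splitting of the critical exponent in dimension n+3: one factor carries the
    critical exponent of dimension n+2, to which the induction hypothesis
    applies, the other one only sees the bound h. *)
Lemma poweR_invn_split (n : nat) (w h : \bar R) : 0 <= w -> w <= h ->
  w `^ (n.+3%:R / n.+2%:R) <=
  (w `^ (n.+2%:R / n.+1%:R)) `^ (1 - n.+2%:R^-1) * h `^ n.+2%:R^-1.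
Proof.
move=> w0 wh.
have n1 : (n%:R + 1 != 0 :> R)%R by rewrite natr1 pnatr_eq0.
have n2 : (n%:R + 1 + 1 != 0 :> R)%R by rewrite !natr1 pnatr_eq0.
have -> : (n.+3%:R / n.+2%:R = 1 + n.+2%:R^-1 :> R)%R.
  by rewrite -!natr1; field.
rewrite poweRD; last by rewrite add_neq0_poweRD_def// paddr_eq0.
apply: lee_pmul; rewrite ?poweR_ge0//.
  rewrite -poweRrM (_ : n.+2%:R / n.+1%:R * (1 - n.+2%:R^-1) = 1 :> R)%R//.
  by rewrite -!natr1; field; rewrite n2.
apply: gt0_ler_poweR => //; rewrite ?invr_ge0// in_itv /= leey andbT//.
exact: le_trans wh.
Qed.

(** Induction on the dimension.  Fix the first coordinate t.  On the slice, w is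
    bounded by the integral h of g_0 along the first axis, which does not depend
    on t; Hoelder separates a power of h from the critical power of w in one
    dimension less, which the induction hypothesis bounds by the product of the
    integrals of the other g_i over the slice.  Hoelder for products then
    integrates this in t. *)
Lemma gagliardo n (w : 'rV[R]_n.+2 -> \bar R)
    (g : 'I_n.+2 -> 'rV[R]_n.+2 -> \bar R) :
  measurable_fun setT w -> (forall i, measurable_fun setT (g i)) ->
  (forall x, 0 <= w x) -> (forall i x, 0 <= g i x) ->
  (forall i x, w x <= \int[leb]_s g i (row_upd i x s)) ->
  \int[lebesgue_row R n.+2]_x w x `^ (n.+2%:R / n.+1%:R) <=
  (\prod_i \int[lebesgue_row R n.+2]_x g i x) `^ n.+1%:R^-1.
Proof.
elim: n w g => [|n ih] w g mw mg w0 g0 wg.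
- rewrite ge0_integral_row_cons//; last 2 first.
  + exact: measurable_poweR_comp.
  + by move=> x; exact: poweR_ge0.
  rewrite invr1 big_ord_recl big_ord1 poweRe1; last first.
    by rewrite mule_ge0// integral_ge0.
  pose h x := \int[leb]_t g ord0 (row_cons (t, x)).
  have mh : measurable_fun setT h by exact: measurable_row_cons_integral_swap.
  have h0 x : 0 <= h x by exact: integral_ge0.
  pose G t := \int[lebesgue_row R 1]_x g (lift ord0 ord0) (row_cons (t, x)).
  have mG : measurable_fun setT G by exact: measurable_row_cons_integral.
  have G0 x : 0 <= G x by exact: integral_ge0.
  have Ih : \int[lebesgue_row R 2]_x g ord0 x = \int[lebesgue_row R 1]_x h x.
    exact: ge0_integral_row_cons_swap.
  have IG : \int[lebesgue_row R 2]_x g (lift ord0 ord0) x = \int[leb]_t G t.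
    exact: ge0_integral_row_cons.
  rewrite Ih IG -ge0_integralZl//; last exact: integral_ge0.
  apply: ge0_le_integral => //.
  + move=> t _; apply: integral_ge0 => x _; exact: poweR_ge0.
  + apply: (@measurable_row_cons_integral _ _ (fun x => w x `^ _)).
      exact: measurable_poweR_comp.
    by move=> x; exact: poweR_ge0.
  + exact: emeasurable_funM.
  + move=> t _; rewrite -ge0_integralZr//.
    apply: ge0_le_integral => //.
    * by move=> x _; exact: poweR_ge0.
    * apply: measurable_poweR_comp; apply: (measurableT_comp mw).
      exact: measurable_row_cons2.
    * exact: emeasurable_funM.
    * move=> x _; rewrite mulr1 (_ : 2%:R = 1 + 1)%R; last by rewrite -mulr2n.
      rewrite poweRD ?add_neq0_poweRD_def// poweRe1//.
      apply: lee_pmul => //.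
        by have := wg ord0 (row_cons (t, x)); under eq_integral do rewrite row_upd_cons0.
      rewrite /G (ge0_integral_row1 _ _ x)//; last first.
        by apply: (measurableT_comp (mg _)); exact: measurable_row_cons2.
      have := wg (lift ord0 ord0) (row_cons (t, x)).
      by under eq_integral do rewrite row_upd_cons_lift.
- rewrite ge0_integral_row_cons//; last 2 first.
  + exact: measurable_poweR_comp.
  + by move=> x; exact: poweR_ge0.
  pose h x := \int[leb]_t g ord0 (row_cons (t, x)).
  have mh : measurable_fun setT h by exact: measurable_row_cons_integral_swap.
  have h0 x : 0 <= h x by exact: integral_ge0.
  pose G i t := \int[lebesgue_row R n.+2]_x g (lift ord0 i) (row_cons (t, x)).
  have mG i : measurable_fun setT (G i) by exact: measurable_row_cons_integral.
  have G0 i x : 0 <= G i x by exact: integral_ge0.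
  have Ih : \int[lebesgue_row R n.+3]_x g ord0 x = \int[lebesgue_row R n.+2]_x h x.
    exact: ge0_integral_row_cons_swap.
  have IG i : \int[lebesgue_row R n.+3]_x g (lift ord0 i) x = \int[leb]_t G i t.
    exact: ge0_integral_row_cons.
  rewrite big_ord_recl Ih poweRM ?integral_ge0 ?prode_ge0//; last first.
    by move=> i _; exact: integral_ge0.
  under [X in _ <= _ * X `^ _]eq_bigr do rewrite IG.
  apply: (@le_trans _ _ (\int[leb]_t ((\int[lebesgue_row R n.+2]_x h x) `^ n.+2%:R^-1
      * (\prod_i G i t) `^ n.+2%:R^-1))); last first.
    rewrite ge0_integralZl ?poweR_ge0//; last 2 first.
    * by apply: measurable_poweR_comp; exact: measurable_prode.
    * by move=> t _; exact: poweR_ge0.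
    by apply: lee_pmul; rewrite ?poweR_ge0 ?ge0_hoelder_prod//
       integral_ge0// => t _; exact: poweR_ge0.
  apply: ge0_le_integral => //.
  + move=> t _; apply: integral_ge0 => x _; exact: poweR_ge0.
  + apply: (@measurable_row_cons_integral _ _ (fun x => w x `^ _)).
      exact: measurable_poweR_comp.
    by move=> x; exact: poweR_ge0.
  + apply: emeasurable_funM => //.
    by apply: measurable_poweR_comp; exact: measurable_prode.
  + move=> t _; pose wt x := w (row_cons (t, x)).
    have mwt : measurable_fun setT wt.
      by apply: (measurableT_comp mw); exact: measurable_row_cons2.
    apply: (@le_trans _ _ (\int[lebesgue_row R n.+2]_x
      ((wt x `^ (n.+2%:R / n.+1%:R)) `^ (1 - n.+2%:R^-1) *
        h x `^ (1 - (1 - n.+2%:R^-1))))).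
      apply: ge0_le_integral => //.
      * by move=> x _; exact: poweR_ge0.
      * exact: measurable_poweR_comp.
      * by apply: emeasurable_funM; do ! apply: measurable_poweR_comp.
      * move=> x _; rewrite opprB addrCA subrr addr0.
        apply: poweR_invn_split => //.
        have := wg ord0 (row_cons (t, x)).
        by under eq_integral do rewrite row_upd_cons0.
    apply: (le_trans (@ge0_hoelder _ _ _ (lebesgue_row R n.+2)
      (fun x => wt x `^ _) h _ _ _ _ _ _)) => //.
    * by rewrite subr_ge0 invf_le1 ?ltr0n// ler1n gtrDl oppr_lt0 invr_gt0 ltr0n.
    * exact: measurable_poweR_comp.
    * by move=> x; exact: poweR_ge0.
    rewrite muleC opprB addrCA subrr addr0.
    apply: lee_pmul; rewrite ?poweR_ge0//.
    have thE : (n.+2%:R^-1 = n.+1%:R^-1 * (1 - n.+2%:R^-1) :> R)%R.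
      by rewrite -!natr1; field; rewrite !natr1 !pnatr_eq0.
    rewrite [X in _ <= _ `^ X]thE [leRHS]poweRrM; apply: gt0_ler_poweR.
    * by rewrite subr_ge0 invf_le1 ?ler1n.
    * by rewrite in_itv /= leey andbT integral_ge0// => x _; exact: poweR_ge0.
    * by rewrite in_itv /= leey andbT poweR_ge0.
    apply: ih => //.
    * by move=> i; apply: (measurableT_comp (mg _)); exact: measurable_row_cons2.
    * by move=> x; exact: w0.
    * move=> i x; have := wg (lift ord0 i) (row_cons (t, x)).
      by under eq_integral do rewrite row_upd_cons_lift.
Qed.

End gagliardo.

(** * Sobolev inequality for compactly supported C^1 functions *)

Section powers.
Context (R : realType).
Implicit Types (p y : R).

Lemma is_derive_cvg (V W : normedModType R) (f : V -> W) (a v : V) (l : W) :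
  h^-1 *: (f (h *: v + a) - f a) @[h --> (0:R)^'] --> l -> is_derive a v f l.
Proof.
move=> fl; apply: DeriveDef; first by apply/cvg_ex; exists l.
exact: cvg_lim fl.
Qed.

Lemma continuous_norm_powR p : 0 <= p -> continuous (fun y => `|y| `^ p).
Proof.
rewrite le_eqVlt => /predU1P[<-|p0] y.
  under eq_fun do rewrite powRr0; exact: cvg_cst.
have [->|y0] := eqVneq y 0.
  apply/cvgrPdist_le => e e0; rewrite normr0 powR0 ?gt_eqF//.
  have ep0 : 0 < e `^ p^-1 by exact: powR_gt0.
  near=> z; rewrite sub0r normrN ger0_norm ?powR_ge0//.
  have zep : `|z| <= e `^ p^-1.
    near: z; apply/nbhs_normP; exists (e `^ p^-1) => //= w.
    by rewrite /ball_/= sub0r normrN => /ltW.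
  apply: le_trans (ge0_ler_powR (ltW p0) _ _ zep) _; rewrite ?nnegrE ?powR_ge0//.
  by rewrite -powRrM mulVf ?gt_eqF// powRr1// ltW.
apply: (@continuous_comp _ _ _ (fun z : R => `|z|) (fun z : R => z `^ p)).
  exact: norm_continuous.
apply: differentiable_continuous; apply/derivable1_diffP.
by apply: derivable_powR; rewrite in_itv /= andbT normr_gt0.
Unshelve. all: by end_near. Qed.

(** The odd extension of the power y^p: unlike |y|^p it is differentiable
    everywhere as soon as p >= 1. *)
Definition odd_powR p y := y * `|y| `^ (p - 1).

Lemma norm_odd_powR p y : 0 < p -> `|odd_powR p y| = `|y| `^ p.
Proof.
by move=> p0; rewrite normrM (ger0_norm (powR_ge0 _ _)) mulr_powRB1.
Qed.

Lemma is_derive_odd_powR p y : 1 <= p ->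
  is_derive y 1 (odd_powR p) (p * `|y| `^ (p - 1)).
Proof.
rewrite le_eqVlt => /predU1P[<-|p1].
  rewrite subrr powRr0 mulr1 (_ : odd_powR 1 = id); first exact: is_derive_id.
  by apply/funext => z; rewrite /odd_powR subrr powRr0 mulr1.
have p0 : 0 < p by exact: lt_trans p1.
have pos (z : R) : 0 < z -> is_derive z 1 (odd_powR p) (p * `|z| `^ (p - 1)).
  move=> z0; rewrite gtr0_norm//.
  apply: near_eq_is_derive (is_derive1_powR p z0).
  near=> w; have w0 : 0 < w by near: w; exact: lt_nbhsr.
  by rewrite /odd_powR gtr0_norm// mulr_powRB1 ?ltW.
have [y0|y0|->] := ltgtP y 0.
- have -> : odd_powR p = - (odd_powR p \o -%R).
    by apply/funext => z; rewrite /odd_powR /= fctE /= normrN mulNr opprK.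
  have ny0 : 0 < - y by rewrite oppr_gt0.
  apply: is_derive_eq (is_deriveN (is_derive1_comp (pos _ ny0)
    (is_deriveNid y 1))) _.
  by rewrite mulrN1 opprK normrN.
- exact: pos.
- apply: is_derive_cvg; rewrite normr0 powR0 ?gt_eqF ?subr_gt0// mulr0.
  have p10 : 0 <= p - 1 by rewrite subr_ge0 ltW.
  have := @continuous_norm_powR (p - 1) p10 0.
  rewrite /continuous_at normr0 powR0 ?gt_eqF ?subr_gt0// => c0.
  apply: (@cvg_trans _ ((fun y => `|y| `^ (p - 1)) @ 0^')); last first.
    by apply: cvg_trans c0; apply: cvg_app; exact: nbhs_dnbhs.
  apply: near_eq_cvg; near=> h.
  have h0 : h != 0 by near: h; exact: nbhs_dnbhs_neq.
  rewrite /odd_powR addr0 mul0r subr0 scaler1.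
  by rewrite -[RHS]/(h^-1 * (h * _)) mulKf.
Unshelve. all: by end_near. Qed.

Lemma measurable_norm_powR d (T : measurableType d) (f : T -> R) p :
  measurable_fun setT f -> measurable_fun setT (fun x => `|f x| `^ p).
Proof.
move=> mf; apply: (measurableT_comp (measurable_powR p)).
exact: (measurableT_comp (@normr_measurable R setT)).
Qed.

End powers.

Section line.
Context (R : realType).
Local Notation leb := (@lebesgue_measure R).
Implicit Types (M x : R) (h k : R -> R).

Lemma is_derive_continuous h k : (forall s : R, is_derive s 1 h (k s)) ->
  continuous h.
Proof.
move=> dh s; apply: differentiable_continuous; apply/derivable1_diffP.
exact: ex_derive.
Qed.

Lemma integral_derive_itv h k (a b : R) : a < b ->
  (forall s : R, is_derive s 1 h (k s)) -> continuous k ->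
  (\int[leb]_(s in `[a, b]) (k s)%:E = (h b - h a)%:E)%E.
Proof.
move=> ab dh ck; have ch := is_derive_continuous dh.
rewrite EFinB; apply: continuous_FTC2 => //.
- exact: continuous_subspaceT.
- split.
  + by move=> s _; exact: ex_derive.
  + exact/cvg_at_right_filter/ch.
  + exact/cvg_at_left_filter/ch.
- by move=> s _; rewrite derive1E; exact: derive_val.
Qed.

Lemma norm_le_integral_derive h k M :
  (forall s : R, is_derive s 1 h (k s)) -> continuous k ->
  (forall s, M <= `|s| -> h s = 0) -> forall x,
  (`|h x|%:E <= \int[leb]_s `|k s|%:E)%E.
Proof.
move=> dh ck h0 x.
have mk : measurable_fun setT k by exact: continuous_measurable_fun.
pose a := - (`|M| + `|x| + 1).
have ax : a < x.
  rewrite /a ltrNl; apply: le_lt_trans (ler_norm _) _; rewrite normrN.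
  by rewrite -addrA addrCA ltrDl ltr_wpDl.
have ha : h a = 0.
  apply: h0; rewrite /a normrN ger0_norm ?addr_ge0//.
  by rewrite -addrA (le_trans (ler_norm M))// lerDl addr_ge0.
have := integral_derive_itv ax dh ck; rewrite ha subr0 -abse_EFin => <-.
apply: le_trans (le_abse_integral _ _ _) _ => //.
  by apply/measurable_EFinP; exact: measurable_funTS.
apply: ge0_subset_integral => //.
apply/measurable_EFinP; exact: (measurableT_comp (@normr_measurable R setT)).
Qed.

(** The integral over the line of the derivative of a compactly supported
    function vanishes.  Phrased with positive and negative parts, it can be
    integrated over the remaining variables by eq_ge0_integral_lines. *)
Lemma integral_derive_pos_neg h k M :
  (forall s : R, is_derive s 1 h (k s)) -> continuous k ->
  (forall s, M <= `|s| -> h s = 0) -> (forall s, M <= `|s| -> k s = 0) ->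
  (\int[leb]_s ((EFin \o k)^\+ s) = \int[leb]_s ((EFin \o k)^\- s))%E.
Proof.
move=> dh ck h0 k0.
have mk : measurable_fun setT k by exact: continuous_measurable_fun.
pose a := `|M| + 1.
have aM : M <= a by rewrite (le_trans (ler_norm M))// lerDl.
have a0 : 0 < a by rewrite ltr_wpDl.
have /integral_derive_itv/(_ dh ck) : - a < a by rewrite gtrN.
rewrite !h0 ?subrr ?normrN ?(ger0_norm (ltW a0))//.
have I : leb.-integrable `[- a, a] (EFin \o k).
  apply: continuous_compact_integrable; first exact: segment_compact.
  exact: continuous_subspaceT.
rewrite integralE => E.
have mI : measurable (`[- a, a]%classic : set (measurableTypeR R)).
  exact: measurable_itv.
have fp := integrable_pos_fin_num mI I.
have fn := integrable_neg_fin_num mI I.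
have {}E : ((\int[leb]_(s in `[(- a)%R, a]) (EFin \o k)^\+ s) -
            (\int[leb]_(s in `[(- a)%R, a]) (EFin \o k)^\- s) = 0)%E by exact: E.
have {}E : (\int[leb]_(s in `[(- a)%R, a]) (EFin \o k)^\+ s =
            \int[leb]_(s in `[(- a)%R, a]) (EFin \o k)^\- s)%E.
  rewrite -[LHS]fineK// -[RHS]fineK//; congr EFin; apply/eqP.
  by rewrite -subr_eq0 -fineB// E.
have out s : s \notin `[- a, a]%classic -> k s = 0.
  move=> /negP sa; apply: k0; rewrite leNgt; apply/negP => sM; apply: sa.
  rewrite inE /= in_itv /= -ler_norml; exact: le_trans (ltW sM) aM.
have ext (f : R -> \bar R) : (forall s, k s = 0 -> f s = 0%E) ->
    (\int[leb]_s f s = \int[leb]_(s in `[(- a)%R, a]) f s)%E.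
  move=> f0; rewrite [RHS]integral_mkcond; apply: eq_integral => s _.
  by rewrite patchE; case: ifPn => // /out/f0.
rewrite (ext _ _) ?(ext (EFin \o k)^\-%E) //.
- by move=> s ks; rewrite funenegE /= ks oppr0 maxxx.
- by move=> s ks; rewrite funeposE /= ks maxxx.
Qed.

End line.

Section directional.
Context (R : realType) (n : nat).
Implicit Types (u : 'rV[R]_n -> R) (x : 'rV[R]_n) (i : 'I_n).

Lemma row_updE i x (s : R) :
  row_upd i x s = (s - x ord0 i) *: delta_mx ord0 i + x.
Proof.
apply/rowP => j; rewrite !mxE eqxx /=; case: eqP => [->|_].
  by rewrite mulr1 subrK.
by rewrite mulr0 add0r.
Qed.

Lemma row_upd_id i x : row_upd i x (x ord0 i) = x.
Proof. by rewrite row_updE subrr scale0r add0r. Qed.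

Lemma continuous_row_upd i x : continuous (row_upd i x).
Proof.
rewrite (_ : row_upd i x =
    (fun s => (s - x ord0 i) *: delta_mx ord0 i + x)); last first.
  by apply/funext => s; exact: row_updE.
move=> s; apply: cvgD; last exact: cvg_cst.
apply: cvgZ; last exact: cvg_cst.
by apply: cvgB; [exact: cvg_id|exact: cvg_cst].
Qed.

Lemma is_derive_row_upd u i x (s : R) :
  derivable u (row_upd i x s) (delta_mx ord0 i) ->
  is_derive s 1 (fun s => u (row_upd i x s)) (pderiv i u (row_upd i x s)).
Proof.
move=> du; apply: is_derive_cvg.
rewrite (_ : (fun h : R => _) =
  (fun h => h^-1 *: ((u \o shift (row_upd i x s)) (h *: delta_mx ord0 i)
            - u (row_upd i x s)))); first exact: du.
apply/funext => h; congr (_ *: (u _ - _)).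
by rewrite /= !row_updE addrA -scalerDl scaler1 addrA.
Qed.

(** With a cube as support, the restriction to any line vanishes for large
    parameters, uniformly in the line, and so do the derivatives. *)
Record C1_cube (M : R) u : Prop := {
  C1_continuous : continuous u;
  C1_derivable : forall i x, derivable u x (delta_mx ord0 i);
  C1_continuous_pderiv : forall i, continuous (pderiv i u);
  C1_support : forall x i, M <= `|x ord0 i| -> u x = 0;
  C1_support_pderiv : forall j x i, M <= `|x ord0 i| -> pderiv j u x = 0 }.

End directional.

Section sobolev_C1.
Context (R : realType).
Local Notation leb := (@lebesgue_measure R).
Local Notation mu := (@lebesgue_row R).

Lemma C1_line n M (u : 'rV[R]_n -> R) i x : C1_cube M u -> forall s : R,
  is_derive s 1 (fun s => u (row_upd i x s)) (pderiv i u (row_upd i x s)).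
Proof.
by move=> Cu s; apply: is_derive_row_upd; exact: (C1_derivable Cu).
Qed.

Lemma row_updii n (x : 'rV[R]_n) i s : row_upd i x s ord0 i = s.
Proof. by rewrite mxE eqxx. Qed.

(** The function w = |u|^p to which Gagliardo's inequality is applied: the
    fundamental theorem of calculus for the odd power of u along a line. *)
Lemma C1_norm_powR_line n M (u : 'rV[R]_n -> R) (p : R) i x : C1_cube M u ->
  1 <= p ->
  ((`|u x| `^ p)%:E <= \int[leb]_s
    (p * `|u (row_upd i x s)| `^ (p - 1) * `|pderiv i u (row_upd i x s)|)%:E)%E.
Proof.
move=> Cu p1; have p0 : 0 < p by exact: lt_le_trans p1.
have cupd := @continuous_row_upd R n i x.
have cu : continuous (fun s => u (row_upd i x s)).
  by move=> s; apply: continuous_comp (cupd s) _; exact: (C1_continuous Cu).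
have cdu : continuous (fun s => pderiv i u (row_upd i x s)).
  move=> s; apply: continuous_comp (cupd s) _.
  exact: (C1_continuous_pderiv Cu).
have := @norm_le_integral_derive _ (fun s => odd_powR p (u (row_upd i x s)))
  (fun s => p * `|u (row_upd i x s)| `^ (p - 1) * pderiv i u (row_upd i x s)) M
  _ _ _ (x ord0 i).
rewrite row_upd_id norm_odd_powR//.
under eq_integral do rewrite !normrM (ger0_norm (ltW p0)) (ger0_norm (powR_ge0 _ _)).
apply.
- move=> s; apply: is_derive1_comp; last exact: C1_line Cu _.
  exact: is_derive_odd_powR.
- move=> s; apply: cvgM; last exact: cdu.
  apply: cvgM; first exact: cvg_cst.
  apply: (@continuous_comp _ _ _ _ (fun y => `|y| `^ (p - 1))); first exact: cu.
  by apply: continuous_norm_powR; rewrite subr_ge0.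
- move=> s Ms; rewrite (C1_support Cu (i := i)) ?row_updii//.
  by rewrite /odd_powR mul0r.
Qed.

Lemma integral_pderiv_pos_neg n M (u : 'rV[R]_n -> R) i : C1_cube M u ->
  (\int[mu n]_x (EFin \o pderiv i u)^\+ x =
   \int[mu n]_x (EFin \o pderiv i u)^\- x)%E.
Proof.
move=> Cu.
have mdu : measurable_fun setT (EFin \o pderiv i u).
  apply/measurable_EFinP; apply: continuous_row_measurable.
  exact: (C1_continuous_pderiv Cu).
apply: (eq_ge0_integral_lines (i := i)).
- exact: measurable_funepos.
- exact: measurable_funeneg.
- by move=> x; exact: funepos_ge0.
- by move=> x; exact: funeneg_ge0.
move=> x; have := @integral_derive_pos_neg _ (fun s => u (row_upd i x s))
  (fun s => pderiv i u (row_upd i x s)) M.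
under [in LHS]eq_integral do rewrite funeposE.
under [in RHS]eq_integral do rewrite funenegE.
under [in X in _ -> X = _]eq_integral do rewrite funeposE.
under [in X in _ -> _ = X]eq_integral do rewrite funenegE.
apply.
- exact: C1_line Cu.
- move=> s; apply: continuous_comp (@continuous_row_upd R n i x s) _.
  exact: (C1_continuous_pderiv Cu).
- by move=> s Ms; apply: (C1_support Cu (i := i)); rewrite row_updii.
- by move=> s Ms; apply: (C1_support_pderiv Cu i (i := i)); rewrite row_updii.
Qed.

Lemma C1_bounded n M (u : 'rV[R]_n -> R) : C1_cube M u ->
  exists2 B : R, 0 <= B & forall x, `|u x| <= B.
Proof.
move=> Cu.
have K : compact (cbox (fun=> - M) (fun=> M) : set 'rV[R]_n).
  rewrite (_ : cbox _ _ = [set v : 'rV[R]_n | forall i, `[- M, M]%classic (v ord0 i)]).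
    by apply: (@rV_compact _ _ (fun=> `[- M, M]%classic)) => _; exact: segment_compact.
  by apply/seteqP; split => x h i; have := h i; rewrite /= in_itv.
have := @continuous_compact _ _ u _ _ K.
have cK : {within cbox (fun=> - M) (fun=> M), continuous u}.
  by apply: continuous_subspaceT; exact: (C1_continuous Cu).
move=> /(_ cK) /compact_bounded[B [Br hB]].
exists (`|B| + 1) => [|x]; first by rewrite addr_ge0.
have [xK|xK] := pselect (cbox (fun=> - M) (fun=> M) x).
  by apply: hB; [rewrite (le_lt_trans (ler_norm _))// ltrDl|exists x].
have [i hi] : exists i, ~ (- M <= x ord0 i <= M).
  by apply: contrapT => h; apply: xK => i; apply: contrapT => hi; apply: h; exists i.
rewrite (C1_support Cu (i := i)) ?normr0 ?addr_ge0//.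
by rewrite leNgt; apply/negP => h; apply: hi; rewrite -ler_norml ltW.
Qed.

Lemma C1_out n M (u : 'rV[R]_n -> R) x : C1_cube M u ->
  ~ obox (fun=> - M) (fun=> M) x -> u x = 0.
Proof.
move=> Cu xK.
have [i hi] : exists i, ~ (- M < x ord0 i < M).
  by apply: contrapT => h; apply: xK => i; apply: contrapT => hi; apply: h; exists i.
apply: (C1_support Cu (i := i)).
by rewrite leNgt; apply/negP => h; apply: hi; rewrite -ltr_norml.
Qed.

Lemma C1_integral_powR_lty n M (u : 'rV[R]_n -> R) (p : R) : C1_cube M u ->
  0 < p -> (\int[mu n]_x `|(u x)%:E| `^ p < +oo)%E.
Proof.
move=> Cu p0; have [B B0 uB] := C1_bounded Cu.
pose K : set 'rV[R]_n := obox (fun=> - M) (fun=> M).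
have mK : measurable K by exact: measurable_obox.
have mu' : measurable_fun setT (fun x => `|(u x)%:E| `^ p)%E.
  apply: measurable_poweR_comp; do 2 apply: measurableT_comp => //.
  by apply: continuous_row_measurable; exact: (C1_continuous Cu).
rewrite (_ : (\int[mu n]_x `|(u x)%:E| `^ p)%E =
             (\int[mu n]_(x in K) `|(u x)%:E| `^ p)%E); last first.
  rewrite [RHS]integral_mkcond; apply: eq_integral => x _.
  rewrite patchE; case: ifPn => // /negP xK.
  rewrite (C1_out Cu) ?normr0 ?powR0 ?gt_eqF//= ?normr0 ?powR0 ?gt_eqF//.
  by move=> h; apply: xK; rewrite inE.
apply: (@le_lt_trans _ _ (\int[mu n]_(x in K) (B `^ p)%:E)%E).
  apply: ge0_le_integral => //.
  - by move=> x _; exact: poweR_ge0.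
  - exact: measurable_funTS.
  - move=> x _; rewrite /= lee_fin ge0_ler_powR ?nnegrE//; exact: ltW.
rewrite integral_cst//; have := @lebesgue_row_obox R n (fun=> - M) (fun=> M).
rewrite -/K => h; rewrite lte_mul_pinfty// ?lee_fin ?powR_ge0//.
Qed.

Lemma lee_prode (I : Type) (r : seq I) (f g : I -> \bar R) :
  (forall i, 0 <= f i)%E -> (forall i, f i <= g i)%E ->
  (\prod_(i <- r) f i <= \prod_(i <- r) g i)%E.
Proof.
move=> f0 fg; elim: r => [|i r ih]; first by rewrite !big_nil.
by rewrite !big_cons; apply: lee_pmul => //; apply: prode_ge0.
Qed.

(** Gagliardo's inequality for |u|^g with g = 2 (d-1)/d, whose critical power is
    |u|^2.  Hoelder bounds each of the integrals of g |u|^(g-1) |d_i u| by a power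
    of A = int |u|^2 times the L^q norm of d_i u, q = 2d/(d+2); A is finite, so
    that this power can be divided out.  Here d = n + 2, and g <= 2 gives the
    constant. *)
Lemma sobolev_C1 n M (u : 'rV[R]_n.+2 -> R) : C1_cube M u ->
  ('N[mu n.+2]_2%:E[EFin \o u] <=
   2%:E * \sum_i 'N[mu n.+2]_(2 * n.+2%:R / n.+4%:R)%:E[EFin \o pderiv i u])%E.
Proof.
move=> Cu; set q := 2 * _ / _.
have [nn0 n1 n2 n4] : [/\ 0 <= n%:R :> R, n%:R + 1 != 0 :> R, n%:R + 1 + 1 != 0 :> R &
    n%:R + 1 + 1 + 1 + 1 != 0 :> R].
  by split; rewrite ?natr1 ?pnatr_eq0.
have q0 : 0 < q by rewrite divr_gt0// mulr_gt0.
pose g : R := 2 * n.+1%:R / n.+2%:R.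
pose th : R := n%:R / (2 * n.+2%:R).
have g1 : 1 <= g.
  by rewrite /g ler_pdivlMr// mul1r -!natr1; lra.
have g2 : g <= 2.
  by rewrite /g ler_pdivrMr// -!natr1; lra.
have g0 : 0 < g by lra.
have thg : 2 * th = g - 1.
  by rewrite /th /g -!natr1; field.
have thq : q * (1 - th) = 1.
  by rewrite /th /q -!natr1; field; rewrite n2 n4.
have qth : q^-1 = 1 - th.
  by rewrite -[RHS](mulKf (lt0r_neq0 q0)) thq mulr1.
have th0 : 0 <= th by rewrite /th divr_ge0// mulr_ge0.
have th1 : th < 1.
  by rewrite /th ltr_pdivrMr ?mulr_gt0// mul1r -!natr1; lra.
have mU : measurable_fun setT u.
  by apply: continuous_row_measurable; exact: (C1_continuous Cu).
have mdU i : measurable_fun setT (pderiv i u).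
  by apply: continuous_row_measurable; exact: (C1_continuous_pderiv Cu).
set S := (\sum_i _)%E.
have S0 : (0 <= S)%E by apply: sume_ge0 => i _; exact: Lnorm_ge0.
have [->|Sfin] := eqVneq S +oo%E; first by rewrite gt0_muley ?leey.
pose A := (\int[mu n.+2]_x `|(u x)%:E| `^ 2)%E.
have A0 : (0 <= A)%E by apply: integral_ge0 => x _; exact: poweR_ge0.
have Afin : A \is a fin_num.
  by rewrite ge0_fin_numE//; exact: C1_integral_powR_lty Cu _.
pose G i x := (g * `|u x| `^ (g - 1) * `|pderiv i u x|)%:E.
have mG i : measurable_fun setT (G i).
  apply/measurable_EFinP; apply: measurable_funM; last exact: measurableT_comp.
  by apply: measurable_funM => //; exact: measurable_norm_powR.
have G0 i x : (0 <= G i x)%E by rewrite lee_fin !mulr_ge0 ?powR_ge0// ltW.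
have IG i : (\int[mu n.+2]_x G i x <= g%:E * (A `^ th * S))%E.
  rewrite (_ : G i = fun x => (g%:E *
    ((`|(u x)%:E| `^ 2) `^ th * (`|(pderiv i u x)%:E| `^ q) `^ (1 - th)))%E);
    last first.
    apply/funext => x; rewrite /G -!poweRrM thg thq /= powRr1//.
    by rewrite -!EFinM mulrA.
  have m1 : measurable_fun setT (fun x => `|(u x)%:E| `^ 2)%E.
    by apply: measurable_poweR_comp; do 2 apply: measurableT_comp => //.
  have m2 : measurable_fun setT (fun x => `|(pderiv i u x)%:E| `^ q)%E.
    by apply: measurable_poweR_comp; do 2 apply: measurableT_comp => //.
  rewrite ge0_integralZl//; last 3 first.
  - by apply: emeasurable_funM; exact: measurable_poweR_comp.
  - by move=> x _; rewrite mule_ge0 ?poweR_ge0.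
  - by rewrite lee_fin ltW.
  apply: lee_pmul => //; first by rewrite lee_fin ltW.
    by apply: integral_ge0 => x _; rewrite mule_ge0 ?poweR_ge0.
  apply: le_trans (ge0_hoelder _ _ m1 m2 _ _) _; rewrite ?th0//.
  - by move=> x; exact: poweR_ge0.
  - by move=> x; exact: poweR_ge0.
  apply: lee_pmul; rewrite ?poweR_ge0//.
  have -> : ((\int[mu n.+2]_x `|(pderiv i u x)%:E| `^ q) `^ (1 - th) =
             'N[mu n.+2]_q%:E[EFin \o pderiv i u])%E.
    by rewrite unlock qth.
  rewrite /S (bigD1 i)//= leeDl//; apply: sume_ge0 => j _; exact: Lnorm_ge0.
have AE : (\int[mu n.+2]_x (`|u x| `^ g)%:E `^ (n.+2%:R / n.+1%:R) = A)%E.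
  apply: eq_integral => x _; rewrite /= -powRrM; congr (_ `^ _)%:E.
  by rewrite /g -!natr1; field; rewrite n1.
have Agag : (A <= (\prod_i \int[mu n.+2]_x G i x) `^ n.+1%:R^-1)%E.
  rewrite -AE; apply: gagliardo => //.
  - by apply/measurable_EFinP; exact: measurable_norm_powR.
  - by move=> i x; exact: C1_norm_powR_line Cu g1.
rewrite unlock -/A.
have Sf : S \is a fin_num by rewrite ge0_fin_numE// ltey.
move: A0 S0 Agag IG; rewrite -(fineK Afin) -(fineK Sf).
move: (fine A) (fine S) => a s; rewrite !lee_fin => a0 s0 Agag IG.
have [->|aN0] := eqVneq a 0.
  by rewrite powR0 ?invr_eq0// mulr_ge0.
have ap : 0 < a by rewrite lt0r aN0.
pose c := g * (a `^ th * s).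
have c0 : 0 <= c by rewrite !mulr_ge0 ?powR_ge0// ltW.
have {Agag} : a <= (c ^+ n.+2) `^ n.+1%:R^-1.
  rewrite -lee_fin; apply: le_trans Agag _; rewrite -poweR_EFin.
  apply: gt0_ler_poweR.
  - by rewrite invr_ge0.
  - rewrite in_itv /= leey andbT; apply: prode_ge0 => i _.
    by apply: integral_ge0 => x _; exact: G0.
  - by rewrite in_itv /= leey andbT lee_fin exprn_ge0.
  apply: (@le_trans _ _ (\prod_(i < n.+2) c%:E)%E).
    apply: lee_prode => i; first by apply: integral_ge0 => x _; exact: G0.
    by apply: le_trans (IG i) _; rewrite poweR_EFin -!EFinM.
  by rewrite -(big_morph EFin (@EFinM R) erefl) prodr_const card_ord.
move=> /(ge0_ler_powR (ler0n R n.+1)).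
rewrite !nnegrE a0 powR_ge0 => /(_ isT isT).
rewrite -powRrM mulVf ?pnatr_eq0// powRr1 ?exprn_ge0// -powR_mulrn//.
rewrite /c mulrCA powRM ?powR_ge0 ?mulr_ge0 ?(ltW g0)// -powRrM => H.
have H2 : a `^ (2^-1 * n.+2%:R) <= (g * s) `^ n.+2%:R.
  have := H; rewrite -ler_pdivrMl ?powR_gt0// -powRN -powRD; last first.
    by rewrite aN0 implybT.
  congr (_ `^ _ <= _); rewrite /th -!natr1; field; exact: n2.
have n20 : 0 < n.+2%:R^-1 :> R by rewrite invr_gt0.
have := ge0_ler_powR (ltW n20) _ _ H2; rewrite !nnegrE !powR_ge0 => /(_ isT isT).
rewrite -!powRrM mulfK ?pnatr_eq0// mulfV ?pnatr_eq0// powRr1 ?mulr_ge0 ?(ltW g0)//.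
by move=> /le_trans; apply; apply: ler_wpM2r.
Qed.

End sobolev_C1.

(** * Smooth bumps and test functions *)

Section continuous_ops.
Context (R : realType) (T : topologicalType).
Implicit Types f g : T -> R.

Lemma continuous_funD f g : continuous f -> continuous g ->
  continuous (fun x => f x + g x).
Proof. by move=> cf cg x; exact: cvgD (cf x) (cg x). Qed.

Lemma continuous_funM f g : continuous f -> continuous g ->
  continuous (fun x => f x * g x).
Proof. by move=> cf cg x; exact: cvgM (cf x) (cg x). Qed.

End continuous_ops.

Section smooth_line.
Context (R : realType).
Implicit Types (f g : R -> R) (m k : nat).

Fixpoint Ck m f : Prop :=
  continuous f /\
  if m is m'.+1 then
    exists2 g, (forall x : R, is_derive x 1 f (g x)) & Ck m' g
  else True.

Definition Csmooth f := forall m, Ck m f.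

Lemma Ck_continuous m f : Ck m f -> continuous f.
Proof. by case: m => [|m] []. Qed.

Lemma CkW m f : Ck m.+1 f -> Ck m f.
Proof.
elim: m f => [|m ih] f [cf [g fg Cg]]; first by split.
by split => //; exists g => //; exact: ih.
Qed.

Lemma CkS m f g : (forall x : R, is_derive x 1 f (g x)) -> Ck m g -> Ck m.+1 f.
Proof. by move=> fg Cg; split; [exact: is_derive_continuous fg|exists g]. Qed.

Lemma CkD m f g : Ck m f -> Ck m g -> Ck m (fun x => f x + g x).
Proof.
elim: m f g => [|m ih] f g.
  by move=> [cf _] [cg _]; split => // x; exact: cvgD (cf x) (cg x).
move=> [_ [df ff Cf]] [_ [dg gg Cg]].
apply: (@CkS _ _ (fun x => df x + dg x) (fun x => is_deriveD (ff x) (gg x))).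
exact: ih.
Qed.

Lemma CkM m f g : Ck m f -> Ck m g -> Ck m (fun x => f x * g x).
Proof.
elim: m f g => [|m ih] f g.
  by move=> [cf _] [cg _]; split => // x; exact: cvgM (cf x) (cg x).
move=> Cf' Cg'; have Cf0 := CkW Cf'; have Cg0 := CkW Cg'.
case: Cf' => _ [df ff Cf]; case: Cg' => _ [dg gg Cg].
apply: (@CkS _ _ (fun x => f x * dg x + g x * df x)
  (fun x => is_deriveM (ff x) (gg x))).
by apply: CkD; exact: ih.
Qed.

Lemma Ck_cst m (c : R) : Ck m (fun=> c).
Proof.
elim: m c => [|m ih] c; first by split => // x; exact: cvg_cst.
by apply: (@CkS _ _ (fun=> 0)) => // x; exact: is_derive_cst.
Qed.

Lemma Ck_affine m f (p q : R) : Ck m f -> Ck m (fun x => f (p * x + q)).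
Proof.
have da (x : R) : is_derive x 1 (fun x : R => p * x + q) p.
  apply: is_derive_eq (is_deriveD (is_deriveM (is_derive_cst p x 1)
    (is_derive_id x 1)) (is_derive_cst q x 1)) _.
  by rewrite scaler0 !addr0; exact: mulr1.
elim: m f => [|m ih] f.
  move=> [cf _]; split => // x.
  apply: (@continuous_comp _ _ _ (fun x : R => p * x + q) f).
    exact: (is_derive_continuous da).
  exact: cf.
move=> [_ [df ff Cf]].
apply: (@CkS _ _ (fun x => df (p * x + q) * p)
  (fun x => @is_derive1_comp _ f (fun x : R => p * x + q) _ _ _ (ff _) (da x))).
by apply: CkM; [exact: ih|exact: Ck_cst].
Qed.

(** The powers x^-k make the family closed under differentiation, which is
    what the smoothness of e^(-1/x) at 0 comes from. *)
Definition flat k (x : R) : R := if 0 < x then x ^- k * expR (- x^-1) else 0.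

Lemma flat_le0 k x : x <= 0 -> flat k x = 0.
Proof. by rewrite /flat ltNge => ->. Qed.

Lemma flat_ge0 k x : 0 <= flat k x.
Proof.
by rewrite /flat; case: ifPn => // x0; rewrite mulr_ge0 ?expR_ge0 ?invr_ge0 ?exprn_ge0 ?ltW.
Qed.

(** From the term of degree k+1 of the exponential series at 1/x. *)
Lemma flat_le k x : flat k x <= k.+1`!%:R * `|x|.
Proof.
rewrite /flat; case: ifPn => x0; last by rewrite mulr_ge0.
have y0 : 0 < x^-1 by rewrite invr_gt0.
have := expR_ge1Dxn k (ltW y0) => h.
have {}h : x^-1 ^+ k.+1 <= k.+1`!%:R * expR x^-1.
  rewrite mulrC -ler_pdivrMr ?ltr0n ?fact_gt0//; apply: le_trans h.
  by rewrite lerDr.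
rewrite gtr0_norm// expRN -exprVn ler_pdivrMr ?expR_gt0//.
have -> : x^-1 ^+ k = x * x^-1 ^+ k.+1 by rewrite exprS mulVKf ?gt_eqF.
by rewrite mulrAC mulrC ler_pM2r.
Qed.

Lemma flat_cvg0 k : flat k x @[x --> (0:R)] --> (0:R).
Proof.
have c0 : 0 <= k.+1`!%:R :> R by [].
apply: (@squeeze_cvgr _ _ _ _ (fun=> 0) (fun x => k.+1`!%:R * `|x|)).
- by near=> x; rewrite flat_ge0 flat_le.
- exact: cvg_cst.
- rewrite -[X in _ --> X](mulr0 (k.+1`!%:R : R)); apply: cvgM; first exact: cvg_cst.
  by have := @norm_continuous R R 0; rewrite /continuous_at normr0.
Unshelve. all: by end_near. Qed.

Lemma is_derive_flat k (x : R) :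
  is_derive x 1 (flat k) (flat k.+2 x - k%:R * flat k.+1 x).
Proof.
have [x0|x0|->] := ltgtP x 0.
- rewrite !flat_le0 ?(ltW x0)// mulr0 subrr.
  apply: near_eq_is_derive (is_derive_cst 0 x 1).
  near=> y; rewrite flat_le0// ltW//; near: y.
  by apply: open_nbhs_nbhs; split => //; exact: open_lt.
- have xN0 : x != 0 by rewrite gt_eqF.
  have dV : is_derive x 1 (fun y : R => y^-1) (- x ^- 2).
    by apply: is_derive_eq (is_deriveV xN0 (is_derive_id x 1)) _; exact: mulr1.
  have dE : is_derive x 1 (fun y : R => expR (- y^-1)) (expR (- x^-1) * x ^- 2).
    apply: (@is_derive1_comp _ expR (fun y : R => - y^-1)).
    by apply: is_derive_eq (is_deriveN dV) _; rewrite opprK.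
  case: k => [|k].
    apply: (@near_eq_is_derive _ _ _ (fun y : R => expR (- y^-1))).
      near=> y; have y0 : 0 < y by near: y; exact: lt_nbhsr.
      by rewrite /flat y0 expr0 invr1 mul1r.
    by apply: is_derive_eq dE _; rewrite /flat x0 mul0r subr0 mulrC.
  apply: (@near_eq_is_derive _ _ _ (fun y : R => y^-1 ^+ k.+1 * expR (- y^-1))).
    near=> y; have y0 : 0 < y by near: y; exact: lt_nbhsr.
    by rewrite /flat y0 exprVn.
  rewrite (_ : (fun y : R => y^-1 ^+ k.+1 * expR (- y^-1)) =
    (fun y : R => y^-1) ^+ k.+1 * (fun y : R => expR (- y^-1))); last first.
    by apply/funext => y; rewrite fctE exprfctE.
  apply: is_derive_eq (is_deriveM (is_deriveX k.+1 dV) dE) _.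
  rewrite /flat x0 -!exprVn.
  set e := expR _; set y := x^-1.
  rewrite exprfctE -/y.
  rewrite -[LHS]/(y ^+ k.+1 * (e * y ^+ 2) + e * (k.+1%:R * y ^+ k * (- y ^+ 2))).
  by rewrite !exprS; ring.
- rewrite !flat_le0 ?lexx// mulr0 subrr; apply: is_derive_cvg.
  apply: (@cvg_trans _ (flat k.+1 @ (0:R)^')); last first.
    by apply: cvg_trans (flat_cvg0 k.+1); apply: cvg_app; exact: nbhs_dnbhs.
  apply: near_eq_cvg; near=> h.
  have h0 : h != 0 by near: h; exact: nbhs_dnbhs_neq.
  rewrite addr0 (flat_le0 _ (lexx 0)) subr0 scaler1 /flat; case: ifPn => hp.
    by rewrite -[RHS]/(h^-1 * (_ * _)) mulrA exprS invfM.
  by rewrite scaler0.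
Unshelve. all: by end_near. Qed.

Lemma Csmooth_flat k : Csmooth (flat k).
Proof.
move=> m; elim: m k => [|m ih] k.
  by split => //; apply: is_derive_continuous; exact: is_derive_flat.
apply: CkS; first exact: is_derive_flat.
apply: CkD; first exact: ih.
have -> : (fun x => - (k%:R * flat k.+1 x)) = (fun x => - k%:R * flat k.+1 x).
  by apply/funext => x; rewrite mulNr.
by apply: CkM; [exact: Ck_cst|exact: ih].
Qed.

(** Smooth functions supported in [p, q] that converge to the indicator of
    ]p, q[ as k tends to infinity. *)
Definition bump k (p q : R) (x : R) : R :=
  flat 0 (k.+1%:R * (x - p)) * flat 0 (k.+1%:R * (q - x)).

Lemma Csmooth_bump k p q : Csmooth (bump k p q).
Proof.
move=> m; apply: CkM.
  have -> : (fun x => flat 0 (k.+1%:R * (x - p))) =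
            (fun x => flat 0 (k.+1%:R * x + (- (k.+1%:R * p)))).
    by apply/funext => x; rewrite mulrBr.
  exact/Ck_affine/Csmooth_flat.
have -> : (fun x => flat 0 (k.+1%:R * (q - x))) =
          (fun x => flat 0 (- k.+1%:R * x + k.+1%:R * q)).
  by apply/funext => x; rewrite mulrBr addrC mulNr.
exact/Ck_affine/Csmooth_flat.
Qed.

Lemma flat0_le1 x : flat 0 x <= 1.
Proof.
rewrite /flat; case: ifPn => // x0; rewrite expr0 invr1 mul1r -expR0 ler_expR.
by rewrite lerNl oppr0 invr_ge0 ltW.
Qed.

Lemma bump_ge0 k p q x : 0 <= bump k p q x.
Proof. by rewrite mulr_ge0 ?flat_ge0. Qed.

Lemma bump_le1 k p q x : bump k p q x <= 1.
Proof. by rewrite mulr_ile1 ?flat_ge0 ?flat0_le1. Qed.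

Lemma bump_out k p q x : ~~ (p < x < q) -> bump k p q x = 0.
Proof.
rewrite negb_and -!leNgt => /orP[xp|qx]; rewrite /bump.
  by rewrite flat_le0 ?mul0r// pmulr_rle0// subr_le0.
by rewrite [X in _ * X]flat_le0 ?mulr0// pmulr_rle0// subr_le0.
Qed.

Lemma flat0_cvg1 (y : R) : 0 < y -> flat 0 (k.+1%:R * y) @[k --> \oo] --> (1:R).
Proof.
move=> y0.
have -> : (fun k => flat 0 (k.+1%:R * y)) = (fun k => expR (- (k.+1%:R^-1 * y^-1))).
  by apply/funext => k; rewrite /flat mulr_gt0// expr0 invr1 mul1r invfM.
rewrite [X in _ --> X](_ : 1 = expR (- 0)); last by rewrite oppr0 expR0.
apply: continuous_cvg; first exact: continuous_expR.
apply: cvgN; rewrite -[X in _ --> X](mul0r y^-1).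
by apply: cvgM; [exact: cvg_harmonic|exact: cvg_cst].
Qed.

Lemma bump_cvg p q x :
  bump k p q x @[k --> \oo] --> ((p < x < q)%R%:R : R).
Proof.
have [/andP[px xq]|xpq] := boolP (p < x < q); last first.
  by under eq_fun do rewrite bump_out//; exact: cvg_cst.
rewrite -[X in _ --> X](mulr1 (1:R)).
by apply: cvgM; apply: flat0_cvg1; rewrite subr_gt0.
Qed.

End smooth_line.

Section smooth_product.
Context (R : realType) (n : nat).

Definition prod_fun (b : 'I_n -> R -> R) (x : 'rV[R]_n) : R :=
  \prod_i b i (x ord0 i).

Lemma continuous_prod_fun (b : 'I_n -> R -> R) : (forall i, continuous (b i)) -> continuous (prod_fun b).
Proof.
move=> cb; rewrite /prod_fun.
elim: (index_enum 'I_n) => [|i r ih].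
  have -> : (fun x : 'rV[R]_n => \prod_(i <- [::]) b i (x ord0 i)) = fun=> 1.
    by apply/funext => y; rewrite big_nil.
  exact: (@cst_continuous _ R).
have -> : (fun x : 'rV[R]_n => \prod_(j <- i :: r) b j (x ord0 j)) =
    fun y : 'rV[R]_n => b i (y ord0 i) * \prod_(j <- r) b j (y ord0 j).
  by apply/funext => y; rewrite big_cons.
apply: continuous_funM; last exact: ih.
move=> x; apply: (@continuous_comp _ _ _ (fun y : 'rV[R]_n => y ord0 i) (b i)).
  exact: coord_continuous.
exact: cb.
Qed.

Lemma is_derive_prod_fun (b : 'I_n -> R -> R) (db : R -> R) j x :
  (forall s : R, is_derive s 1 (b j) (db s)) ->
  is_derive x (delta_mx ord0 j) (prod_fun b)
    (prod_fun (fun i => if i == j then db else b i) x).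
Proof.
move=> dbj; apply: is_derive_cvg.
have cE (c : 'I_n -> R -> R) y : prod_fun c y =
    (\prod_(i | i != j) c i (y ord0 i)) * c j (y ord0 j).
  by rewrite /prod_fun (bigD1 j)//= mulrC.
rewrite (_ : prod_fun (fun i => if i == j then db else b i) x =
    (\prod_(i | i != j) b i (x ord0 i)) * db (x ord0 j)); last first.
  by rewrite cE eqxx; congr (_ * _); apply: eq_bigr => i /negbTE ->.
have -> : (fun h : R => h^-1 *: (prod_fun b (h *: delta_mx ord0 j + x) - prod_fun b x)) =
  (fun h : R => (\prod_(i | i != j) b i (x ord0 i)) *
     (h^-1 *: ((b j \o shift (x ord0 j)) (h *: (1:R)) - b j (x ord0 j)))).
  apply/funext => h; rewrite !cE.
  rewrite (eq_bigr (fun i => b i (x ord0 i))); last first.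
    by move=> i ij; rewrite !mxE (negbTE ij) mulr0 add0r.
  by rewrite -mulrBr !mxE !eqxx /= mulrCA.
apply: cvgM; first exact: cvg_cst.
by rewrite -(@derive_val _ _ _ _ _ _ _ (dbj (x ord0 j))); exact: (@ex_derive _ _ _ _ _ _ _ (dbj (x ord0 j))).
Qed.

(** Partial derivatives of such a product are again products of the same kind,
    so the claim for all iterated derivatives follows by induction. *)
Lemma smooth_prod_fun (b : 'I_n -> R -> R) : (forall i, Csmooth (b i)) ->
  smooth (prod_fun b).
Proof.
move=> sb s.
have [c sc ->] : exists2 c, (forall i, Csmooth (c i)) &
    foldr (@pderiv R n) (prod_fun b) s = prod_fun c.
  elim: s => [|j s [c sc /= ->]]; first by exists b.
  have [g cg Cg] : exists2 g, (forall x : R, is_derive x 1 (c j) (g x)) & Csmooth g.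
    have [_ [g cg _]] := sc j 1%N; exists g => // m.
    have [_ [k ck Ck]] := sc j m.+1.
    have <- // : k = g; apply/funext => x.
    by rewrite -(@derive_val _ _ _ _ _ _ _ (ck x)) (@derive_val _ _ _ _ _ _ _ (cg x)).
  exists (fun i => if i == j then g else c i) => [i|]; first by case: ifP.
  apply/funext => x; rewrite /pderiv.
  exact: (@derive_val _ _ _ _ _ _ _ (is_derive_prod_fun x cg)).
split; first by apply: continuous_prod_fun => i; exact: (Ck_continuous (sc i 0%N)).
move=> j x; have [_ [g cg _]] := sc j 1%N.
exact: (@ex_derive _ _ _ _ _ _ _ (is_derive_prod_fun x cg)).
Qed.

Definition box_bump k (p q : 'I_n -> R) : 'rV[R]_n -> R :=
  prod_fun (fun i => bump k (p i) (q i)).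

Lemma smooth_box_bump k p q : smooth (box_bump k p q).
Proof. by apply: smooth_prod_fun => i; exact: Csmooth_bump. Qed.

Lemma box_bump_ge0 k p q x : 0 <= box_bump k p q x.
Proof. by apply: prodr_ge0 => i _; exact: bump_ge0. Qed.

Lemma box_bump_le1 k p q x : box_bump k p q x <= 1.
Proof. by apply: prodr_ile1 => i _; rewrite bump_ge0 bump_le1. Qed.

Lemma box_bump_out k p q x : ~ obox p q x -> box_bump k p q x = 0.
Proof.
move=> xb; have [i hi] : exists i, ~ (p i < x ord0 i < q i).
  by apply: contrapT => h; apply: xb => i; apply: contrapT => hi; apply: h; exists i.
by rewrite /box_bump /prod_fun (bigD1 i)//= bump_out ?mul0r//; exact/negP.
Qed.

Lemma box_bump_cvg p q x : obox p q x ->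
  box_bump k p q x @[k --> \oo] --> (1:R).
Proof.
move=> xb; rewrite /box_bump /prod_fun.
suff H (r : seq 'I_n) : \prod_(i <- r) bump k (p i) (q i) (x ord0 i) @[k --> \oo]
    --> \prod_(i <- r) (1:R) by have := H (index_enum 'I_n); rewrite big1.
elim: r => [|i r ih].
  by under eq_fun do rewrite big_nil; rewrite big_nil; exact: cvg_cst.
under eq_fun do rewrite big_cons; rewrite big_cons.
by apply: cvgM ih; have := @bump_cvg R (p i) (q i) (x ord0 i); rewrite xb.
Qed.

Lemma closed_cbox (p q : 'I_n -> R) : closed (cbox p q : set 'rV[R]_n).
Proof.
rewrite (_ : cbox p q = \bigcap_(i in setT)
    ((fun x : 'rV[R]_n => x ord0 i) @^-1` `[p i, q i]%classic)); last first.
  by apply/seteqP; split => x h i; have := h i; rewrite /= in_itv//=; apply.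
apply: closed_bigI => i _; apply: preimage_closed => //.
  by move=> x _; exact: coord_continuous.
exact: interval_closed.
Qed.

Lemma compact_cbox (p q : 'I_n -> R) : compact (cbox p q : set 'rV[R]_n).
Proof.
rewrite (_ : cbox p q = [set v : 'rV[R]_n | forall i, `[p i, q i]%classic (v ord0 i)]).
  by apply: (@rV_compact _ _ (fun i => `[p i, q i]%classic)) => i; exact: segment_compact.
by apply/seteqP; split => x h i; have := h i; rewrite /= in_itv.
Qed.

Lemma box_bump_test k (p q : 'I_n -> R) (Omega : set 'rV[R]_n) :
  cbox p q `<=` Omega -> test_function Omega (box_bump k p q).
Proof.
move=> pqO.
have sub : closure [set x | box_bump k p q x != 0] `<=` cbox p q.
  rewrite [X in _ `<=` X]((closure_id (cbox p q)).1 _); last exact: closed_cbox.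
  apply: closure_subset => x /= bx; apply: subset_obox_cbox.
  by apply: contrapT => h; rewrite box_bump_out ?eqxx in bx.
split; first exact: smooth_box_bump.
- apply: subclosed_compact sub; [exact: closed_closure|exact: compact_cbox].
- exact: subset_trans pqO.
Qed.

Lemma test_function_C1 (Omega : set 'rV[R]_n) f : test_function Omega f ->
  exists M, C1_cube M f.
Proof.
move=> [sf cf _].
have [M M0 KM] := bounded_sub_cbox (compact_bounded cf).
exists M; have out (x : 'rV[R]_n) i : M <= `|x ord0 i| -> \forall y \near x, f y = 0.
  move=> Mx; have : open (~` closure [set x | f x != 0]).
    exact/closed_openC/closed_closure.
  rewrite openE => /(_ x) h; have : (~` closure [set x | f x != 0]) x.
    by move=> /KM/(_ i); rewrite -ltr_norml ltNge Mx.
  move=> /h; apply: filterS => y yK; apply/eqP; apply: contrapT => /negP fy.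
  by apply: yK; exact: subset_closure.
have [cf0 df0] := sf [::].
split => //.
- by move=> i; exact: (sf [:: i]).1.
- by move=> x i /out /nbhs_singleton.
- move=> j x i /out fx; rewrite /pderiv.
  by rewrite (@near_eq_derive _ _ _ f (cst 0)) ?derive_cst.
Qed.

Lemma test_function_out (Omega : set 'rV[R]_n) f x : test_function Omega f ->
  ~ Omega x -> f x = 0.
Proof.
move=> [_ _ KO] xO; apply/eqP; apply: contrapT => /negP fx.
by apply/xO/KO/subset_closure.
Qed.

Lemma test_function_pderiv (Omega : set 'rV[R]_n) f i :
  test_function Omega f -> test_function Omega (pderiv i f).
Proof.
move=> [sf cf KO].
have sub : closure [set x | pderiv i f x != 0] `<=` closure [set x | f x != 0].
  rewrite [X in _ `<=` X]((closure_id (closure [set x | f x != 0])).1 _); last first.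
    exact: closed_closure.
  apply: closure_subset => x /= fx; apply: contrapT => xK; case/negP: fx; apply/eqP.
  have : \forall y \near x, f y = 0.
    have : open (~` closure [set x | f x != 0]).
      exact/closed_openC/closed_closure.
    rewrite openE => /(_ x xK); apply: filterS => y yK; apply/eqP.
    by apply: contrapT => /negP fy; apply: yK; exact: subset_closure.
  by move=> fx; rewrite /pderiv (@near_eq_derive _ _ _ f (cst 0)) ?derive_cst.
split; [|exact: subclosed_compact (@closed_closure _ _) cf sub|exact: subset_trans KO].
by move=> s; have := sf (rcons s i); rewrite -cats1 foldr_cat.
Qed.

Lemma C1_cubeM M (f g : 'rV[R]_n -> R) (M' : R) :
  C1_cube M f -> C1_cube M' g ->
  C1_cube M (f \* g) /\
  forall i x, pderiv i (f \* g) x = f x * pderiv i g x + g x * pderiv i f x.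
Proof.
move=> Cf Cg.
have E i x : pderiv i (f \* g) x = f x * pderiv i g x + g x * pderiv i f x.
  by rewrite /pderiv deriveM//; [exact: (C1_derivable Cf)|exact: (C1_derivable Cg)].
split => //; split.
- by apply: continuous_funM; [exact: (C1_continuous Cf)|exact: (C1_continuous Cg)].
- move=> i x; apply: derivableM; [exact: (C1_derivable Cf)|exact: (C1_derivable Cg)].
- move=> i; rewrite (_ : pderiv i _ = fun x => f x * pderiv i g x + g x * pderiv i f x).
    apply: continuous_funD; apply: continuous_funM.
    + exact: (C1_continuous Cf).
    + exact: (C1_continuous_pderiv Cg).
    + exact: (C1_continuous Cg).
    + exact: (C1_continuous_pderiv Cf).
  by apply/funext => x; exact: E.
- by move=> x i h; rewrite /= (C1_support Cf h) mul0r.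
- by move=> j x i h; rewrite E (C1_support Cf h) (C1_support_pderiv Cf j h) mul0r mulr0 addr0.
Qed.

End smooth_product.

(** * Integration by parts *)

Section test_integrals.
Context (R : realType) (n : nat).
Local Notation mu := (@lebesgue_row R n).
Implicit Types (u v f g : 'rV[R]_n -> R) (Omega A : set 'rV[R]_n).

Lemma bounded_set_lty A : bounded_set A -> measurable A -> (mu A < +oo)%E.
Proof.
move=> bA mA; have [M M0 AM] := bounded_sub_cbox bA.
apply: le_lt_trans (@lebesgue_row_obox R n (fun=> - M) (fun=> M)).
by apply: le_measure; rewrite ?inE//; exact: measurable_obox.
Qed.

Lemma C1_integrable M f g : C1_cube M f -> continuous g ->
  (exists B, forall x, `|g x| <= B) -> mu.-integrable setT (EFin \o (f \* g)).
Proof.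
move=> Cf cg [B gB].
pose K : set 'rV[R]_n := obox (fun=> - M) (fun=> M).
have mK : measurable K by exact: measurable_obox.
have -> : EFin \o (f \* g) = (EFin \o (f \* g)) \_ K.
  apply/funext => x; rewrite patchE; case: ifPn => // /negP xK /=.
  by rewrite (C1_out Cf) ?mul0r// => h; apply: xK; rewrite inE.
apply/integrable_restrict => //; rewrite setTI.
have [F F0 fF] := C1_bounded Cf.
apply: measurable_bounded_integrable => //.
- exact: lebesgue_row_obox.
- apply: measurable_funTS; apply: continuous_row_measurable.
  by apply: continuous_funM; [exact: (C1_continuous Cf)|exact: cg].
- exists (F * B); split; first exact: num_real.
  move=> r rFB x _ /=; rewrite normrM; apply: le_trans (ltW rFB).
  by apply: ler_pM.
Qed.

(** The integral of d_i (f g) vanishes, line by line. *)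
Lemma integral_by_parts M (M' : R) f g i : C1_cube M f -> C1_cube M' g ->
  (exists B, forall x, `|pderiv i f x| <= B) ->
  (exists B, forall x, `|pderiv i g x| <= B) ->
  \int[mu]_x (f x * pderiv i g x) = - \int[mu]_x (pderiv i f x * g x).
Proof.
move=> Cf Cg Bf Bg; have [Cfg dfg] := C1_cubeM Cf Cg.
have I1 := C1_integrable Cf (@C1_continuous_pderiv _ _ _ _ Cg i) Bg.
have I2 := C1_integrable Cg (@C1_continuous_pderiv _ _ _ _ Cf i) Bf.
apply/eqP; rewrite -addr_eq0; apply/eqP.
under [X in _ + X]eq_Rintegral do rewrite mulrC.
rewrite -RintegralD//; under eq_Rintegral do rewrite -dfg.
rewrite /Rintegral integralE (integral_pderiv_pos_neg i Cfg).
by case: (integral _ _ _) => [r| |] //=; rewrite subrr.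
Qed.

Lemma inner_setT Omega f g : (forall x, ~ Omega x -> f x * g x = 0) ->
  inner Omega f g = \int[mu]_x (f x * g x).
Proof.
move=> h; rewrite /inner Rintegral_mkcond; apply: eq_Rintegral => x _.
by rewrite patchE; case: ifPn => // /negP xO; rewrite h// => Ox; apply: xO; rewrite inE.
Qed.

Lemma test_function_bounded Omega f : test_function Omega f ->
  exists B, forall x, `|f x| <= B.
Proof.
by move=> /test_function_C1[M /C1_bounded[B _ ?]]; exists B.
Qed.

Lemma test_function_continuous Omega f : test_function Omega f -> continuous f.
Proof. by move=> [sf _ _]; exact: (sf [::]).1. Qed.

Lemma test_function_integrable Omega f : test_function Omega f ->
  mu.-integrable setT (EFin \o f).
Proof.
move=> tf; have [M Cf] := test_function_C1 tf.
have := @C1_integrable M f (fun=> 1) Cf (@cst_continuous _ R _).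
rewrite (_ : f \* _ = f); last by apply/funext => x /=; rewrite mulr1.
by apply; exists 1 => x; rewrite normr1.
Qed.

Lemma mdeg_delta i : mdeg (fun j : 'I_n => (j == i : nat)) = 1%N.
Proof. by rewrite /mdeg (bigD1 i)//= eqxx big1// => j /negbTE ->. Qed.

Lemma pderivn_delta i f : pderivn (fun j : 'I_n => (j == i : nat)) f = pderiv i f.
Proof.
rewrite /pderivn.
have H s : uniq s -> foldr (fun j g => iter (j == i) (pderiv j) g) f s =
    if i \in s then pderiv i f else f.
  elim: s => // j s ih /= /andP[js us]; rewrite in_cons {}ih//.
  by have [ji|//] := eqVneq j i; rewrite ji in js *; rewrite /= (negbTE js).
by rewrite H ?enum_uniq// mem_enum.
Qed.

Lemma loc_integrable_integrable Omega f : mu.-integrable setT (EFin \o f) ->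
  loc_integrable Omega f.
Proof.
move=> If A cA _; apply: integrableS If => //.
exact: compact_row_measurable.
Qed.

Lemma test_function_weak_deriv Omega f i : test_function Omega f ->
  is_weak_deriv Omega (fun j : 'I_n => (j == i : nat)) f (pderiv i f).
Proof.
move=> tf; have tdf := test_function_pderiv i tf; split.
- exact/loc_integrable_integrable/test_function_integrable/tf.
- exact/loc_integrable_integrable/test_function_integrable/tdf.
move=> g tg; rewrite pderivn_delta mdeg_delta expr1 mulN1r.
have [M Cf] := test_function_C1 tf; have [M' Cg] := test_function_C1 tg.
rewrite !inner_setT.
- apply: integral_by_parts Cf Cg _ _; apply: test_function_bounded.
    exact: tdf.
  exact: (test_function_pderiv i tg).
- by move=> x /(test_function_out tg) ->; rewrite mulr0.
- by move=> x /(test_function_out tf) ->; rewrite mul0r.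
Qed.

End test_integrals.

(** * Uniqueness of weak derivatives *)

Section du_bois_reymond.
Context (R : realType) (n : nat).
Local Notation mu := (@lebesgue_row R n).
Implicit Types (u v f g : 'rV[R]_n -> R) (Omega A : set 'rV[R]_n).

(** The bumps of the box converge to its indicator and are dominated by it. *)
Lemma integral_obox_eq0 Omega v (p q : 'I_n -> R) : loc_integrable Omega v ->
  (forall f, test_function Omega f -> inner Omega v f = 0) ->
  cbox p q `<=` Omega -> (\int[mu]_(x in obox p q) (v x)%:E = 0)%E.
Proof.
move=> lv v0 pqO.
have mQ : measurable (obox p q) by exact: measurable_obox.
have Iv : mu.-integrable (obox p q) (EFin \o v).
  apply: (integrableS (measurable_cbox p q) mQ (@subset_obox_cbox _ _ p q)).
  exact: (lv _ (@compact_cbox R n p q) pqO).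
have mv : measurable_fun (obox p q) v by apply/measurable_EFinP; exact: measurable_int Iv.
have mb k : measurable_fun setT (box_bump k p q).
  by apply: continuous_row_measurable; exact: (smooth_box_bump k p q [::]).1.
have E0 k : (\int[mu]_(x in obox p q) (v x * box_bump k p q x)%:E = 0)%E.
  have Ik : mu.-integrable (obox p q) (EFin \o (v \* box_bump k p q)).
    apply: (le_integrable mQ _ _ Iv).
      apply/measurable_EFinP; apply: measurable_funM => //.
      exact: measurable_funTS.
    move=> x _ /=; rewrite lee_fin normrM ler_piMr// ger0_norm ?box_bump_ge0//.
    exact: box_bump_le1.
  have := v0 _ (box_bump_test k pqO).
  rewrite inner_setT; last first.
    move=> x xO; rewrite box_bump_out ?mulr0// => xpq; apply: xO.
    exact/pqO/subset_obox_cbox.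
  have -> : \int[mu]_x (v x * box_bump k p q x) =
            \int[mu]_(x in obox p q) (v x * box_bump k p q x).
    rewrite [RHS]Rintegral_mkcond; apply: eq_Rintegral => x _.
    rewrite patchE; case: ifPn => // /negP xb; rewrite box_bump_out ?mulr0// => h.
    by apply: xb; rewrite inE.
  by rewrite /Rintegral => h; rewrite -[LHS]fineK ?h//; exact: integrable_fin_num.
have m1 k : measurable_fun (obox p q) (fun x => (v x * box_bump k p q x)%:E).
  by apply/measurable_EFinP; apply: measurable_funM => //; exact: measurable_funTS.
have m2 : {ae mu, forall x, obox p q x ->
    (v x * box_bump k p q x)%:E @[k --> \oo] --> (EFin \o v) x}.
  apply: aeW => x xb; apply: cvg_EFin; first by near=> k.
  rewrite -[X in _ --> X]mulr1; apply: cvgM; first exact: cvg_cst.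
  exact: (@box_bump_cvg R n p q).
have m3 : {ae mu, forall x k, obox p q x ->
    (`|(v x * box_bump k p q x)%:E| <= (abse \o (EFin \o v)) x)%E}.
  apply: aeW => x k _ /=; rewrite lee_fin normrM ler_piMr// ger0_norm ?box_bump_ge0//.
  exact: box_bump_le1.
have [_ _] := dominated_convergence mQ m1 (measurable_int _ Iv) m2
  (integrable_abse Iv) m3.
have -> : [sequence (\int[mu]_(x in obox p q) (v x * box_bump k p q x)%:E)%E]_k = cst 0%E.
  by apply/funext => k; exact: E0.
by move=> h; apply/esym; apply: (cvg_unique _ _ h) => //; exact: cvg_cst.
Unshelve. all: by end_near. Qed.

Definition oboxes : set_system 'rV[R]_n := [set A | exists p q, A = obox p q].

Lemma obox_setI (p q p' q' : 'I_n -> R) : obox p q `&` obox p' q' =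
  obox (fun i => Num.max (p i) (p' i)) (fun i => Num.min (q i) (q' i)).
Proof.
apply/seteqP; split => x.
  by move=> [h h'] i; have := h i; have := h' i; rewrite gt_max lt_min => /andP[-> ->] /andP[-> ->].
by move=> h; split => i; move: (h i); rewrite gt_max lt_min => /andP[/andP[a b] /andP[c e]]; apply/andP.
Qed.

Lemma oboxes_setI : setI_closed oboxes.
Proof.
by move=> _ _ [p [q ->]] [p' [q' ->]]; rewrite obox_setI; eexists; eexists.
Qed.

Lemma measurable_oboxes : @measurable _ 'rV[R]_n = <<s oboxes >>.
Proof.
apply/seteqP; split; last first.
  apply: smallest_sub; first exact: sigma_algebra_measurable.
  by move=> _ [p [q ->]]; exact: measurable_obox.
pose T' := g_sigma_algebraType oboxes.
have mcoord (i : 'I_n) :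
    measurable_fun (setT : set T') (fun x : T' => ((x : 'rV[R]_n) ord0 i : measurableTypeR R)).
  apply: (measurability _ (RGenOpens.measurableE R)) => _ [_ [a [b ->]] <-].
  rewrite setTI.
  have -> : (fun x : T' => (x : 'rV[R]_n) ord0 i) @^-1` `]a, b[%classic =
     \bigcup_(k in [set: nat]) (obox (fun j => if j == i then a else - k%:R)
                    (fun j => if j == i then b else k%:R) : set T').
    apply/seteqP; split => [x /=|x [k _ /(_ i)]]; last by rewrite eqxx /= in_itv.
    rewrite in_itv /= => xab.
    exists (Num.truncn `|x : 'rV[R]_n|).+1 => // j.
    case: eqP => [->//|_]; rewrite -ltr_norml.
    by apply: le_lt_trans (row_coord_le _ _) _; exact: truncnS_gt.
  apply: bigcupT_measurable => k; apply: sub_sigma_algebra; by eexists; eexists.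
move=> A.
apply: smallest_sub; first exact: smallest_sigma_algebra.
apply: (big_ind (fun X => X `<=` <<s oboxes>>)) => //.
  by move=> X Y hX hY; rewrite subUset.
by move=> i _ B [C mC <-]; rewrite setTI -[X in _ X]setTI; exact: mcoord.
Qed.

(** Boxes form an intersection-stable generator of the sigma-algebra, so the
    vanishing on boxes extends to all measurable sets. *)
Lemma integral_measurable_eq0 v (p q : 'I_n -> R) :
  mu.-integrable (obox p q) (EFin \o v) ->
  (forall p' q', (forall i, p i <= p' i) -> (forall i, q' i <= q i) ->
    (\int[mu]_(x in obox p' q') (v x)%:E = 0)%E) ->
  forall A, measurable A -> (\int[mu]_(x in A `&` obox p q) (v x)%:E = 0)%E.
Proof.
move=> Iv v0 A mA.
have mQ : measurable (obox p q) by exact: measurable_obox.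
have Iv' B : measurable B -> mu.-integrable (B `&` obox p q) (EFin \o v).
  by move=> mB; apply: (integrableS mQ _ _ Iv); [exact: measurableI|exact: subIsetr].
apply: (@dynkin_induction _ _ oboxes
  (fun B => \int[mu]_(x in B `&` obox p q) (v x)%:E = 0)%E) => //.
- exact: measurable_oboxes.
- exact: oboxes_setI.
- by rewrite setTI; exact: v0.
- move=> _ [p' [q' ->]]; rewrite obox_setI; apply: v0 => i.
    by rewrite le_max lexx orbT.
  by rewrite ge_min lexx orbT.
- move=> B mB B0.
  have := v0 p q (fun i => lexx _) (fun i => lexx _).
  rewrite -{1}(setUIDK (obox p q) B) (setIC _ B) setDE (setIC _ (~` B)).
  rewrite integral_setU_EFin//.
  + by rewrite B0 add0e.
  + exact: measurableI.
  + by apply: measurableI => //; exact: measurableC.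
  + rewrite -setIUl setUCr setTI; apply/measurable_EFinP; exact: measurable_int Iv.
  + apply/disj_set2P; rewrite setIACA setICr set0I//.
- move=> B mB tB B0; rewrite setI_bigcupl integral_bigcup//.
  + by apply: eseries0 => k _ _; exact: B0.
  + by apply: trivIset_setIr.
  + by move=> k; exact: measurableI.
  + by rewrite -setI_bigcupl; apply: Iv'; exact: bigcupT_measurable.
- by rewrite -measurable_oboxes.
Qed.

(** On each rational box whose closure lies in Omega, v has vanishing integral
    over all measurable subsets; countably many such boxes cover Omega. *)
Lemma du_bois_reymond Omega v : open Omega -> loc_integrable Omega v ->
  (forall f, test_function Omega f -> inner Omega v f = 0) ->
  {ae mu, forall x, Omega x -> v x = 0}.
Proof.
move=> oO lv v0.
have box0 (c : {ffun 'I_n -> rat * rat}) : @rat_cbox R n c `<=` Omega ->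
    {ae mu, forall x, @rat_box R n c x -> v x = 0}.
  move=> cO; set p := (fun i => ratr (c i).1) : 'I_n -> R.
  set q := (fun i => ratr (c i).2) : 'I_n -> R.
  have mQ : measurable (obox p q) by exact: measurable_obox.
  have Iv : mu.-integrable (obox p q) (EFin \o v).
    apply: (integrableS (measurable_cbox p q) mQ (@subset_obox_cbox _ _ p q)).
    exact: (lv _ (@compact_cbox R n p q) cO).
  have /integral_ae_eq h := Iv.
  have {}h := h mQ (cst 0%E) (measurable_cst _).
  have E0 : ae_eq mu (obox p q) (EFin \o v) (cst 0%E).
    apply: h => E EQ mE; rewrite integral0 -(setIidl EQ).
    apply: integral_measurable_eq0 => // p' q' pp' qq'.
    apply: (integral_obox_eq0 lv v0); apply: subset_trans cO => x xb i.
    by have /andP[h1 h2] := xb i; rewrite (le_trans (pp' i))// (le_trans h2).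
  by apply: filterS E0 => x /= + xb => /(_ xb) [].
pose P k x := if @unpickle {ffun 'I_n -> rat * rat} k is Some c then
  @rat_cbox R n c `<=` Omega -> @rat_box R n c x -> v x = 0 else True.
have : {ae mu, forall x k, P k x}.
  apply/ae_foralln => k; rewrite /P; case: unpickle => [c|]; last exact: aeW.
  have [cO|ncO] := pselect (@rat_cbox R n c `<=` Omega); last by apply: aeW.
  by apply: filterS (box0 c cO) => x h _.
apply: filterS => x Px Ox; have [c cx cO] := open_rat_box oO Ox.
by have := Px (pickle c); rewrite /P pickleK; exact.
Qed.

End du_bois_reymond.

Section weak_derivatives.
Context (R : realType) (n : nat) (Omega : set 'rV[R]_n).
Hypothesis oO : open Omega.
Local Notation mu := (@lebesgue_row R n).
Local Notation e i := (fun j : 'I_n => (j == i : nat)).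
Implicit Types (u v w f : 'rV[R]_n -> R).

(** Omega is a countable union of boxes with compact closure in Omega, on each
    of which v is measurable by definition. *)
Lemma loc_integrable_measurable v : loc_integrable Omega v -> measurable_fun Omega v.
Proof.
move=> lv; pose E k : set 'rV[R]_n := if @unpickle {ffun 'I_n -> rat * rat} k is Some c then
  (if `[< @rat_cbox R n c `<=` Omega >] then @rat_box R n c else set0) else set0.
have mE k : measurable (E k).
  rewrite /E; case: unpickle => [c|//]; case: ifP => // _; exact: measurable_obox.
have -> : Omega = \bigcup_k E k.
  apply/seteqP; split => [x Ox|x [k _]].
    have [c cx cO] := open_rat_box oO Ox; exists (pickle c) => //.
    by rewrite /E pickleK ifT//; exact/asboolP.
  rewrite /E; case: unpickle => [c|//]; case: ifPn => // /asboolP cO.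
  by move/subset_obox_cbox; exact: cO.
apply/(measurable_fun_bigcup _ mE) => k; rewrite /E.
case: unpickle => [c|]; last exact: measurable_fun_set0.
case: ifPn => [/asboolP cO|_]; last exact: measurable_fun_set0.
apply: measurable_funS (measurable_cbox _ _) (@subset_obox_cbox _ _ _ _) _.
by apply/measurable_EFinP; exact: measurable_int (lv _ (@compact_cbox R n _ _) cO).
Qed.

Lemma loc_integrable_test v f : loc_integrable Omega v -> test_function Omega f ->
  mu.-integrable Omega (EFin \o (v \* f)).
Proof.
move=> lv tf; have [B fB] := test_function_bounded tf.
have [_ cK KO] := tf; set K := closure _ in cK KO.
have mK : measurable K by exact: compact_row_measurable.
have mO : measurable Omega by exact: open_row_measurable.
have -> : EFin \o (v \* f) = (EFin \o (v \* f)) \_ K.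
  apply/funext => x; rewrite patchE; case: ifPn => // /negP xK /=.
  have -> : f x = 0; last by rewrite mulr0.
  apply/eqP; apply: contrapT => /negP fx; apply: xK; rewrite inE.
  exact: subset_closure.
apply/integrable_restrict => //; rewrite setIidr//.
have Iv := lv _ cK KO.
apply: (@le_integrable _ _ _ mu K mK _ (fun x => B%:E * (v x)%:E)%E).
- apply/measurable_EFinP; apply: measurable_funM.
    by apply/measurable_EFinP; exact: measurable_int Iv.
  apply: measurable_funTS; apply: continuous_row_measurable.
  exact: test_function_continuous tf.
- move=> x _ /=; rewrite lee_fin !normrM mulrC ler_wpM2r//.
  by apply: le_trans (fB x) _; exact: ler_norm.
- exact: integrableZl.
Qed.

Lemma test_function_pderivn al f : test_function Omega f ->
  test_function Omega (pderivn al f).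
Proof.
move=> tf; rewrite /pderivn; elim: (enum 'I_n) => //= i s ih.
by elim: (al i) => //= k ih'; exact: test_function_pderiv.
Qed.

Lemma inner_linear u w f (c : R) : loc_integrable Omega u -> loc_integrable Omega w ->
  test_function Omega f ->
  inner Omega (fun x => u x + c * w x) f = inner Omega u f + c * inner Omega w f.
Proof.
move=> lu lw tf; have mO : measurable Omega by exact: open_row_measurable.
have Iu := loc_integrable_test lu tf; have Iw := loc_integrable_test lw tf.
have Icw : mu.-integrable Omega (EFin \o (fun x => c * (w x * f x))).
  rewrite (_ : _ \o _ = fun x => (c%:E * (w x * f x)%:E)%E).
    exact: integrableZl.
  by apply/funext => x; rewrite -EFinM.
rewrite /inner -RintegralZl// -RintegralD//.
by apply: eq_Rintegral => x _; rewrite mulrDl mulrA.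
Qed.

Lemma loc_integrable_linear u w (c : R) :
  loc_integrable Omega u -> loc_integrable Omega w ->
  loc_integrable Omega (fun x => u x + c * w x).
Proof.
move=> lu lw A cA AO; have mA : measurable A by exact: compact_row_measurable.
apply: (@integrableD _ _ _ mu A mA (EFin \o u) (fun x => c%:E * (w x)%:E)%E).
  exact: lu.
by apply: integrableZl => //; exact: lw.
Qed.

Lemma is_weak_deriv_linear (al : 'I_n -> nat) u u' v v' (c : R) :
  is_weak_deriv Omega al u v -> is_weak_deriv Omega al u' v' ->
  is_weak_deriv Omega al (fun x => u x + c * u' x) (fun x => v x + c * v' x).
Proof.
move=> [lu lv uv] [lu' lv' uv']; split; [exact: loc_integrable_linear..|].
move=> f tf; have tdf := test_function_pderivn al tf.
by rewrite !inner_linear// uv// uv'// mulrDr mulrCA.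
Qed.

Lemma weak_deriv_unique (al : 'I_n -> nat) u v v' :
  is_weak_deriv Omega al u v -> is_weak_deriv Omega al u v' ->
  {ae mu, forall x, Omega x -> v x = v' x}.
Proof.
move=> uv uv'; have [_ l H] := is_weak_deriv_linear (-1) uv uv'.
have : {ae mu, forall x, Omega x -> v x + -1 * v' x = 0}.
  apply: du_bois_reymond => // f tf; have := H f tf.
  have -> : inner Omega (fun x => u x + -1 * u x) (pderivn al f) = 0.
    rewrite /inner (_ : (fun x => _) = cst 0) ?Rintegral_cst ?mul0r//.
      exact: open_row_measurable.
    by apply/funext => x; rewrite mulN1r subrr mul0r.
  move=> /esym/eqP; rewrite mulf_eq0 signr_eq0 => /orP[//|/eqP].
  by [].
apply: filterS => x h Ox; apply/eqP; rewrite -subr_eq0 -mulN1r; apply/eqP.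
exact: h.
Qed.

Lemma weak_derivP i u v : is_weak_deriv Omega (e i) u v ->
  is_weak_deriv Omega (e i) u (weak_deriv Omega (e i) u).
Proof.
move=> uv; rewrite /weak_deriv mdeg_delta /=.
exact: (@getI _ [set v | is_weak_deriv Omega (e i) u v] v).
Qed.

Lemma weak_deriv_ae i u v : is_weak_deriv Omega (e i) u v ->
  {ae mu, forall x, Omega x -> weak_deriv Omega (e i) u x = v x}.
Proof. by move=> uv; apply: weak_deriv_unique (weak_derivP uv) uv. Qed.

Lemma weak_deriv_measurable i u v : is_weak_deriv Omega (e i) u v ->
  measurable_fun Omega (weak_deriv Omega (e i) u).
Proof. by move=> /weak_derivP[_ + _]; exact: loc_integrable_measurable. Qed.

Lemma in_W1_weak_deriv i q u : in_W Omega 1 q u ->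
  is_weak_deriv Omega (e i) u (weak_deriv Omega (e i) u) /\
  in_Lq Omega q (weak_deriv Omega (e i) u).
Proof. by apply; rewrite mdeg_delta. Qed.

Lemma mdeg0 : mdeg (fun _ : 'I_n => 0%N) = 0%N.
Proof. by rewrite /mdeg big1. Qed.

Lemma weak_deriv0 u : weak_deriv Omega (fun=> 0%N) u = u.
Proof. by rewrite /weak_deriv mdeg0 eqxx. Qed.

Lemma in_W1_Lq q u : in_W Omega 1 q u -> in_Lq Omega q u.
Proof. by move=> /(_ (fun=> 0%N)); rewrite mdeg0 weak_deriv0 => -[]. Qed.

Lemma in_W1_loc_integrable q u : in_W Omega 1 q u -> loc_integrable Omega u.
Proof. by move=> /(_ (fun=> 0%N)); rewrite mdeg0 => /(_ isT) [[]]. Qed.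

Lemma Lq_norm_le_W (al : 'I_n -> nat) u : (mdeg al <= 1)%N ->
  (Lq_norm Omega 2%:E (weak_deriv Omega al u) <= W_norm Omega 1 2%:E u)%E.
Proof.
move=> al1; rewrite /W_norm.
have al1' i : (al i < 2)%N.
  by apply: leq_trans (_ : al i <= mdeg al)%N al1; rewrite /mdeg (bigD1 i)//= leq_addr.
pose be : {ffun 'I_n -> 'I_2} := [ffun i => Ordinal (al1' i)].
have E : (fun i => be i : nat) = al by apply/funext => i; rewrite ffunE.
rewrite (bigD1 be)/=; last by rewrite E.
rewrite E -[leLHS]poweRe1 ?Lnorm_ge0// -[X in (_ `^ X)%E](@mulfV _ 2%R)// poweRrM.
apply: gt0_ler_poweR.
- by rewrite invr_ge0.
- by rewrite in_itv /= leey andbT poweR_ge0.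
- rewrite in_itv /= leey andbT adde_ge0 ?poweR_ge0//.
  by apply: sume_ge0 => ? _; exact: poweR_ge0.
- by rewrite leeDl//; apply: sume_ge0 => ? _; exact: poweR_ge0.
Qed.

End weak_derivatives.

(** * Norms and the Sobolev inequality on a bounded open set *)

Section Lq_norms.
Context (R : realType) (n : nat) (Omega : set 'rV[R]_n).
Hypothesis mO : measurable Omega.
Local Notation mu := (@lebesgue_row R n).
Implicit Types (u v w f : 'rV[R]_n -> R) (p q : R).

Lemma measurable_restrict_fun u : measurable_fun Omega u ->
  measurable_fun setT (u \_ Omega).
Proof. by move=> m; apply/measurable_restrict => //; rewrite setTI. Qed.

Lemma Lq_normE q u : q != 0 ->
  Lq_norm Omega q%:E u = ((\int[mu]_(x in Omega) (`|u x| `^ q)%:E) `^ q^-1)%E.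
Proof.
move=> q0; rewrite /Lq_norm unlock; congr (_ `^ _)%E.
rewrite [RHS]integral_mkcond; apply: eq_integral => x _ /=.
by rewrite !patchE; case: ifPn => // _; rewrite normr0 powR0.
Qed.

Lemma Lq_norm_ge0 (q : \bar R) u : (0 <= Lq_norm Omega q u)%E.
Proof. exact: Lnorm_ge0. Qed.

Lemma Lq_normD q u v : 1 <= q -> measurable_fun Omega u -> measurable_fun Omega v ->
  (Lq_norm Omega q%:E (fun x => u x + v x)%R <=
   Lq_norm Omega q%:E u + Lq_norm Omega q%:E v)%E.
Proof.
move=> q1 hu hv; rewrite /Lq_norm.
have -> : (fun x => u x + v x) \_ Omega = (u \_ Omega) \+ (v \_ Omega).
  by apply/funext => x /=; rewrite !patchE; case: ifP => //; rewrite addr0.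
by apply: minkowski_EFin => //; exact: measurable_restrict_fun.
Qed.

Lemma Lq_normN (q : \bar R) u : Lq_norm Omega q (fun x => - u x) = Lq_norm Omega q u.
Proof.
rewrite /Lq_norm -[RHS]oppe_Lnorm; apply: eq_Lnorm => x /=.
by rewrite !patchE; case: ifP => //; rewrite oppr0.
Qed.

Lemma eq_Lq_norm (q : \bar R) u v : (forall x, Omega x -> u x = v x) ->
  Lq_norm Omega q u = Lq_norm Omega q v.
Proof.
move=> uv; apply: eq_Lnorm => x /=; rewrite !patchE.
by case: ifPn => // /set_mem/uv ->.
Qed.

Lemma ae_eq_Lq_norm q u v : q != 0 ->
  measurable_fun Omega u -> measurable_fun Omega v ->
  {ae mu, forall x, Omega x -> u x = v x} ->
  Lq_norm Omega q%:E u = Lq_norm Omega q%:E v.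
Proof.
move=> q0 hu hv uv.
have mp f : measurable_fun Omega f -> measurable_fun Omega (fun x => (`|f x| `^ q)%:E).
  move=> mf; apply/measurable_EFinP; apply: (measurableT_comp (measurable_powR q)).
  exact: (measurableT_comp (@normr_measurable R setT)).
have f0 f x : Omega x -> (0 <= (`|f x| `^ q)%:E)%E.
  by move=> _; rewrite lee_fin powR_ge0.
have E : ae_eq mu Omega (fun x => (`|u x| `^ q)%:E) (fun x => (`|v x| `^ q)%:E).
  by apply: filterS uv => x h Ox; rewrite h.
have I := ge0_ae_eq_integral mO (mp _ hu) (mp _ hv) (f0 u) (f0 v) E.
by rewrite (Lq_normE u q0) (Lq_normE v q0) I.
Qed.

(** Hoelder against the indicator of Omega. *)
Lemma Lq_norm_le_ge1 (p q : R) : (mu Omega < +oo)%E -> 1 <= p <= q ->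
  exists2 K : R, 0 < K & forall u, measurable_fun Omega u ->
    (Lq_norm Omega p%:E u <= K%:E * Lq_norm Omega q%:E u)%E.
Proof.
move=> Ofin /andP[p1]; have p0 : 0 < p by exact: lt_le_trans p1.
rewrite le_eqVlt => /predU1P[<-|pq].
  by exists 1 => // u _; rewrite mul1e.
have q0 : 0 < q by exact: lt_trans pq.
pose th := p / q.
have th0 : 0 < th by rewrite divr_gt0.
have th1 : th < 1 by rewrite ltr_pdivrMr// mul1r.
pose k := fine (mu Omega) `^ ((1 - th) / p).
exists (k + 1) => [|u hu]; first by rewrite ltr_wpDl ?powR_ge0.
apply: (@le_trans _ _ (k%:E * Lq_norm Omega q%:E u)%E); last first.
  by apply: lee_wpmul2r; [exact: Lq_norm_ge0|rewrite lee_fin lerDl].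
have mp (r : R) : measurable_fun setT (fun x => (`|(u \_ Omega) x| `^ r)%:E).
  by apply/measurable_EFinP; apply: measurable_norm_powR; exact: measurable_restrict_fun.
have E (r : R) : r != 0 -> (\int[mu]_(x in Omega) (`|u x| `^ r)%:E =
    \int[mu]_x (`|(u \_ Omega) x| `^ r)%:E)%E.
  move=> r0; rewrite [LHS]integral_mkcond; apply: eq_integral => x _ /=.
  by rewrite !patchE; case: ifPn => // _; rewrite normr0 powR0.
rewrite !Lq_normE ?gt_eqF// !E ?gt_eqF//.
have H : (\int[mu]_x (`|(u \_ Omega) x| `^ p)%:E <=
    (\int[mu]_x (`|(u \_ Omega) x| `^ q)%:E) `^ th * (mu Omega) `^ (1 - th))%E.
  have -> : (\int[mu]_x (`|(u \_ Omega) x| `^ p)%:E =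
     \int[mu]_x (((`|(u \_ Omega) x| `^ q)%:E `^ th) * (\1_Omega x)%:E `^ (1 - th)))%E.
    apply: eq_integral => x _; rewrite !poweR_EFin -powRrM -EFinM; congr EFin.
    rewrite /th (mulrC q) divfK ?gt_eqF// patchE indicE; case: ifPn => xO.
      by rewrite powR1 mulr1.
    by rewrite normr0 powR0 ?mul0r// gt_eqF.
  apply: le_trans (ge0_hoelder _ _ _ _ _ _) _ => //.
  - by rewrite (ltW th0).
  - exact/measurable_EFinP/measurable_indic.
  - by rewrite integral_indic// setIT.
apply: (@le_trans _ _ (((\int[mu]_x (`|(u \_ Omega) x| `^ q)%:E) `^ th *
    (mu Omega) `^ (1 - th)) `^ p^-1)%E).
  apply: gt0_ler_poweR H; first by rewrite invr_ge0 ltW.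
  - by rewrite in_itv /= leey andbT integral_ge0.
  - by rewrite in_itv /= leey andbT mule_ge0// poweR_ge0.
rewrite poweRM ?poweR_ge0// -!poweRrM muleC.
have -> : th / p = q^-1 by rewrite /th mulrAC divff ?gt_eqF// mul1r.
rewrite -(@fineK _ (mu Omega)); last by rewrite ge0_fin_numE.
exact: lexx.
Qed.

End Lq_norms.

Section sobolev_H10.
Context (R : realType) (n : nat) (Omega : set 'rV[R]_n.+2).
Hypothesis (oO : open Omega) (bO : bounded_set Omega).
Local Notation mu := (@lebesgue_row R n.+2).
Local Notation e i := (fun j : 'I_n.+2 => (j == i : nat)).
Local Notation wd i u := (weak_deriv Omega (e i) u).
Implicit Types (u v w f : 'rV[R]_n.+2 -> R) (p q : R).

Let mO : measurable Omega. Proof. exact: open_row_measurable. Qed.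
Let Ofin : (mu Omega < +oo)%E. Proof. exact: bounded_set_lty. Qed.

Lemma sobolev_test f : test_function Omega f ->
  (Lq_norm Omega 2%:E f <= 2%:E * \sum_i
    Lq_norm Omega (2 * n.+2%:R / n.+4%:R)%:E (pderiv i f))%E.
Proof.
move=> tf; have [M Cf] := test_function_C1 tf.
have E g : test_function Omega g -> g \_ Omega = g.
  move=> tg; apply/funext => x; rewrite patchE; case: ifPn => // /negP xO.
  by rewrite (test_function_out tg)// => Ox; apply: xO; rewrite inE.
have -> : (\sum_i Lq_norm Omega (2 * n.+2%:R / n.+4%:R)%:E (pderiv i f) =
    \sum_i 'N[mu]_(2 * n.+2%:R / n.+4%:R)%:E[EFin \o pderiv i f])%E.
  apply: eq_bigr => i _; rewrite /Lq_norm E//; exact: test_function_pderiv.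
by rewrite /Lq_norm E//; exact: sobolev_C1 Cf.
Qed.

(** Apply the inequality to test functions f_k that converge to u in H^1.  The
    exponent of the derivatives is first raised from 2d/(d+2) to b, which is
    possible since Omega has finite measure, and the error f_k - u is measured in
    L^2, which controls L^b since b <= 2. *)
Lemma sobolev_H10 (b : R) : 2 * n.+2%:R / n.+4%:R <= b <= 2 ->
  exists2 S : R, 0 < S & forall u, in_H10 Omega u ->
    (Lq_norm Omega 2%:E u <= S%:E * \sum_i Lq_norm Omega b%:E (wd i u))%E.
Proof.
set b0 := 2 * _ / _ => /andP[b0b b2].
have b01 : 1 <= b0 by rewrite /b0 ler_pdivlMr// mul1r -!natr1; have : 0 <= n%:R :> R by []; lra.
have b1 : 1 <= b by exact: le_trans b0b.
have [|K K0 HK] := @Lq_norm_le_ge1 R _ Omega mO b0 b Ofin; first by rewrite b01.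
have [|L L0 HL] := @Lq_norm_le_ge1 R _ Omega mO b 2 Ofin; first by rewrite b1.
exists (2 * K); first by rewrite mulr_gt0.
move=> u [Wu [f tf fu]].
have [Lmu _] := in_W1_Lq Wu.
have lu := in_W1_loc_integrable Wu.
pose W k := W_norm Omega 1 2%:E (f k \- u).
have mf g : test_function Omega g -> measurable_fun Omega g.
  move=> tg; apply: measurable_funTS; apply: continuous_row_measurable.
  exact: test_function_continuous tg.
have mwu i : measurable_fun Omega (wd i u).
  by have [wi _] := in_W1_weak_deriv i Wu; exact: weak_deriv_measurable wi.
have subE (g h : 'rV[R]_n.+2 -> R) : g \- h = (fun x => g x + -1 * h x).
  by apply/funext => x /=; rewrite mulN1r.
have H0 k : (Lq_norm Omega 2%:E (f k \- u)%R <= W k)%E.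
  rewrite -[in leLHS](@weak_deriv0 _ _ Omega (f k \- u)); apply: Lq_norm_le_W.
  by rewrite mdeg0.
have H1 k i : (Lq_norm Omega 2%:E (fun x => pderiv i (f k) x - wd i u x)%R <= W k)%E.
  have [wi _] := in_W1_weak_deriv i Wu.
  have := is_weak_deriv_linear oO (-1) (test_function_weak_deriv i (tf k)) wi.
  rewrite -!subE => wfu.
  rewrite -(ae_eq_Lq_norm mO _ _ _ (weak_deriv_ae oO wfu)) //.
  - by apply: Lq_norm_le_W; rewrite mdeg_delta.
  - exact: weak_deriv_measurable wfu.
  - by apply: measurable_funB => //; exact: (mf _ (test_function_pderiv i (tf k))).
have key k : (Lq_norm Omega 2%:E u <=
    (2 * K)%:E * (\sum_i Lq_norm Omega b%:E (wd i u)) +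
    (1 + 2 * K * L * n.+2%:R)%:E * W k)%E.
  have W0 : (0 <= W k)%E by exact: poweR_ge0.
  have h1 : (Lq_norm Omega 2%:E u <= Lq_norm Omega 2%:E (f k) + W k)%E.
    apply: le_trans (leeD2l _ (H0 k)).
    rewrite -[in leLHS](_ : (fun x => f k x + - (f k \- u)%R x)%R = u); last first.
      by apply/funext => x /=; rewrite opprB addrC subrK.
    rewrite -[X in (_ <= _ + X)%E]Lq_normN.
    apply: Lq_normD => //; first by rewrite ler1n.
      exact: mf.
    by apply: measurableT_comp => //; apply: measurable_funB => //; exact: mf.
  have h2 i : (Lq_norm Omega b0%:E (pderiv i (f k)) <=
      K%:E * (Lq_norm Omega b%:E (wd i u) + L%:E * W k))%E.
    have mp : measurable_fun Omega (pderiv i (f k)) by exact: (mf _ (test_function_pderiv i (tf k))).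
    apply: le_trans (HK _ mp) _; apply: lee_wpmul2l; first by rewrite lee_fin ltW.
    apply: (@le_trans _ _ (Lq_norm Omega b%:E (wd i u) +
      Lq_norm Omega b%:E (fun x => pderiv i (f k) x - wd i u x)%R)%E).
      rewrite -[in leLHS](_ : (fun x => wd i u x + (pderiv i (f k) x - wd i u x))%R =
        pderiv i (f k)); last by apply/funext => x; rewrite addrC subrK.
      by apply: Lq_normD => //; exact: measurable_funB.
    apply: leeD2l; apply: le_trans (HL _ _) _; first exact: measurable_funB.
    by apply: lee_wpmul2l (H1 k i); rewrite lee_fin ltW.
  apply: le_trans h1 _.
  have c0 : 0 <= 2 * K * L * n.+2%:R by rewrite !mulr_ge0// ltW.
  have -> : ((1 + 2 * K * L * n.+2%:R)%:E * W k =
             W k + (2 * K * L * n.+2%:R)%:E * W k)%E.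
    by rewrite [(1 + _)%:E]EFinD ge0_muleDl ?mul1e// lee_fin.
  rewrite [leRHS]addeCA [leLHS]addeC; apply: leeD2l.
  apply: le_trans (sobolev_test (tf k)) _.
  apply: (@le_trans _ _ (2%:E * \sum_i
      (K%:E * (Lq_norm Omega b%:E (wd i u) + L%:E * W k)))%E).
    by apply: lee_wpmul2l => //; apply: lee_sum => i _; exact: h2.
  rewrite -ge0_sume_distrr; last first.
    by move=> i _; rewrite adde_ge0 ?Lq_norm_ge0// mule_ge0// lee_fin ltW.
  rewrite big_split /= muleA -EFinM ge0_muleDr; last 2 first.
  - by apply: sume_ge0 => i _; exact: Lq_norm_ge0.
  - by apply: sume_ge0 => i _; rewrite mule_ge0// lee_fin ltW.
  have -> : (\sum_(i < n.+2) (L%:E * W k) = n.+2%:R%:E * (L%:E * W k))%E.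
    by rewrite mule_natl sumr_const card_ord.
  apply: leeD2l; rewrite (_ : (2 * K * L * n.+2%:R)%R = ((2 * K) * (n.+2%:R * L))%R); last by ring.
  by rewrite !muleA -!EFinM !mulrA lexx.
have W0 : ((1 + 2 * K * L * n.+2%:R)%:E * W k)%E @[k --> \oo] --> 0%E.
  by rewrite -[X in _ --> X](mule0 (1 + 2 * K * L * n.+2%:R)%:E); apply: cvgeZl.
have WK0 : ((2 * K)%:E * (\sum_i Lq_norm Omega b%:E (wd i u)) +
    (1 + 2 * K * L * n.+2%:R)%:E * W k)%E @[k --> \oo] -->
    ((2 * K)%:E * (\sum_i Lq_norm Omega b%:E (wd i u)))%E.
  rewrite -[X in _ --> X]adde0; apply: cvgeD W0; last exact: cvg_cst.
  by rewrite fin_num_adde_defl.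
by apply: cvge_ge WK0; apply: nearW => k; exact: key.
Qed.

End sobolev_H10.

(** * Coercivity of the Forchheimer flux *)

Lemma gt0_powRD (R : realType) (x r s : R) : 0 < x -> x `^ (r + s) = x `^ r * x `^ s.
Proof. by move=> x0; rewrite powRD// (gt_eqF x0) implybT. Qed.

Section forchheimer_bounds.
Context (R : realType) (N : nat) (al a : 'I_N.+1 -> R).
Hypothesis hN : (1 <= N)%N.
Hypothesis hal0 : al ord0 = 0.
Hypothesis hal : forall i j : 'I_N.+1, (i < j)%N -> al i < al j.
Hypothesis ha : forall i, 0 <= a i.
Hypothesis ha0 : 0 < a ord0.
Local Notation g := (gpoly al a).
Local Notation K := (Kfun al a).
Local Notation aN := (a_exp al).
Local Notation beta := (beta_exp al).
Local Notation lambda := (lambda_exp al).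

Lemma alpha_ge0 i : 0 <= al i.
Proof.
have [->|i0] := eqVneq i ord0; first by rewrite hal0.
by rewrite -hal0 ltW// hal// lt0n.
Qed.

Lemma alpha_le_max i : al i <= al ord_max.
Proof.
have [->//|im] := eqVneq i ord_max.
rewrite ltW// hal// ltn_neqAle leq_ord andbT.
by apply: contra im => /eqP im; apply/eqP/val_inj.
Qed.

Lemma alpha_max_gt0 : 0 < al ord_max.
Proof. by rewrite -hal0 hal. Qed.

Lemma a_exp_itv : 0 < aN < 1.
Proof.
have h := alpha_max_gt0; rewrite /a_exp divr_gt0 ?addr_gt0//=.
by rewrite ltr_pdivrMr ?mul1r ?ltrDl// addr_gt0.
Qed.

Lemma beta_exp_itv : 1 < beta < 2.
Proof. by have /andP[h1 h2] := a_exp_itv; rewrite /beta_exp; apply/andP; split; lra. Qed.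

Lemma onem_a_exp : 1 - aN = (al ord_max + 1)^-1.
Proof.
have h := alpha_max_gt0; rewrite /a_exp.
by field; rewrite gt_eqF// addr_gt0.
Qed.

(** lambda is the exponent conjugate to beta. *)
Lemma lambda_expE : lambda = 1 + (beta - 1)^-1.
Proof.
have /andP[h1 h2] := a_exp_itv; rewrite /lambda_exp /beta_exp.
have E : 2 - aN - 1 != 0 by rewrite gt_eqF//; lra.
have E' : 1 - aN != 0 by rewrite gt_eqF//; lra.
by field; rewrite E.
Qed.

Lemma gpoly_ge s : a ord0 <= g s.
Proof.
rewrite /gpoly (bigD1 ord0)//= hal0 powRr0 mulr1 lerDl.
by apply: sumr_ge0 => i _; rewrite mulr_ge0 ?powR_ge0.
Qed.

Lemma gpoly_gt0 s : 0 < g s.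
Proof. exact: lt_le_trans (gpoly_ge s). Qed.

Lemma gpoly_homo s t : 0 <= s -> s <= t -> g s <= g t.
Proof.
move=> s0 st; apply: ler_sum => i _; apply: ler_wpM2l => //.
apply: ge0_ler_powR => //; rewrite ?nnegrE ?alpha_ge0//.
exact: le_trans st.
Qed.

(** Existence by the intermediate value theorem on [0, xi / a_0], as g >= a_0;
    |s| replaces s to have a function that is continuous on the whole line. *)
Lemma s_ofP xi : 0 <= xi -> 0 <= s_of al a xi /\ s_of al a xi * g (s_of al a xi) = xi.
Proof.
move=> xi0; pose F s := s * \sum_i a i * `|s| `^ al i.
have cF : continuous F.
  apply: continuous_funM; first exact: (fun x => cvg_id).
  have -> : (fun s : R => \sum_i a i * `|s| `^ al i) =
      \sum_i (fun s : R => a i * `|s| `^ al i).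
    by apply/funext => s; rewrite fct_sumE.
  elim/big_ind : _ => //.
  - by move=> x; exact: cvg_cst.
  - by move=> f h cf ch; exact: continuous_funD.
  - move=> i _; apply: continuous_funM; first by move=> x; exact: cvg_cst.
    exact/continuous_norm_powR/alpha_ge0.
have FE s : 0 <= s -> F s = s * g s.
  by move=> s0; rewrite /F ger0_norm.
pose M := xi / a ord0.
have M0 : 0 <= M by rewrite divr_ge0// ltW.
have [|c] := @IVT R F 0 M xi M0 (continuous_subspaceT cF).
  rewrite !FE// mul0r.
  have MF : xi <= M * g M.
    rewrite -[leLHS](@divfK _ (a ord0)) ?gt_eqF// ler_wpM2l//; exact: gpoly_ge.
  have MF0 := le_trans xi0 MF.
  by rewrite (min_l MF0) (max_r MF0) xi0 MF.
rewrite in_itv /= => /andP[c0 cM] Fc.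
exact: (@getI _ [set s | 0 <= s /\ s * g s = xi] c (conj c0 (etrans (esym (FE _ c0)) Fc))).
Qed.

Lemma s_of_ge0 xi : 0 <= xi -> 0 <= s_of al a xi.
Proof. by move=> /s_ofP[]. Qed.

Lemma s_of_homo xi eta : 0 <= xi -> xi <= eta -> s_of al a xi <= s_of al a eta.
Proof.
move=> xi0 xieta; have eta0 := le_trans xi0 xieta.
have [s0 sE] := s_ofP xi0; have [t0 tE] := s_ofP eta0.
rewrite leNgt; apply/negP => ts; move: xieta; apply/negP; rewrite -ltNge -sE -tE.
apply: (@le_lt_trans _ _ (s_of al a eta * g (s_of al a xi))).
  by apply: ler_wpM2l => //; apply: gpoly_homo => //; exact: ltW.
by rewrite ltr_pM2r// gpoly_gt0.
Qed.

Lemma Kfun_gt0 xi : 0 < K xi.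
Proof. by rewrite /Kfun invr_gt0 gpoly_gt0. Qed.

Lemma Kfun_le xi : K xi <= (a ord0)^-1.
Proof. by rewrite /Kfun lef_pV2 ?posrE ?gpoly_gt0// gpoly_ge. Qed.

Lemma Kfun_nincr xi eta : 0 <= xi -> xi <= eta -> K eta <= K xi.
Proof.
move=> xi0 xe; rewrite /Kfun lef_pV2 ?posrE ?gpoly_gt0//.
by apply: gpoly_homo; [exact: s_of_ge0|exact: s_of_homo].
Qed.

(** K is only controlled on the nonnegative axis, hence the maximum. *)
Lemma measurable_Kfun : measurable_fun setT (fun xi : R => K (Num.max 0 xi)).
Proof.
apply: nonincreasing_measurable => // xi eta xe.
apply: Kfun_nincr; first by rewrite le_max lexx.
by rewrite ge_max !le_max lexx /= xe orbT.
Qed.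

(** The summand 1 makes eps / gbound at most 1 for every eps <= 1. *)
Definition gbound := 1 + \sum_i a i.

Lemma gbound_ge1 : 1 <= gbound.
Proof. by rewrite lerDl sumr_ge0. Qed.

Lemma gpoly_le s : 0 <= s -> g s <= gbound * Num.max 1 (s `^ al ord_max).
Proof.
move=> s0; apply: (@le_trans _ _ ((\sum_i a i) * Num.max 1 (s `^ al ord_max))).
  rewrite mulr_suml; apply: ler_sum => i _; apply: ler_wpM2l => //.
  rewrite le_max; have [s1|s1] := leP s 1.
    apply/orP; left; have [->|sN0] := eqVneq s 0.
      by rewrite /powR eqxx; case: eqP.
    rewrite -[leRHS](powRr0 s); apply: ger_powR; first by rewrite lt0r sN0 s0.
    exact: alpha_ge0.
  by apply/orP; right; apply: ler_powR; [exact: ltW|exact: alpha_le_max].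
by apply: ler_wpM2r; rewrite ?le_max ?ler01// /gbound lerDr.
Qed.

(** Write p = alpha_N, B = gbound.  If s > 1 then xi <= B s^(p+1).  If s <= 1 then
    xi <= B s, and s^p is at least (eps / B)^p since xi >= eps.  In both cases
    (xi / B) (eps / B)^p <= s^(p+1), and a = p / (p+1). *)
Lemma s_of_ge xi (eps : R) : 0 < eps <= 1 -> eps <= xi ->
  gbound^-1 * (eps `^ aN * xi `^ (1 - aN)) <= s_of al a xi.
Proof.
move=> /andP[e0 e1] exi; have xi0 : 0 < xi by exact: lt_le_trans exi.
have [s0 sE] := s_ofP (ltW xi0); set s := s_of al a xi in s0 sE *.
have h := alpha_max_gt0; set p := al ord_max in h.
have p1 : 0 < p + 1 by lra.
have B1 := gbound_ge1; set B := gbound in B1 *.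
have B0 : 0 < B by lra.
have sp : 0 < s.
  rewrite lt0r s0 andbT; apply/eqP => s00; move: sE; rewrite s00 mul0r => x0.
  by rewrite -x0 ltxx in xi0.
have eB0 : 0 <= eps / B by rewrite divr_ge0 ?ltW.
have key : (xi / B) * (eps / B) `^ p <= s `^ (p + 1).
  rewrite powRD ?gt_eqF ?implybT// powRr1// [leRHS]mulrC.
  have xB : xi <= s * (B * Num.max 1 (s `^ p)).
    by rewrite -sE ler_wpM2l//; exact: gpoly_le.
  have [s1|s1] := leP s 1.
    have sp1 : s `^ p <= 1.
      by rewrite -(powRr0 s); apply: ger_powR; [rewrite sp|exact: ltW].
    rewrite max_l// mulr1 in xB.
    have xBs : xi / B <= s by rewrite ler_pdivrMr.
    apply: ler_pM => //.
    - by rewrite divr_ge0 ?(ltW xi0) ?(ltW B0).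
    - exact: powR_ge0.
    - apply: ge0_ler_powR => //; rewrite ?nnegrE ?(ltW h)//.
      by apply: le_trans xBs; rewrite ler_pM2r ?invr_gt0.
  have sp1 : 1 <= s `^ p.
    by rewrite -[leLHS](powRr0 s); apply: ler_powR; [exact: ltW|exact: ltW].
  rewrite max_r// in xB.
  apply: (@le_trans _ _ (xi / B)); last by rewrite ler_pdivrMr//; lra.
  rewrite ler_piMr//; first by rewrite divr_ge0 ?(ltW xi0) ?(ltW B0).
  have eB1 : eps / B <= 1 by rewrite ler_pdivrMr//; lra.
  rewrite -(powRr0 (eps / B)); apply: ger_powR; last exact: ltW.
  by rewrite eB1 andbT divr_gt0.
have := @ge0_ler_powR _ (1 - aN) _ _ _ _ _ key.
rewrite !nnegrE -powRrM onem_a_exp mulfV ?gt_eqF// (powRr1 s0).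
rewrite powR_ge0 mulr_ge0 ?powR_ge0 ?divr_ge0 ?(ltW xi0) ?(ltW B0)// invr_ge0 (ltW p1).
move=> /(_ isT isT isT); apply: le_trans.
rewrite [leRHS]powRM ?powR_ge0 ?divr_ge0 ?(ltW xi0) ?(ltW B0)// -powRrM.
rewrite -/(a_exp al) !powRM ?invr_ge0 ?(ltW xi0) ?(ltW e0) ?(ltW B0)//.
have BE : B^-1 = B^-1 `^ (p + 1)^-1 * B^-1 `^ aN.
  rewrite -gt0_powRD ?invr_gt0// -/p -onem_a_exp subrK powRr1// invr_ge0 ltW//.
rewrite [X in X * _]BE le_eqVlt; apply/orP; left; apply/eqP.
by rewrite /p; ring.
Qed.

Lemma Kfun_mul xi : 0 <= xi -> K xi * xi = s_of al a xi.
Proof.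
move=> /s_ofP[s0 sE]; rewrite -[X in _ * X]sE /Kfun mulrCA mulVf ?mulr1//.
by rewrite gt_eqF// gpoly_gt0.
Qed.

(** K(xi) xi^2 = s(xi) xi; for xi < eps the left-hand side is negative because
    eps^a eps^beta = eps^2. *)
Lemma Kfun_sqr_ge xi eps : 0 <= xi -> 0 < eps <= 1 ->
  gbound^-1 * (eps `^ aN * xi `^ beta - eps ^+ 2) <= K xi * xi ^+ 2.
Proof.
move=> xi0 e01; have /andP[e0 e1] := e01.
have Bi : 0 <= gbound^-1 by rewrite invr_ge0 (le_trans _ gbound_ge1).
have [exi|xie] := leP eps xi.
  have xi1 : 0 < xi by exact: lt_le_trans exi.
  rewrite expr2 mulrA Kfun_mul//.
  apply: (@le_trans _ _ (gbound^-1 * (eps `^ aN * xi `^ beta))).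
    by rewrite ler_wpM2l// lerBlDr lerDl sqr_ge0.
  have -> : beta = 1 - aN + 1 by rewrite /beta_exp; ring.
  rewrite gt0_powRD//.
  by rewrite powRr1// !mulrA ler_wpM2r// -mulrA s_of_ge.
have /andP[b1 _] := beta_exp_itv.
apply: (@le_trans _ _ 0); last by rewrite mulr_ge0 ?sqr_ge0 ?ltW ?Kfun_gt0.
rewrite mulr_ge0_le0// subr_le0.
have -> : eps ^+ 2 = eps `^ aN * eps `^ beta.
  rewrite -gt0_powRD//.
  by rewrite /beta_exp addrC subrK -powR_mulrn// ltW.
rewrite ler_wpM2l ?powR_ge0//; apply: ge0_ler_powR; rewrite ?nnegrE ?(ltW e0) ?(ltW xie)//.
by rewrite (le_trans _ (ltW b1)).
Qed.

Section coercivity.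
Context (d : nat).
Implicit Types y z : 'rV[R]_d.

Lemma dotv_ge0 y : 0 <= dotv y y.
Proof. by apply: sumr_ge0 => i _; rewrite -expr2 sqr_ge0. Qed.

Lemma enorm_ge0 y : 0 <= enorm y.
Proof. exact: sqrtr_ge0. Qed.

Lemma sqr_enorm y : enorm y ^+ 2 = dotv y y.
Proof. by rewrite sqr_sqrtr// dotv_ge0. Qed.

Lemma coord_le_enorm y i : `|y ord0 i| <= enorm y.
Proof.
rewrite -sqrtr_sqr ler_sqrt ?dotv_ge0// /dotv (bigD1 i)//= -expr2 lerDl.
by apply: sumr_ge0 => j _; rewrite -expr2 sqr_ge0.
Qed.

Lemma dotv_sub_le y z : dotv (y - z) (y - z) <= 2 * dotv y y + 2 * dotv z z.
Proof.
rewrite /dotv !mulr_sumr -big_split/=; apply: ler_sum => i _; rewrite !mxE.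
by have := sqr_ge0 (y ord0 i + z ord0 i); rewrite -!expr2; lra.
Qed.

(** 2 y . (y - z) = |y|^2 - |z|^2 + |y - z|^2. *)
Lemma dotv_mid_le y z : dotv y y - dotv z z <= 2 * dotv y (y - z).
Proof.
rewrite /dotv mulr_sumr -sumrB; apply: ler_sum => i _; rewrite !mxE.
by have := sqr_ge0 (y ord0 i - z ord0 i); rewrite expr2; lra.
Qed.

Lemma enorm_sub_powR y z :
  enorm (y - z) `^ beta <= 2 `^ beta * (enorm y `^ beta + enorm z `^ beta).
Proof.
have /andP[b1 _] := beta_exp_itv; have b0 : 0 <= beta by lra.
pose m := Num.max (enorm y) (enorm z).
have m0 : 0 <= m by rewrite le_max enorm_ge0.
have h : enorm (y - z) <= 2 * m.
  rewrite -(@ler_pXn2r _ 2) ?nnegrE ?enorm_ge0 ?mulr_ge0//.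
  rewrite sqr_enorm (le_trans (dotv_sub_le _ _))// -!sqr_enorm exprMn.
  have ym : enorm y ^+ 2 <= m ^+ 2.
    by rewrite ler_pXn2r ?nnegrE ?enorm_ge0// le_max lexx.
  have zm : enorm z ^+ 2 <= m ^+ 2.
    by rewrite ler_pXn2r ?nnegrE ?enorm_ge0// le_max lexx orbT.
  lra.
apply: (@le_trans _ _ ((2 * m) `^ beta)).
  by apply: ge0_ler_powR; rewrite ?nnegrE ?enorm_ge0 ?mulr_ge0.
rewrite powRM// ler_wpM2l ?powR_ge0// /m maxEle.
by case: ifP => _; rewrite ?lerDr ?lerDl powR_ge0.
Qed.

Lemma powR_beta_le (x eps : R) : 0 <= x -> 0 < eps ->
  eps `^ aN * x `^ beta <= eps ^+ 2 + x ^+ 2.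
Proof.
move=> x0 e0; have /andP[b1 b2] := beta_exp_itv; have /andP[a0 a1] := a_exp_itv.
pose m := Num.max eps x.
have m0 : 0 < m by rewrite lt_max e0.
apply: (@le_trans _ _ (m `^ aN * m `^ beta)).
  apply: ler_pM; rewrite ?powR_ge0//; apply: ge0_ler_powR;
    rewrite ?nnegrE ?(ltW e0) ?(ltW m0) ?(ltW a0)// ?le_max ?lexx ?orbT//.
  by rewrite (le_trans _ (ltW b1)).
rewrite -gt0_powRD//.
rewrite /beta_exp addrC subrK powR_mulrn ?(ltW m0)// /m maxEle.
by case: ifP => _; rewrite ?lerDr ?lerDl sqr_ge0.
Qed.

(** K(|y|) y . (y - z) is at least K(|y|) (|y|^2 - |z|^2) / 2, where the first part
    is bounded below by Kfun_sqr_ge and K <= 1 / a_0 in the second one; finally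
    |y - z|^beta is at most a multiple of |y|^beta + |z|^beta, and
    eps^a |z|^beta <= eps^2 + |z|^2. *)
Lemma flux_coercive y z eps : 0 < eps <= 1 ->
  (2 `^ beta * (2 * gbound))^-1 * (eps `^ aN * enorm (y - z) `^ beta) <=
  dotv (K (enorm y) *: y) (y - z)
    + (1 + (a ord0)^-1) * (eps ^+ 2 + dotv z z).
Proof.
move=> e01; have /andP[e0 e1] := e01.
have B1 := gbound_ge1; set B := gbound in B1 *.
have B0 : 0 < B by lra.
have P2 : 0 < 2 `^ beta :> R by rewrite powR_gt0.
have D : dotv (K (enorm y) *: y) (y - z) = K (enorm y) * dotv y (y - z).
  by rewrite /dotv mulr_sumr; apply: eq_bigr => i _; rewrite !mxE mulrA.
have K0 := Kfun_gt0 (enorm y); have K1 := Kfun_le (enorm y).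
have := Kfun_sqr_ge (enorm_ge0 y) e01; rewrite -/B sqr_enorm => Ky.
have h1 : K (enorm y) * dotv y y - (a ord0)^-1 * dotv z z <=
    2 * dotv (K (enorm y) *: y) (y - z).
  rewrite D mulrCA; apply: le_trans (ler_wpM2l (ltW K0) (dotv_mid_le y z)).
  by rewrite mulrBr lerB// ler_wpM2r// dotv_ge0.
have h2 := enorm_sub_powR y z.
have h3 := powR_beta_le (enorm_ge0 z) e0; rewrite sqr_enorm in h3.
have z0 := dotv_ge0 z; have e20 := sqr_ge0 eps.
have h4 : eps `^ aN * enorm (y - z) `^ beta <=
    2 `^ beta * (eps `^ aN * enorm y `^ beta + (eps ^+ 2 + dotv z z)).
  apply: (le_trans (ler_wpM2l (powR_ge0 eps aN) h2)).
  by rewrite mulrCA ler_wpM2l ?(ltW P2)// mulrDr lerD2l.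
rewrite invfM -mulrA mulrCA.
set X := eps `^ aN * enorm (y - z) `^ beta in h4 *.
set Y := eps `^ aN * enorm y `^ beta in h4 Ky *.
set W := (X in _ <= X).
have Bi0 : 0 < B^-1 by rewrite invr_gt0.
have Bi1 : B^-1 <= 1 by rewrite invf_le1.
have ai0 : 0 < (a ord0)^-1 by rewrite invr_gt0.
have h5 : (2 `^ beta)^-1 * X <= Y + (eps ^+ 2 + dotv z z).
  by rewrite mulrC ler_pdivrMr// mulrC.
apply: (@le_trans _ _ ((2 * B)^-1 * (Y + (eps ^+ 2 + dotv z z)))).
  apply: ler_wpM2l h5.
  by rewrite invr_ge0 mulr_ge0// ltW.
rewrite invfM -mulrA; set e2 := eps ^+ 2 in Ky e20 h5 W *.
set zz := dotv z z in z0 h1 h5 W *.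
have h6 : B^-1 * (Y + (e2 + zz)) <= B^-1 * (Y - e2) + (2 * e2 + zz).
  have -> : B^-1 * (Y + (e2 + zz)) = B^-1 * (Y - e2) + B^-1 * (2 * e2 + zz) by ring.
  by rewrite lerD2l ler_piMl//; lra.
have ae : 0 <= (a ord0)^-1 * e2 by rewrite mulr_ge0// ltW.
have az : 0 <= (a ord0)^-1 * zz by rewrite mulr_ge0// ltW.
rewrite /W; lra.
Qed.

End coercivity.

End forchheimer_bounds.

(** Either Y <= kap X^(b-1), or X is at most (Y / kap)^(1/(b-1)). *)
Lemma young (R : realType) (b kap X Y : R) : 1 < b -> 0 < kap -> 0 <= X -> 0 <= Y ->
  X * Y <= kap * X `^ b + kap `^ (- (b - 1)^-1) * Y `^ (1 + (b - 1)^-1).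
Proof.
move=> b1 k0 X0 Y0; pose c := b - 1; have c0 : 0 < c by rewrite /c; lra.
have ci0 : 0 < c^-1 by rewrite invr_gt0.
have [h|h] := leP Y (kap * X `^ c).
  apply: (@le_trans _ _ (kap * X `^ b)); last by rewrite lerDl mulr_ge0 ?powR_ge0.
  have -> : X `^ b = X * X `^ c.
    have [->|XN0] := eqVneq X 0.
      by rewrite mul0r powR0// gt_eqF//; lra.
    rewrite -[X in X * _]powRr1// -powRD; last by rewrite XN0 implybT.
    by rewrite /c addrC subrK.
  by rewrite mulrCA ler_wpM2l.
apply: (@le_trans _ _ (kap `^ (- c^-1) * Y `^ (1 + c^-1))); last first.
  by rewrite lerDr mulr_ge0 ?powR_ge0// ltW.
have Yp : 0 < Y by apply: le_lt_trans h; rewrite mulr_ge0 ?powR_ge0// ltW.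
rewrite gt0_powRD// powRr1// mulrCA mulrC ler_wpM2l// powRN mulrC ler_pdivlMr ?powR_gt0//.
have -> : X * kap `^ c^-1 = (kap * X `^ c) `^ c^-1.
  rewrite powRM ?powR_ge0 ?(ltW k0)// -powRrM mulfV ?gt_eqF// powRr1//; exact: mulrC.
by apply: ge0_ler_powR; rewrite ?nnegrE ?mulr_ge0 ?powR_ge0// ltW.
Qed.

(** * Scalar differential inequalities *)

Section ode.
Context (R : realType).
Implicit Types (y z : R -> R) (t T m : R).

(** The function is 2 max(x, 0)^2, a C^1 substitute for the positive part. *)
Lemma is_derive_sqr_pos (x : R) :
  is_derive x 1 (fun x : R => x ^+ 2 + odd_powR 2 x) (2 * (x + `|x|)).
Proof.
have h1 : is_derive x 1 (fun x : R => x ^+ 2) (2 * x).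
  apply: is_derive_eq (is_deriveX 2 (is_derive_id x 1)) _.
  by rewrite expr1; exact: mulr1.
have h2 := @is_derive_odd_powR R 2 x (ler1n _ 2).
apply: is_derive_eq (is_deriveD h1 h2) _.
by rewrite (_ : 2 - 1 = 1) ?powRr1// ?mulrDr//; lra.
Qed.

(** The derivative of max(y - m, 0)^2 is nonpositive, so this function stays 0. *)
Lemma barrier y z m t0 T : t0 <= T -> {within `[t0, T], continuous y} ->
  (forall t, t0 < t < T -> is_derive t 1 y (z t)) ->
  (forall t, t0 < t < T -> m < y t -> z t <= 0) ->
  y t0 <= m -> y T <= m.
Proof.
move=> t0T cy dy zy y0.
pose h (x : R) := x ^+ 2 + odd_powR 2 x.
have hE x : h x = x * (x + `|x|).
  by rewrite /h /odd_powR (_ : 2 - 1 = 1 :> R) ?powRr1//; lra.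
have ch : continuous h.
  exact: is_derive_continuous is_derive_sqr_pos.
have dF t : t0 < t < T -> is_derive t 1 (fun s => h (y s - m)) (2 * (y t - m + `|y t - m|) * z t).
  move=> tT; apply: (@is_derive1_comp _ h (fun s => y s - m)).
    exact: is_derive_sqr_pos.
  by apply: is_derive_eq (is_deriveB (dy t tT) (is_derive_cst m t 1)) _; rewrite subr0.
have : h (y T - m) <= h (y t0 - m).
  apply: (@ler0_derive1_le_cc _ (fun s => h (y s - m)) t0 T) => //.
  - by move=> t; rewrite in_itv /= => tT; exact: (@ex_derive _ _ _ _ _ _ _ (dF t tT)).
  - move=> t; rewrite in_itv /= => tT; rewrite derive1E.
    rewrite (@derive_val _ _ _ _ _ _ _ (dF t tT)).
    have [ym|my] := leP (y t) m.
      by rewrite ler0_norm ?subr_le0// subrr mulr0 mul0r.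
    by rewrite mulr_ge0_le0 ?zy// mulr_ge0// addr_ge0// subr_ge0 ltW.
  - move=> t; apply: (@continuous_comp _ _ _ (fun s : subspace `[t0, T] => y s - m) h).
      by apply: cvgB; [exact: cy|exact: cvg_cst].
    exact: ch.
  - by rewrite in_itv /= t0T lexx.
  - by rewrite in_itv /= lexx t0T.
rewrite !hE [X in _ <= X](_ : _ = 0); last first.
  by rewrite ler0_norm ?subr_le0// subrr mulr0.
rewrite leNgt => H; rewrite leNgt; apply/negP => mT; move/negP: H; apply.
by rewrite ger0_norm ?subr_ge0 ?(ltW mT)//; apply: mulr_gt0; lra.
Qed.

(** As long as y > m it decreases at rate eta, which a nonnegative function
    cannot do forever; after that the level m is a barrier. *)
Lemma descent y z m eta T0 : 0 < T0 -> 0 < eta ->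
  {within `[0, +oo[, continuous y} ->
  (forall t, 0 <= t -> 0 <= y t) ->
  (forall t, 0 < t -> is_derive t 1 y (z t)) ->
  (forall t, T0 < t -> m < y t -> z t <= - eta) ->
  exists2 T1, T0 <= T1 & forall t, T1 <= t -> y t <= m.
Proof.
move=> T00 eta0 cy y0 dy zy.
have cy' a b : 0 <= a -> {within `[a, b], continuous y}.
  by move=> a0; apply: continuous_subspaceW cy => x /=; rewrite !in_itv /= andbT => /andP[/(le_trans a0)].
have [[T1 T01 yT1]|no] := pselect (exists2 T1, T0 <= T1 & y T1 <= m).
  exists T1 => // t T1t; apply: (@barrier y z m T1 t) => //.
  - by apply: cy'; rewrite (le_trans (ltW T00)).
  - by move=> s /andP[T1s _]; apply: dy; rewrite (lt_trans T00)// (le_lt_trans T01).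
  - move=> s /andP[T1s _] my; apply: le_trans (zy _ _ my) _; last by rewrite oppr_le0 ltW.
    exact: le_lt_trans T1s.
have above t : T0 <= t -> m < y t.
  by move=> T0t; rewrite ltNge; apply/negP => h; apply: no; exists t.
exfalso; pose T := T0 + y T0 / eta + 1.
have T0T : T0 < T.
  by rewrite /T -addrA ltrDl ltr_wpDl// divr_ge0 ?y0 ?ltW.
pose f t := y t + eta * t.
have df t : T0 < t < T -> is_derive t 1 f (z t + eta).
  move=> /andP[T0t _]; apply: is_deriveD; first by apply: dy; exact: lt_trans T0t.
  apply: is_derive_eq (is_deriveM (is_derive_cst eta t 1) (is_derive_id t 1)) _.
  by rewrite scaler0 addr0; exact: mulr1.
have : f T <= f T0.
  apply: (@ler0_derive1_le_cc _ f T0 T) => //.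
  - by move=> t; rewrite in_itv /= => tT; exact: (@ex_derive _ _ _ _ _ _ _ (df t tT)).
  - move=> t; rewrite in_itv /= => tT; rewrite derive1E.
    rewrite (@derive_val _ _ _ _ _ _ _ (df t tT)) -lerBrDr sub0r.
    by case/andP: tT => T0t _; apply: zy => //; apply: above; exact: ltW.
  - move=> t; apply: cvgD; first exact: (cy' _ _ (ltW T00)).
    apply: cvgM; first exact: cvg_cst.
    exact: (@continuous_subspaceT _ _ _ id (fun x => cvg_id)).
  - by rewrite in_itv /= lexx andbT ltW.
  - by rewrite in_itv /= lexx ltW.
  - exact: ltW.
have yT : 0 <= y T by rewrite y0// (le_trans (ltW T00))// ltW.
have E : eta * T = eta * T0 + y T0 + eta.
  by rewrite /T; field; rewrite gt_eqF.
by rewrite /f E; lra.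
Qed.

Section power_decay.
Variables (y z : R -> R) (kap p M : R).
Hypotheses (kap0 : 0 < kap) (p0 : 0 < p) (M0 : 0 <= M).
Hypothesis cy : {within `[0, +oo[, continuous y}.
Hypothesis y0 : forall t, 0 <= t -> 0 <= y t.
Hypothesis dy : forall t, 0 < t -> is_derive t 1 y (z t).
(** The level at which the damping kap y^p balances the source M. *)
Let L := (M / kap) `^ p^-1.

Let Lp : L `^ p = M / kap.
Proof. by rewrite -powRrM mulVf ?gt_eqF// powRr1// divr_ge0// ltW. Qed.

Lemma power_decay_le T : 0 < T ->
  (forall t, 0 < t < T -> z t <= M - kap * y t `^ p) ->
  y T <= Num.max (y 0) L.
Proof.
move=> T0 zy; apply: (@barrier y z _ 0 T (ltW T0)).
- by apply: continuous_subspaceW cy => x /=; rewrite !in_itv /= andbT => /andP[].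
- by move=> t /andP[t0 _]; exact: dy.
- move=> t tT; rewrite gt_max => /andP[_ Ly].
  apply: (le_trans (zy t tT)); rewrite subr_le0 mulrC -ler_pdivrMr// -Lp.
  apply: ge0_ler_powR; rewrite ?nnegrE ?powR_ge0 ?(ltW Ly) ?(ltW p0)//.
  by rewrite y0// ltW//; case/andP: tT.
- by rewrite le_max lexx.
Qed.

Lemma power_decay_eventually T0 del : 0 < T0 -> 0 < del ->
  (forall t, T0 < t -> z t <= M - kap * y t `^ p) ->
  exists2 T1, T0 <= T1 & forall t, T1 <= t -> y t <= L + del.
Proof.
move=> T00 del0 zy; have L0 : 0 <= L by exact: powR_ge0.
pose eta := kap * (L + del) `^ p - M.
have eta0 : 0 < eta.
  rewrite subr_gt0 mulrC -ltr_pdivrMr// -Lp.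
  by apply: gt0_ltr_powR; rewrite ?nnegrE//; lra.
apply: (@descent y z _ eta T0) => // t T0t yt.
apply: (le_trans (zy t T0t)); rewrite /eta opprB lerD2l lerN2 ler_wpM2l ?ltW//.
apply: gt0_ltr_powR; rewrite ?nnegrE//; first by lra.
by apply: y0; lra.
Qed.

End power_decay.

End ode.

(** * Inner product and curves in L^2 *)

Section L2_inner.
Context (R : realType) (n : nat) (Omega : set 'rV[R]_n).
Hypothesis mO : measurable Omega.
Local Notation mu := (@lebesgue_row R n).
Local Notation L2 := (in_Lq Omega 2%:E).
Local Notation nrm u := (L2norm Omega u).
Implicit Types (u v w : 'rV[R]_n -> R) (c : R).

Let sqrE u x : (`|u x| `^ 2)%:E = (u x * u x)%:E :> \bar R.
Proof. by rewrite powR_mulrn// real_normK ?num_real. Qed.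

Lemma L2_norm_integral u :
  Lq_norm Omega 2%:E u = ((\int[mu]_(x in Omega) (u x * u x)%:E) `^ 2^-1)%E.
Proof.
rewrite Lq_normE ?pnatr_eq0//; congr (_ `^ _)%E.
by apply: eq_integral => x _; exact: sqrE.
Qed.

Lemma in_L2_sqr_integrable u : L2 u -> mu.-integrable Omega (EFin \o (fun x => u x * u x)).
Proof.
move=> [mu_ Lu]; apply/integrableP; split.
  by apply/measurable_EFinP; exact: measurable_funM.
rewrite (eq_integral (fun x => (u x * u x)%:E)); last first.
  by move=> x _ /=; rewrite ger0_norm// -expr2 sqr_ge0.
move: Lu; rewrite L2_norm_integral; rewrite ltey; apply: contraTT => h.
by move: h; rewrite ltey negbK => /eqP ->; rewrite poweRyr// invr_eq0 pnatr_eq0.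
Qed.

Lemma sqr_integrable_in_L2 u : measurable_fun Omega u ->
  mu.-integrable Omega (EFin \o (fun x => u x * u x)) -> L2 u.
Proof.
move=> mu_ iu; split=> //; rewrite L2_norm_integral poweR_lty//.
have /integrableP[_] := iu; rewrite (eq_integral (fun x => (u x * u x)%:E))//.
by move=> x _ /=; rewrite ger0_norm// -expr2 sqr_ge0.
Qed.

Lemma in_L2M_integrable u v : L2 u -> L2 v ->
  mu.-integrable Omega (EFin \o (fun x => u x * v x)).
Proof.
move=> Lu Lv; have iu := in_L2_sqr_integrable Lu; have iv := in_L2_sqr_integrable Lv.
apply: (le_integrable mO _ _ (integrableD mO iu iv)).
  by apply/measurable_EFinP; apply: measurable_funM; [case: Lu|case: Lv].
move=> x _ /=; rewrite lee_fin [leRHS]ger0_norm; last by rewrite addr_ge0// -expr2 sqr_ge0.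
rewrite normrM -!expr2 -(real_normK (num_real (u x))) -(real_normK (num_real (v x))).
have := sqr_ge0 (`|u x| - `|v x|); rewrite sqrrB.
have : 0 <= `|u x| * `|v x| by rewrite mulr_ge0.
by lra.
Qed.

Lemma in_L2_linear u v c : L2 u -> L2 v -> L2 (fun x => u x + c * v x).
Proof.
move=> Lu Lv; have [mu_ _] := Lu; have [mv _] := Lv.
apply: sqr_integrable_in_L2.
  by apply: measurable_funD => //; apply: measurable_funM.
have iu := in_L2_sqr_integrable Lu; have iv := in_L2_sqr_integrable Lv.
have iuv := in_L2M_integrable Lu Lv.
have := integrableD mO iu (integrableD mO (integrableZl mO (2 * c) iuv) (integrableZl mO (c ^+ 2) iv)).
apply: eq_integrable => // x _ /=.
by rewrite -!EFinM -!EFinD; congr EFin; ring.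
Qed.

Lemma innerC u v : inner Omega u v = inner Omega v u.
Proof. by apply: eq_Rintegral => x _; rewrite mulrC. Qed.

Lemma inner_linearl u v w c : L2 u -> L2 v -> L2 w ->
  inner Omega (fun x => u x + c * v x) w = inner Omega u w + c * inner Omega v w.
Proof.
move=> Lu Lv Lw; rewrite /inner.
have iu := in_L2M_integrable Lu Lw; have iv := in_L2M_integrable Lv Lw.
have icv : mu.-integrable Omega (EFin \o (fun x => c * (v x * w x))).
  by apply: eq_integrable (integrableZl mO c iv) => // x _ /=; rewrite -EFinM.
rewrite -RintegralZl// -RintegralD//.
by apply: eq_Rintegral => x _; ring.
Qed.

Lemma L2norm_ge0 u : 0 <= nrm u.
Proof. by rewrite fine_ge0// Lq_norm_ge0. Qed.

Lemma sqr_L2norm u : L2 u -> nrm u ^+ 2 = inner Omega u u.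
Proof.
move=> Lu; rewrite /L2norm L2_norm_integral /inner /Rintegral.
have f : (\int[mu]_(x in Omega) (u x * u x)%:E)%E \is a fin_num.
  exact: (integrable_fin_num mO (in_L2_sqr_integrable Lu)).
rewrite -[in LHS](fineK f) poweR_EFin /= -powR_mulrn ?powR_ge0// -powRrM mulVf// powRr1//.
by rewrite fine_ge0// integral_ge0// => x _; rewrite lee_fin -expr2 sqr_ge0.
Qed.

Lemma sqr_L2norm_linear u v c : L2 u -> L2 v ->
  (nrm (fun x => u x + c * v x)) ^+ 2 =
  nrm u ^+ 2 + 2 * c * inner Omega u v + c ^+ 2 * nrm v ^+ 2.
Proof.
move=> Lu Lv; have Luv := in_L2_linear c Lu Lv.
rewrite (sqr_L2norm Luv) (sqr_L2norm Lu) (sqr_L2norm Lv) (inner_linearl c Lu Lv Luv).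
rewrite (innerC u (fun x => _)) (innerC v (fun x => _)).
rewrite (inner_linearl c Lu Lv Lu) (inner_linearl c Lu Lv Lv) (innerC v u).
by ring.
Qed.

Lemma cauchy_schwarz u v : L2 u -> L2 v -> `|inner Omega u v| <= nrm u * nrm v.
Proof.
move=> Lu Lv; set I := inner Omega u v.
have H c : 0 <= nrm u ^+ 2 + 2 * c * I + c ^+ 2 * nrm v ^+ 2.
  by rewrite -sqr_L2norm_linear// sqr_ge0.
rewrite -(@ler_pXn2r _ 2) ?nnegrE ?mulr_ge0 ?L2norm_ge0// real_normK ?num_real// exprMn.
set A := nrm u ^+ 2 in H *; set B := nrm v ^+ 2 in H *.
have B0 : 0 <= B by exact: sqr_ge0.
have [B00|BN0] := eqVneq B 0.
  have [->|I0] := eqVneq I 0; first by rewrite expr0n mulr_ge0// sqr_ge0.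
  have := H (- (A + 1) / (2 * I)); rewrite B00 mulr0 addr0.
  have -> : 2 * (- (A + 1) / (2 * I)) * I = - (A + 1) by field.
  lra.
have Bp : 0 < B by rewrite lt0r BN0.
have := H (- I / B); rewrite -(pmulr_lge0 _ Bp).
have -> : (A + 2 * (- I / B) * I + (- I / B) ^+ 2 * B) * B = A * B - I ^+ 2 by field.
by rewrite subr_ge0.
Qed.

Section curves.
Variables (u : R -> 'rV[R]_n -> R).
Hypothesis Lu : forall t, 0 <= t -> L2 (u t).
Local Notation nng := [set s : R | 0 <= s].

Let subE (v w : 'rV[R]_n -> R) : v \- w = (fun x => v x + -1 * w x).
Proof. by apply/funext => x /=; rewrite mulN1r. Qed.

Let Lsub s t : 0 <= s -> 0 <= t -> L2 (u s \- u t).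
Proof. by move=> s0 t0; rewrite subE; apply: in_L2_linear; exact: Lu. Qed.

Lemma L2_continuous_norm t : L2_continuous_at Omega u t ->
  nrm (u s \- u t) @[s --> within nng (nbhs t)] --> 0.
Proof. by move=> h; apply: fine_cvg; exact: h. Qed.

Lemma sqr_L2norm_expand s t : 0 <= s -> 0 <= t ->
  nrm (u s) ^+ 2 - nrm (u t) ^+ 2 =
  2 * inner Omega (u s \- u t) (u t) + nrm (u s \- u t) ^+ 2.
Proof.
move=> s0 t0; have := sqr_L2norm_linear 1 (Lu t0) (Lsub s0 t0).
have -> : (fun x => u t x + 1 * (u s \- u t) x) = u s.
  by apply/funext => x /=; rewrite mul1r addrC subrK.
by rewrite (innerC (u t)) => ->; ring.
Qed.

(** | |u s|^2 - |u t|^2 | <= 2 |u s - u t| |u t| + |u s - u t|^2. *)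
Lemma continuous_sqr_L2norm :
  (forall t, 0 <= t -> L2_continuous_at Omega u t) ->
  {within `[0, +oo[, continuous (fun t => nrm (u t) ^+ 2)}.
Proof.
move=> cu; apply/subspace_continuousP => t; rewrite /= in_itv /= andbT => t0.
have -> : [set` `[0, +oo[%R] = nng.
  by apply/seteqP; split => x /=; rewrite in_itv /= andbT.
have c0 := L2_continuous_norm (cu t t0).
have b : (fun s => 2 * nrm (u s \- u t) * nrm (u t) + nrm (u s \- u t) ^+ 2)
    @ within nng (nbhs t) --> 2 * 0 * nrm (u t) + 0 * 0.
  apply: cvgD; last by apply: cvgM.
  by apply: cvgM; [apply: cvgM => //; exact: cvg_cst|exact: cvg_cst].
rewrite !(mulr0, mul0r) addr0 in b.
have bE : {near within nng (nbhs t), forall s,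
    `|nrm (u s) ^+ 2 - nrm (u t) ^+ 2| <=
    2 * nrm (u s \- u t) * nrm (u t) + nrm (u s \- u t) ^+ 2}.
  near=> s; have s0 : 0 <= s.
    by near: s; apply: withinT => //; exact: nbhs_filter.
  rewrite sqr_L2norm_expand//; apply: le_trans (ler_normD _ _) _.
  rewrite (ger0_norm (sqr_ge0 _)) lerD2r normrM ger0_norm// -mulrA ler_wpM2l//.
  by apply: cauchy_schwarz; [exact: Lsub|exact: Lu].
apply/cvgrPdist_lt => e e0.
move/cvgrPdist_lt : b => /(_ e e0) b.
near=> s; rewrite distrC; apply: le_lt_trans (_ : _ <= `|0 - (2 * nrm (u s \- u t) * nrm (u t) + nrm (u s \- u t) ^+ 2)|) _.
  rewrite sub0r normrN; apply: le_trans (ler_norm _).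
  by near: s.
by near: s.
Unshelve. all: by end_near. Qed.

(** With w = u s - u t and e = w / (s - t) - r, the difference quotient of |u|^2
    minus 2 (r, u t) equals 2 (e, u t) + (r, w) + (e, w), and e and w tend to 0. *)
Lemma is_derive_sqr_L2norm t r : 0 < t -> L2 r ->
  L2_continuous_at Omega u t -> L2_derivative_at Omega u t r ->
  is_derive t 1 (fun s => nrm (u s) ^+ 2) (2 * inner Omega r (u t)).
Proof.
move=> t0 Lr cu du; have Lt := Lu (ltW t0).
pose D s := (fun x => (s - t)^-1 * (u s x - u t x)) \- r.
have G0 : (h + t @[h --> (0:R)^']) --> within nng t^'.
  move=> A; rewrite /within /= => -[e /= e0 He].
  have te : 0 < Num.min e t by rewrite lt_min e0.
  exists (Num.min e t) => //= h; rewrite /ball_ /= sub0r normrN lt_min => /andP[he ht] h0.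
  apply: He.
  - by rewrite /= opprD addrCA subrr addr0 normrN.
  - by rewrite -subr_eq0 addrK.
  - by move: ht; rewrite /= ltr_norml => /andP[]; lra.
have c0 : nrm (u s \- u t) @[s --> within nng t^'] --> 0.
  apply: cvg_trans (L2_continuous_norm cu); apply: cvg_app.
  by move=> A; rewrite /within /= => -[e /= e0 He]; exists e => //= x xe xt; exact: He.
have nt : \forall s \near within nng t^', 0 <= s /\ s != t.
  by exists 1 => //= x _ xt x0.
have d0 : nrm (D s) @[s --> within nng t^'] --> 0 by apply: fine_cvg; exact: du.
pose b s := 2 * nrm (D s) * nrm (u t) + nrm (u s \- u t) * (nrm r + nrm (D s)).
have b0 : b s @[s --> within nng t^'] --> 2 * 0 * nrm (u t) + 0 * (nrm r + 0).
  apply: cvgD; first by apply: cvgM; [apply: cvgM => //; exact: cvg_cst|exact: cvg_cst].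
  by apply: cvgM => //; apply: cvgD => //; exact: cvg_cst.
rewrite !(mulr0, mul0r) addr0 in b0.
have key s : 0 <= s -> s != t ->
    `|(s - t)^-1 * (nrm (u s) ^+ 2 - nrm (u t) ^+ 2) - 2 * inner Omega r (u t)| <= b s.
  move=> s0 st; have st0 : s - t != 0 by rewrite subr_eq0.
  have Lw := Lsub s0 (ltW t0).
  have LD : L2 (D s).
    rewrite (_ : D s = (fun x => (-1) * r x + (s - t)^-1 * (u s \- u t) x)).
      apply: in_L2_linear => //.
      have -> : (fun x => -1 * r x) = (fun x => r x + (-2) * r x).
        by apply/funext => x; ring.
      exact: in_L2_linear.
    by apply/funext => x; rewrite /D /=; ring.
  have Lrt : L2 (fun x => r x + 1 * D s x) by exact: in_L2_linear.
  have wE : u s \- u t = (fun x => (fun=> 0) x + (s - t) * (r x + 1 * D s x)).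
    by apply/funext => x; rewrite /D /=; field.
  have L0 : L2 (fun=> 0).
    by rewrite (_ : (fun=> 0) = (fun x => r x + (-1) * r x))//; [exact: in_L2_linear|apply/funext => x; ring].
  have iE v : L2 v -> inner Omega (u s \- u t) v = (s - t) * (inner Omega r v + inner Omega (D s) v).
    move=> Lv; rewrite {1}wE inner_linearl// inner_linearl// mul1r.
    rewrite (_ : inner Omega (fun=> 0) v = 0) ?add0r//.
    by rewrite /inner /Rintegral integral0_eq//= => x _; rewrite mul0r.
  rewrite sqr_L2norm_expand ?(ltW t0)// sqr_L2norm// !iE//.
  rewrite (_ : _ - _ = 2 * inner Omega (D s) (u t) +
     (inner Omega r (u s \- u t) + inner Omega (D s) (u s \- u t))); last by field.
  apply: le_trans (ler_normD _ _) _; apply: lerD.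
    by rewrite normrM ger0_norm// -mulrA ler_wpM2l// cauchy_schwarz.
  apply: le_trans (ler_normD _ _) _; rewrite mulrDr; apply: lerD; rewrite mulrC cauchy_schwarz//.
apply: is_derive_cvg.
have F0 : (s - t)^-1 * (nrm (u s) ^+ 2 - nrm (u t) ^+ 2) @[s --> within nng t^'] -->
    2 * inner Omega r (u t).
  apply/cvgrPdist_lt => e e0; move/cvgrPdist_lt : b0 => /(_ e e0) b0.
  near=> s; rewrite distrC; apply: le_lt_trans (_ : _ <= `|0 - b s|) _.
    rewrite sub0r normrN; apply: le_trans (ler_norm _); by have [s0 st] : 0 <= s /\ s != t; [near: s|exact: key].
  by near: s.
have := cvg_comp _ _ G0 F0; apply: cvg_trans; apply: near_eq_cvg; near=> h.
by rewrite /= addrK [h *: 1]mulr1.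
Unshelve. all: by end_near. Qed.

End curves.

End L2_inner.

(** * Dissipation of the flux *)

Section L2_finite_measure.
Context (R : realType) (n : nat) (Omega : set 'rV[R]_n).
Hypothesis mO : measurable Omega.
Local Notation mu := (@lebesgue_row R n).
Hypothesis Ofin : (mu Omega < +oo)%E.
Local Notation L2 := (in_Lq Omega 2%:E).
Implicit Types (u v w : 'rV[R]_n -> R) (c : R).

Lemma integrable_cst_fin c : mu.-integrable Omega (EFin \o (fun=> c)).
Proof.
apply/integrableP; split; first exact/measurable_EFinP/measurable_cst.
rewrite (eq_integral (cst (`|c|%:E)))// integral_cst//.
by rewrite lte_mul_pinfty.
Qed.

Lemma L2_dominated u v c : L2 u -> measurable_fun Omega v ->
  (forall x, Omega x -> `|v x| <= c * `|u x|) -> L2 v.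
Proof.
move=> Lu mv uv; apply: (sqr_integrable_in_L2 mv).
apply: (le_integrable mO _ _ (integrableZl mO (c ^+ 2) (in_L2_sqr_integrable Lu))).
  by apply/measurable_EFinP; exact: measurable_funM.
move=> x Ox /=; rewrite lee_fin -!expr2 -exprMn !normrX ler_pXn2r ?nnegrE ?normr_ge0//.
rewrite normrM; apply: le_trans (uv x Ox) _.
by rewrite ler_wpM2r// ler_norm.
Qed.

Lemma Rintegral_sum_integrable (I : finType) (h : I -> 'rV[R]_n -> R) :
  (forall i, mu.-integrable Omega (EFin \o h i)) ->
  mu.-integrable Omega (EFin \o (fun x => \sum_i h i x)) /\
  \int[mu]_(x in Omega) (\sum_i h i x) = \sum_i \int[mu]_(x in Omega) h i x.
Proof.
move=> hi.
have E : EFin \o (fun x => \sum_i h i x) = (fun x => \sum_i (EFin \o h i) x)%E.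
  by apply/funext => x /=; rewrite sumEFin.
split; first by rewrite E; apply: integrable_sum.
rewrite /Rintegral (_ : (fun x => _) = EFin \o (fun x => \sum_i h i x))// E.
rewrite integral_sum//.
rewrite (eq_bigr (fun i => (\int[mu]_(x in Omega) h i x)%:E)) ?sumEFin// => i _.
by rewrite fineK//; exact: (integrable_fin_num mO (hi i)).
Qed.

Lemma ge0_le_Rintegral_integrable (f g : 'rV[R]_n -> R) : measurable_fun Omega f ->
  mu.-integrable Omega (EFin \o g) -> (forall x, Omega x -> 0 <= f x <= g x) ->
  mu.-integrable Omega (EFin \o f) /\
  \int[mu]_(x in Omega) f x <= \int[mu]_(x in Omega) g x.
Proof.
move=> mf ig fg.
have if_ : mu.-integrable Omega (EFin \o f).
  apply: (le_integrable mO _ _ ig); first exact/measurable_EFinP.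
  move=> x Ox /=; have /andP[f0 fgx] := fg x Ox.
  by rewrite lee_fin !ger0_norm// (le_trans f0).
split=> //; apply: le_Rintegral => // x Ox.
by have /andP[] := fg x Ox.
Qed.

Lemma W_norm_lty u : in_W Omega 1 2%:E u -> (W_norm Omega 1 2%:E u < +oo)%E.
Proof.
move=> Wu; apply/poweR_lty/lte_sum_pinfty => al al1; apply: poweR_lty.
by have [_ []] := Wu _ al1.
Qed.

Lemma H1norm_ge0 u : 0 <= H1norm Omega u.
Proof. by rewrite /H1norm fine_ge0// poweR_ge0. Qed.

Lemma L2norm_weak_deriv_le i u : in_W Omega 1 2%:E u ->
  L2norm Omega (weak_deriv Omega (fun j => (j == i : nat)) u) <= H1norm Omega u.
Proof.
move=> Wu; apply: fine_le.
- by rewrite ge0_fin_numE ?Lq_norm_ge0//; have [_ []] := in_W1_weak_deriv i Wu.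
- by rewrite ge0_fin_numE ?poweR_ge0// W_norm_lty.
- by apply: Lq_norm_le_W; rewrite mdeg_delta.
Qed.

End L2_finite_measure.

Section dissipation.
Context (R : realType) (n N : nat) (al a : 'I_N.+1 -> R) (Omega : set 'rV[R]_n.+2).
Hypothesis hN : (1 <= N)%N.
Hypothesis hal0 : al ord0 = 0.
Hypothesis hal : forall i j : 'I_N.+1, (i < j)%N -> al i < al j.
Hypothesis ha : forall i, 0 <= a i.
Hypothesis ha0 : 0 < a ord0.
Hypothesis hdeg : a_exp al <= 4 / (n.+2%:R + 2).
Hypotheses (oO : open Omega) (bO : bounded_set Omega).
Local Notation mu := (@lebesgue_row R n.+2).
Local Notation K := (Kfun al a).
Local Notation aN := (a_exp al).
Local Notation beta := (beta_exp al).
Local Notation L2 := (in_Lq Omega 2%:E).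
Local Notation nrm u := (L2norm Omega u).
Local Notation wd i u := (weak_deriv Omega (fun j => (j == i : nat)) u).
Implicit Types u v : 'rV[R]_n.+2 -> R.

Let mO : measurable Omega. Proof. exact: open_row_measurable. Qed.
Let Ofin : (mu Omega < +oo)%E. Proof. exact: bounded_set_lty. Qed.
Let b12 : 1 < beta < 2. Proof. exact: beta_exp_itv. Qed.
Let b0 : 0 < beta. Proof. by have /andP[b1 _] := b12; lra. Qed.

Lemma measurable_enorm_grad u : (forall i, measurable_fun Omega (wd i u)) ->
  measurable_fun Omega (fun x => enorm (grad Omega u x)).
Proof.
move=> mw; apply: (measurableT_comp (f := @Num.sqrt R)).
  by apply: nondecreasing_measurable => // x y; exact: ler_wsqrtr.
have -> : (fun x => dotv (grad Omega u x) (grad Omega u x)) =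
    (fun x => \sum_i wd i u x * wd i u x).
  by apply/funext => x; apply: eq_bigr => i _; rewrite !mxE.
by apply: measurable_sum => i; exact: measurable_funM.
Qed.

Lemma flux_L2 u i : (forall j, L2 (wd j u)) ->
  L2 (fun x => flux al a Omega u x ord0 i).
Proof.
move=> Lw; have mw j : measurable_fun Omega (wd j u) by case: (Lw j).
have E : (fun x => flux al a Omega u x ord0 i) =
    (fun x => K (Num.max 0 (enorm (grad Omega u x))) * wd i u x).
  by apply/funext => x; rewrite /flux !mxE max_r// enorm_ge0.
apply: (L2_dominated mO (c := (a ord0)^-1) (Lw i)).
  rewrite E; apply: measurable_funM => //.
  apply: (measurableT_comp (measurable_Kfun hal0 hal ha ha0)).
  exact: measurable_enorm_grad.
move=> x _; rewrite /flux !mxE normrM ler_wpM2r// ger0_norm ?Kfun_le//.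
by apply: ltW; exact: Kfun_gt0.
Qed.

(** The degree condition enters here, as beta >= 2d/(d+2) with d = n + 2. *)
Lemma sobolev_enorm_grad : exists2 S : R, 0 < S & forall u, in_H10 Omega u ->
  mu.-integrable Omega (EFin \o (fun x => enorm (grad Omega u x) `^ beta)) ->
  nrm u `^ beta <= S * \int[mu]_(x in Omega) (enorm (grad Omega u x) `^ beta).
Proof.
have [|S S0 HS] := @sobolev_H10 R n Omega oO bO beta.
  have /andP[b1 /ltW ->] := b12; rewrite andbT /beta_exp.
  have E : 2 * n.+2%:R / n.+4%:R = 2 - 4 / (n.+2%:R + 2) :> R.
    have n0 : 0 <= n%:R :> R by [].
    by rewrite -!natr1; field; rewrite gt_eqF//; lra.
  by rewrite E lerD2l lerN2.
exists ((S * n.+2%:R) `^ beta) => [|u Hu iu]; first by rewrite powR_gt0// mulr_gt0.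
have [Wu _] := Hu.
set J := \int[mu]_(x in Omega) _.
have J0 : 0 <= J by apply: Rintegral_ge0 => x _; exact: powR_ge0.
have JE : (\int[mu]_(x in Omega) (enorm (grad Omega u x) `^ beta)%:E)%E = J%:E.
  by rewrite /J /Rintegral fineK//; exact: (integrable_fin_num mO iu).
have mw i : measurable_fun Omega (wd i u) by have [_ []] := in_W1_weak_deriv i Wu.
have h i : (Lq_norm Omega beta%:E (wd i u) <= (J `^ beta^-1)%:E)%E.
  rewrite Lq_normE ?gt_eqF// -poweR_EFin -JE.
  apply: gt0_ler_poweR; rewrite ?invr_ge0 ?(ltW b0) ?in_itv/= ?leey ?andbT//.
  - by apply: integral_ge0 => x _; rewrite lee_fin powR_ge0.
  - by apply: integral_ge0 => x _; rewrite lee_fin powR_ge0.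
  apply: ge0_le_integral => //.
  - apply/measurable_EFinP; apply: (measurableT_comp (measurable_powR beta)).
    exact: (measurableT_comp (@normr_measurable R setT)).
  - by have /integrableP[] := iu.
  move=> x _; rewrite lee_fin; apply: ge0_ler_powR; rewrite ?nnegrE ?(ltW b0) ?enorm_ge0//.
  by have := coord_le_enorm (grad Omega u x) i; rewrite mxE.
have H : (Lq_norm Omega 2%:E u <= (S * n.+2%:R * J `^ beta^-1)%:E)%E.
  apply: le_trans (HS u Hu) _; rewrite -mulrA EFinM.
  apply: lee_wpmul2l; first by rewrite lee_fin ltW.
  apply: (@le_trans _ _ (\sum_(i < n.+2) (J `^ beta^-1)%:E)%E).
    by apply: lee_sum => i _; exact: h.
  by rewrite sumEFin sumr_const card_ord mulr_natl.
have H' : nrm u <= S * n.+2%:R * J `^ beta^-1.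
  rewrite -[leRHS]/(fine (S * n.+2%:R * J `^ beta^-1)%:E); apply: fine_le => //.
  by rewrite ge0_fin_numE ?Lq_norm_ge0//; have [] := in_W1_Lq Wu.
apply: (@le_trans _ _ ((S * n.+2%:R * J `^ beta^-1) `^ beta)).
  by apply: ge0_ler_powR; rewrite ?nnegrE ?(ltW b0) ?L2norm_ge0// !mulr_ge0 ?powR_ge0// ltW.
by rewrite powRM ?mulr_ge0 ?powR_ge0 ?(ltW S0)// -powRrM mulVf ?gt_eqF// powRr1.
Qed.

(** Integrated form of flux_coercive, with y = grad rho and y - z = grad u.  The
    vector z is taken to be grad rho - grad u rather than grad v: the two agree
    only almost everywhere, while the pointwise inequality can then be used
    everywhere. *)
Lemma dissipation : exists c C : R, [/\ 0 < c, 0 < C & forall eps u v,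
  0 < eps <= 1 -> in_H10 Omega u -> in_W Omega 1 2%:E v ->
  c * eps `^ aN * nrm u `^ beta <=
  \int[mu]_(x in Omega) dotv (flux al a Omega (fun x => u x + 1 * v x) x) (grad Omega u x)
    + C * (eps ^+ 2 + H1norm Omega v ^+ 2)].
Proof.
have [S S0 HS] := sobolev_enorm_grad.
pose c1 := (2 `^ beta * (2 * gbound a))^-1; pose C2 := 1 + (a ord0)^-1.
have g0 : 0 < gbound a by rewrite (lt_le_trans _ (gbound_ge1 ha)).
have c10 : 0 < c1 by rewrite invr_gt0 mulr_gt0 ?powR_gt0// mulr_gt0.
have C20 : 0 < C2 by rewrite ltr_wpDr// invr_ge0 ltW.
have m0 : 0 <= fine (mu Omega) by exact: fine_ge0.
exists (c1 / S), (C2 * (1 + fine (mu Omega) + n.+2%:R)); split.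
- by rewrite divr_gt0.
- by rewrite mulr_gt0//; have := ler0n R n.+2; lra.
move=> eps u v e01 Hu Wv; have [Wu _] := Hu; have /andP[e0 e1] := e01.
set rho := fun x => u x + 1 * v x.
have wr i : is_weak_deriv Omega (fun j => (j == i : nat)) rho (fun x => wd i u x + 1 * wd i v x).
  have [wu _] := in_W1_weak_deriv i Wu; have [wv _] := in_W1_weak_deriv i Wv.
  by have := is_weak_deriv_linear oO 1 wu wv.
have Lu i : L2 (wd i u) by have [_ ] := in_W1_weak_deriv i Wu.
have Lv i : L2 (wd i v) by have [_ ] := in_W1_weak_deriv i Wv.
have mr i : measurable_fun Omega (wd i rho) by exact: weak_deriv_measurable (wr i).
have rae i : {ae mu, forall x, Omega x -> wd i rho x = wd i u x + 1 * wd i v x}.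
  exact: weak_deriv_ae (wr i).
have Lr i : L2 (wd i rho).
  split=> //; rewrite (ae_eq_Lq_norm mO _ (mr i) _ (rae i))//.
    by have [] := in_L2_linear mO 1 (Lu i) (Lv i).
  by have [] := in_L2_linear mO 1 (Lu i) (Lv i).
pose z i := fun x => wd i rho x + (-1) * wd i u x.
have Lz i : L2 (z i) by exact: in_L2_linear.
have nz i : nrm (z i) <= H1norm Omega v.
  apply: le_trans (L2norm_weak_deriv_le i Wv); rewrite le_eqVlt; apply/orP; left.
  apply/eqP; congr fine; apply: ae_eq_Lq_norm => //; first by case: (Lz i).
    by case: (Lv i).
  by apply: filterS (rae i) => x h Ox; rewrite /z h//; ring.
pose F x := dotv (flux al a Omega rho x) (grad Omega u x).
have [iF _] := Rintegral_sum_integrable mO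
  (fun i => in_L2M_integrable mO (flux_L2 i Lr) (Lu i)).
have {}iF : mu.-integrable Omega (EFin \o F).
  by apply: eq_integrable iF => // x _; congr EFin; apply: eq_bigr => i _; rewrite [grad _ _ _ _ _]mxE.
have [iz Iz] := Rintegral_sum_integrable mO (fun i => in_L2M_integrable mO (Lz i) (Lz i)).
pose Z x := \sum_i z i x * z i x.
have iC := integrable_cst_fin mO Ofin (C2 * eps ^+ 2).
pose G x := F x + (C2 * eps ^+ 2 + C2 * Z x).
have iCz : mu.-integrable Omega (EFin \o (fun x => C2 * Z x)).
  by apply: eq_integrable (integrableZl mO C2 iz) => // x _ /=; rewrite -EFinM.
have iCZ : mu.-integrable Omega (EFin \o (fun x => C2 * eps ^+ 2 + C2 * Z x)).
  by apply: eq_integrable (integrableD mO iC iCz).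
have iG : mu.-integrable Omega (EFin \o G).
  by apply: eq_integrable (integrableD mO iF iCZ).
pose c3 := c1 * eps `^ aN.
have c30 : 0 < c3 by rewrite mulr_gt0// powR_gt0.
have meg : measurable_fun Omega (fun x => enorm (grad Omega u x) `^ beta).
  apply: (measurableT_comp (measurable_powR beta)); apply: measurable_enorm_grad => i.
  by case: (Lu i).
have [||i1 I1] := @ge0_le_Rintegral_integrable _ _ Omega mO
    (fun x => c3 * enorm (grad Omega u x) `^ beta) G _ iG.
- exact: measurable_funM.
- move=> x Ox; rewrite mulr_ge0 ?powR_ge0 ?(ltW c30)//=.
  have := @flux_coercive _ _ al a hN hal0 hal ha ha0 _ (grad Omega rho x)
     (grad Omega rho x - grad Omega u x) eps e01.
  rewrite opprB addrCA subrr addr0 -/c1 -/C2 mulrA -/c3 => /le_trans; apply.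
  rewrite /G -mulrDr lerD2l ler_wpM2l ?(ltW C20)// lerD2l.
  by apply: ler_sum => i _; rewrite !mxE /z mulN1r.
have ieg : mu.-integrable Omega (EFin \o (fun x => enorm (grad Omega u x) `^ beta)).
  apply: eq_integrable (integrableZl mO c3^-1 i1) => // x _ /=.
  by rewrite -EFinM mulrA mulVf ?gt_eqF// mul1r.
rewrite RintegralZl// in I1.
have hS := HS u Hu ieg.
have GE : \int[mu]_(x in Omega) G x = \int[mu]_(x in Omega) F x +
    (C2 * eps ^+ 2 * fine (mu Omega) + C2 * \sum_i inner Omega (z i) (z i)).
  by rewrite RintegralD// RintegralD// Rintegral_cst// RintegralZl// Iz.
rewrite {}GE in I1.
have sz : \sum_i inner Omega (z i) (z i) <= n.+2%:R * H1norm Omega v ^+ 2.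
  apply: (@le_trans _ _ (\sum_(i < n.+2) H1norm Omega v ^+ 2)).
    apply: ler_sum => i _; rewrite -sqr_L2norm//.
    by rewrite ler_pXn2r ?nnegrE ?L2norm_ge0 ?H1norm_ge0.
  by rewrite sumr_const card_ord mulr_natl.
apply: (@le_trans _ _ (c3 * \int[mu]_(x in Omega) (enorm (grad Omega u x) `^ beta))).
  have -> : c1 / S * eps `^ aN * nrm u `^ beta = c3 * (nrm u `^ beta / S).
    by rewrite /c3; ring.
  by rewrite ler_wpM2l ?(ltW c30)// ler_pdivrMr// mulrC.
apply: le_trans I1 _; rewrite lerD2l -/F.
move: sz; set s := \sum_i inner Omega (z i) (z i) => sz.
rewrite -!mulrA -mulrDr; apply: ler_wpM2l; first exact: ltW.
apply: le_trans (lerD (lexx _) sz) _.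
have := mulr_ge0 m0 (sqr_ge0 (H1norm Omega v)); have := mulr_ge0 (ler0n R n.+2) (sqr_ge0 eps).
have := sqr_ge0 (H1norm Omega v); have := sqr_ge0 eps.
by lra.
Qed.

End dissipation.

(** * Limits superior and decay estimates *)

Section limsup_infty.
Context (R : realType).
Implicit Types (F y g : R -> R) (M T : R).

Lemma limsup_infty_le F M T : (forall t, T <= t -> F t <= M) ->
  (limsup_infty F <= M%:E)%E.
Proof.
move=> FM; apply: ge_ereal_inf; exists (ereal_sup ((EFin \o F) @` [set t | T < t])).
  by exists [set t | T < t] => //; exists T; split => //; exact: num_real.
by apply: ge_ereal_sup => _ [t /= Tt <-]; rewrite lee_fin FM// ltW.
Qed.

Lemma limsup_infty_lt F M : (limsup_infty F < M%:E)%E ->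
  exists2 T, 0 < T & forall t, T < t -> F t <= M.
Proof.
move=> /ereal_inf_lt[_ [A [T [_ TA]] <-]] AM.
exists (Num.max T 1) => [|t]; first by rewrite lt_max ltr01 orbT.
rewrite gt_max => /andP[Tt _]; rewrite -lee_fin; apply: le_trans (ltW AM).
by apply: ereal_sup_ubound; exists t => //; exact: TA.
Qed.

Lemma limsup_infty_ge0 F : (forall t, 0 <= F t) -> (0 <= limsup_infty F)%E.
Proof.
move=> F0; apply: limf_esup_ge0 => [[M [_ /(_ (M + 1))]]|t]; last by rewrite lee_fin.
by apply; rewrite ltrDl.
Qed.

Lemma limsup_infty_eq0 F : (forall t, 0 <= F t) ->
  (forall e, 0 < e -> exists T, forall t, T <= t -> F t <= e) ->
  limsup_infty F = 0%E.
Proof.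
move=> F0 Fe; apply/eqP; rewrite eq_le limsup_infty_ge0// andbT.
apply/lee_addgt0Pr => e e0; rewrite add0e; have [T FT] := Fe e e0.
exact: limsup_infty_le FT.
Qed.

Section decay_estimates.
Variables (aN kap C : R) (D : R -> R) (y z g : R -> R).
Let beta := 2 - aN.
Hypothesis (aN01 : 0 < aN < 1) (kap0 : 0 < kap) (C0 : 0 < C).
Hypothesis D0 : forall e, 0 <= D e.
Hypothesis cy : {within `[0, +oo[, continuous y}.
Hypothesis y0 : forall t, 0 <= y t.
Hypothesis g0 : forall t, 0 <= g t.
Hypothesis dy : forall t : R, 0 < t -> is_derive t 1 y (z t).
Hypothesis zy : forall e t, 0 < e <= 1 -> 0 < t ->
  z t <= C * e ^+ 2 + D e * g t - kap * e `^ aN * y t `^ (beta / 2).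

Let b0 : 0 < beta. Proof. by rewrite /beta; case/andP: aN01; lra. Qed.
Let p0 : 0 < beta / 2. Proof. by rewrite divr_gt0. Qed.
Let pE : (beta / 2)^-1 = 2 / beta. Proof. by rewrite invf_div. Qed.
Let q0 : 0 < 2 / beta. Proof. by rewrite divr_gt0. Qed.
Let y0' t : 0 <= t -> 0 <= y t. Proof. by []. Qed.

(** The level of balance for a source C + D(1) m with m >= 1 is at most
    decay_const * m^(2/beta); the factor 2 leaves room for m = 1 + L when the
    source is only known to be at most L + 1 eventually. *)
Definition decay_const := (2 * (C + D 1) / kap) `^ (2 / beta).

Let zy1 t : 0 < t -> z t <= C + D 1 * g t - kap * y t `^ (beta / 2).
Proof.
have e01 : 0 < (1 : R) <= 1 by rewrite ltr01 lexx.
by move=> t0; have := zy e01 t0; rewrite expr1n mulr1 powR1 mulr1.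
Qed.

Let CD0 : 0 < C + D 1. Proof. by rewrite ltr_wpDr. Qed.

Lemma decay_le (M T : R) : 0 < T -> (forall t, 0 < t < T -> g t <= M) -> 0 <= M ->
  y T <= Num.max (y 0) (decay_const * (Num.max 1 M) `^ (2 / beta)).
Proof.
move=> T0 gM M0; pose M1 := C + D 1 * M.
have M10 : 0 <= M1 by rewrite addr_ge0 ?(ltW C0)// mulr_ge0.
apply: (le_trans (power_decay_le kap0 p0 M10 cy y0' dy T0 _)).
  move=> t /andP[t0 tT]; apply: (le_trans (zy1 t0)).
  by rewrite /M1 lerD2r lerD2l ler_wpM2l// gM// t0.
rewrite ge_max le_max lexx /= le_max; apply/orP; right.
rewrite pE /decay_const -powRM ?divr_ge0 ?mulr_ge0 ?(ltW CD0) ?(ltW kap0) ?le_max ?ler01//.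
apply: ge0_ler_powR; rewrite ?nnegrE ?(ltW q0) ?divr_ge0 ?mulr_ge0 ?(ltW CD0) ?(ltW kap0) ?le_max ?ler01//.
  by rewrite invr_ge0 ltW.
rewrite mulrAC ler_pM2r ?invr_gt0// /M1.
have m1 : 1 <= Num.max 1 M by rewrite le_max lexx.
have mM : M <= Num.max 1 M by rewrite le_max lexx orbT.
have := ler_wpM2l (ltW C0) m1; have := ler_wpM2l (D0 1) mM.
have : 0 <= D 1 * Num.max 1 M by rewrite mulr_ge0// (le_trans ler01).
have : 0 <= C * Num.max 1 M by rewrite mulr_ge0 ?(ltW C0)// (le_trans ler01).
by rewrite mulr1; lra.
Qed.

Lemma limsup_decay_le :
  (limsup_infty y <= (decay_const + 1)%:E * (1 + limsup_infty g) `^ (2 / beta))%E.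
Proof.
have d0 : 0 <= decay_const by exact: powR_ge0.
have := limsup_infty_ge0 g0; case E : (limsup_infty g) => [L| |//]; last first.
  by move=> _; rewrite addey// poweRyr ?gt_eqF// gt0_muley ?leey// lte_fin ltr_wpDl.
rewrite lee_fin => L0; rewrite -EFinD poweR_EFin -EFinM.
have [|T0 T00 gT] := @limsup_infty_lt g (L + 1); first by rewrite E lte_fin ltrDl.
pose M1 := C + D 1 * (L + 1).
have M10 : 0 <= M1 by rewrite addr_ge0 ?(ltW C0)// mulr_ge0// addr_ge0.
have [|T1 _ yT] := power_decay_eventually kap0 p0 M10 cy y0' dy T00 ltr01.
  move=> t T0t; apply: (le_trans (zy1 (lt_trans T00 T0t))).
  by rewrite /M1 lerD2r lerD2l ler_wpM2l// gT.
apply: (@limsup_infty_le _ _ T1) => t T1t; apply: (le_trans (yT t T1t)).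
have L1 : 1 <= (1 + L) `^ (2 / beta).
  rewrite -[leLHS](powRr0 (1 + L)); apply: ler_powR; last exact: ltW.
  by rewrite lerDl.
have h1 : 0 <= 1 + L by rewrite addr_ge0.
have h2 : 0 <= 2 * (C + D 1) / kap.
  by rewrite divr_ge0 ?(ltW kap0)// mulr_ge0 ?(ltW CD0).
rewrite [leRHS]mulrDl mul1r; apply: lerD; last exact: L1.
rewrite pE /decay_const -powRM//.
apply: ge0_ler_powR; rewrite ?nnegrE ?(ltW q0) ?(divr_ge0 M10) ?(ltW kap0) ?(mulr_ge0 h2)//.
rewrite mulrAC ler_pM2r ?invr_gt0// /M1.
have : 0 <= D 1 * L by rewrite mulr_ge0.
have : 0 <= C * L by rewrite mulr_ge0// ltW.
move: (D0 1) C0; clear; move: (D 1) => D1 D10 C0 CL DL.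
rewrite -subr_ge0.
have -> : 2 * (C + D1) * (1 + L) - (C + D1 * (L + 1)) = C + D1 + 2 * (C * L) + D1 * L by ring.
by apply: addr_ge0 DL; apply: addr_ge0; [rewrite addr_ge0 ?(ltW C0)|exact: mulr_ge0].
Qed.

(** The level of balance for the source 2 C eps^2 and the damping kap eps^a is
    proportional to (eps^beta)^(2/beta) = eps^2. *)
Lemma limsup_decay_eq0 :
  (forall e, 0 < e -> exists2 T, 0 < T & forall t, T < t -> g t <= e) ->
  limsup_infty y = 0%E.
Proof.
move=> ge; apply: limsup_infty_eq0 => // e e0.
pose Q := (2 * C / kap) `^ (2 / beta) + 1.
have Q0 : 0 < Q by rewrite ltr_wpDl ?powR_ge0.
pose eps := Num.min 1 (e / Q).
have eps0 : 0 < eps by rewrite lt_min ltr01 divr_gt0.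
have eps1 : eps <= 1 by rewrite ge_min lexx.
have e20 : 0 < eps ^+ 2 by rewrite exprn_gt0.
have D1 : 0 < D eps + 1 by rewrite ltr_wpDl.
have [|T0 T00 gT] := ge (C * eps ^+ 2 / (D eps + 1)); first by rewrite divr_gt0 ?mulr_gt0.
pose M := 2 * C * eps ^+ 2.
have M0 : 0 <= M by rewrite mulr_ge0 ?(ltW e20)// mulr_ge0 ?(ltW C0).
have k0 : 0 < kap * eps `^ aN by rewrite mulr_gt0// powR_gt0.
have [|T1 _ yT] := power_decay_eventually k0 p0 M0 cy y0' dy T00 e20.
  move=> t T0t; have e01 : 0 < eps <= 1 by rewrite eps0.
  apply: (le_trans (zy e01 (lt_trans T00 T0t))); rewrite lerD2r /M.
  have gt1 := gT t T0t.
  have : D eps * g t <= C * eps ^+ 2.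
    apply: (@le_trans _ _ ((D eps + 1) * g t)); first by rewrite ler_wpM2r ?lerDl.
    by rewrite mulrC -ler_pdivlMr.
  by rewrite -mulrA; lra.
exists T1 => t T1t; apply: (le_trans (yT t T1t)).
have -> : (M / (kap * eps `^ aN)) `^ (beta / 2)^-1 = (2 * C / kap) `^ (2 / beta) * eps ^+ 2.
  have -> : M / (kap * eps `^ aN) = 2 * C / kap * eps `^ beta.
    have -> : eps `^ beta = eps ^+ 2 / eps `^ aN.
      by rewrite /beta gt0_powRD// powRN powR_mulrn// ltW.
    by rewrite /M; field; rewrite !gt_eqF// powR_gt0.
  rewrite pE powRM ?powR_ge0 ?divr_ge0 ?mulr_ge0 ?(ltW C0) ?(ltW kap0)//.
  by rewrite -powRrM mulrCA mulfV ?gt_eqF// mulr1 powR_mulrn// ltW.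
rewrite -[X in _ + X]mul1r -mulrDl -/Q.
have h : eps ^+ 2 <= e / Q.
  apply: (@le_trans _ _ eps); first by rewrite expr2 ler_piMl// ltW.
  by rewrite ge_min lexx orbT.
by rewrite -ler_pdivlMl// mulrC.
Qed.

End decay_estimates.

End limsup_infty.

(** * The energy inequality for the semidiscrete solution *)

Section energy.
Context (R : realType) (n N : nat) (al a : 'I_N.+1 -> R) (Omega : set 'rV[R]_n.+2).
Context (W : set ('rV[R]_n.+2 -> R)) (P : ('rV[R]_n.+2 -> R) -> 'rV[R]_n.+2 -> R).
Context (f phi phit rho : R -> 'rV[R]_n.+2 -> R) (rho0 : 'rV[R]_n.+2 -> R) (C0 : R).
Local Notation mu := (@lebesgue_row R n.+2).
Local Notation beta := (beta_exp al).
Local Notation lambda := (lambda_exp al).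
Local Notation aN := (a_exp al).
Local Notation L2 := (in_Lq Omega 2%:E).
Local Notation nrm u := (L2norm Omega u).
Hypothesis hN : (1 <= N)%N.
Hypothesis hal0 : al ord0 = 0.
Hypothesis hal : forall i j : 'I_N.+1, (i < j)%N -> al i < al j.
Hypotheses (oO : open Omega) (bO : bounded_set Omega).
Hypothesis C00 : 0 < C0.
Hypothesis WH : forall v, W v -> in_H10 Omega v.
Hypothesis hP : L2_projection Omega W P.
Hypothesis stab : forall w, in_W Omega 1 2%:E w ->
  (W_norm Omega 1 2%:E (P w) <= C0%:E * W_norm Omega 1 2%:E w)%E.
Hypothesis Lf : forall t : R, 0 <= t -> in_Lq Omega 2%:E (f t).
Hypothesis Wphi : forall t : R, 0 <= t -> in_W Omega 1 2%:E (phi t).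
Hypothesis Lphit : forall t : R, 0 <= t -> in_Lq Omega 2%:E (phit t).
Hypothesis Lrho0 : in_Lq Omega 2%:E rho0.
Hypothesis sol : semidiscrete_solution al a Omega W P f phit phi rho rho0.
Local Notation u := (tilde_rho P rho phi).

Let mO : measurable Omega. Proof. exact: open_row_measurable. Qed.
Let Ofin : (mu Omega < +oo)%E. Proof. exact: bounded_set_lty. Qed.

Let subE (v w : 'rV[R]_n.+2 -> R) : v \- w = (fun x => v x + -1 * w x).
Proof. by apply/funext => x /=; rewrite mulN1r. Qed.

Lemma L2_in_L1 w : L2 w -> in_Lq Omega 1%:E w.
Proof.
move=> [mw Lw]; split => //.
have [|K K0 H] := @Lq_norm_le_ge1 R _ Omega mO 1 2 Ofin; first by rewrite lexx ler1n.
apply: le_lt_trans (H w mw) _.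
by rewrite lte_mul_pinfty// lee_fin ltW.
Qed.

(** (P w, P w) = (w, P w). *)
Lemma L2_projection_le w : L2 w -> nrm (P w) <= nrm w.
Proof.
move=> Lw; have [WPw Pw] := hP (L2_in_L1 Lw).
have LPw : L2 (P w) by have [/in_W1_Lq] := WH WPw.
have := Pw _ WPw; rewrite -sqr_L2norm// => E.
have [->|N0] := eqVneq (nrm (P w)) 0; first exact: L2norm_ge0.
have p : 0 < nrm (P w) by rewrite lt0r N0 L2norm_ge0.
rewrite -(ler_pM2r p) -expr2 E; apply: le_trans (ler_norm _) _.
exact: cauchy_schwarz.
Qed.

Lemma solution_L2 t : 0 <= t -> L2 (u t).
Proof. by move=> t0; have [/in_W1_Lq] := WH (sol_space sol t0). Qed.

Lemma source_L2 t : 0 <= t -> L2 (tilde_f f phit t).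
Proof. by move=> t0; rewrite /tilde_f subE; apply: in_L2_linear => //; [exact: Lf|exact: Lphit]. Qed.

Lemma solution_initial_le : nrm (u 0) <= nrm (rho0 \- phi 0).
Proof.
have -> : nrm (u 0) = nrm (P (rho0 \- phi 0)).
  by congr fine; apply: eq_Lq_norm; exact: (sol_initial sol).
apply: L2_projection_le; rewrite subE; apply: in_L2_linear => //.
exact: in_W1_Lq (Wphi (lexx 0)).
Qed.

Lemma projection_H1norm_le t : 0 <= t -> in_W Omega 1 2%:E (P (phi t)) /\
  H1norm Omega (P (phi t)) <= C0 * H1norm Omega (phi t).
Proof.
move=> t0; have Wp := Wphi t0.
have [WP _] := hP (L2_in_L1 (in_W1_Lq Wp)).
have [WPp _] := WH WP; split=> //.
have f1 : W_norm Omega 1 2%:E (phi t) \is a fin_num.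
  by rewrite ge0_fin_numE ?poweR_ge0// W_norm_lty.
have := stab Wp; rewrite -(fineK f1) -EFinM.
have f2 : W_norm Omega 1 2%:E (P (phi t)) \is a fin_num.
  by rewrite ge0_fin_numE ?poweR_ge0// W_norm_lty.
by rewrite -(fineK f2) lee_fin.
Qed.

(** The solution is a legitimate test function, and half of its dissipation is
    left after Young's inequality for (f~, u) with kap = c e^a / 2. *)
Lemma energy_inequality (c C e t : R) : 0 < c -> 0 < C -> 0 < e <= 1 -> 0 < t ->
  (forall eps u v,
  0 < eps <= 1 -> in_H10 Omega u -> in_W Omega 1 2%:E v ->
  c * eps `^ aN * nrm u `^ beta <=
  \int[mu]_(x in Omega) dotv (flux al a Omega (fun x => u x + 1 * v x) x) (grad Omega u x)
    + C * (eps ^+ 2 + H1norm Omega v ^+ 2)) ->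
  exists2 z, is_derive t 1 (fun t => nrm (u t) ^+ 2) z &
  z <= 2 * C * e ^+ 2
     + (2 * C * C0 ^+ 2 + 2 * (c * e `^ aN / 2) `^ (- (beta - 1)^-1)) *
       gfrak al Omega f phit phi t
     - c * e `^ aN * (nrm (u t) ^+ 2) `^ (beta / 2).
Proof.
move=> c0 C0' e01 t0 diss; have t0' := ltW t0; have /andP[e0 e1] := e01.
have [rt [Wrt drt] eqn] := sol_equation sol t0.
have Lrt : L2 rt by have [/in_W1_Lq] := WH Wrt.
exists (2 * inner Omega rt (u t)).
  apply: is_derive_sqr_L2norm => //; first exact: solution_L2.
  exact: (sol_continuous sol).
have Wu := sol_space sol t0'.
have [WPphi HP] := projection_H1norm_le t0'.
have := diss e (u t) (P (phi t)) e01 (WH Wu) WPphi.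
have -> : (fun x => u t x + 1 * P (phi t) x) = rho t.
  by apply/funext => x; rewrite /tilde_rho /= mul1r subrK.
have := eqn _ Wu; set I := \int[mu]_(x in Omega) _ => E.
have Lft := source_L2 t0'.
have /andP[b1 b2] := beta_exp_itv hN hal0 hal.
have k0 : 0 < c * e `^ aN / 2 by rewrite divr_gt0// mulr_gt0// powR_gt0.
have := young b1 k0 (L2norm_ge0 Omega (u t)) (L2norm_ge0 Omega (tilde_f f phit t)).
rewrite -(lambda_expE hN hal0 hal).
have cs : inner Omega (tilde_f f phit t) (u t) <= nrm (u t) * nrm (tilde_f f phit t).
  apply: (le_trans (ler_norm _)); rewrite mulrC; apply: cauchy_schwarz => //.
  exact: solution_L2.
have -> : (nrm (u t) ^+ 2) `^ (beta / 2) = nrm (u t) `^ beta.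
  by rewrite -powR_mulrn ?L2norm_ge0// -powRrM mulrCA mulfV// mulr1.
rewrite /gfrak; set ff := _ `^ lambda; set X := nrm (u t) `^ beta.
set kk := _ `^ (- _); set H := H1norm Omega (phi t) => yg di.
have HH : H1norm Omega (P (phi t)) ^+ 2 <= C0 ^+ 2 * H ^+ 2.
  by rewrite -exprMn ler_pXn2r ?nnegrE ?H1norm_ge0 ?mulr_ge0 ?H1norm_ge0 ?(ltW C00).
have CHH := ler_wpM2l (ltW C0') HH.
have ff0 : 0 <= C * C0 ^+ 2 * ff by rewrite (mulr_ge0 (mulr_ge0 (ltW C0') (sqr_ge0 C0)) (powR_ge0 _ _)).
have kH0 : 0 <= kk * H ^+ 2 by rewrite (mulr_ge0 (powR_ge0 _ _) (sqr_ge0 H)).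
move: di yg cs E CHH ff0 kH0.
set e2 := e ^+ 2; set hP2 := _ ^+ 2; set H2 := H ^+ 2; set C02 := C0 ^+ 2.
set A := c * e `^ aN; set i1 := inner _ rt _; set i2 := inner _ _ (u t).
set pr := nrm (u t) * _.
have -> : A / 2 * X = A * X / 2 by ring.
have -> : C * (e2 + hP2) = C * e2 + C * hP2 by ring.
have -> : (2 * C * C02 + 2 * kk) * (ff + H2) =
  2 * (C * C02 * ff) + 2 * (C * (C02 * H2)) + 2 * (kk * ff) + 2 * (kk * H2) by ring.
rewrite -(mulrA 2 C e2).
by lra.
Qed.

End energy.

(** * Stability of the semidiscrete solution *)

Lemma gfrak_ge0 (R : realType) (d N : nat) (al : 'I_N.+1 -> R) (Omega : set 'rV[R]_d)
  (f phit phi : R -> 'rV[R]_d -> R) t : 0 <= gfrak al Omega f phit phi t.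
Proof. by rewrite addr_ge0 ?powR_ge0 ?sqr_ge0. Qed.

Lemma gfrak_vanish (R : realType) (d N : nat) (al : 'I_N.+1 -> R) (Omega : set 'rV[R]_d)
  (f phit phi : R -> 'rV[R]_d -> R) : 0 < lambda_exp al ->
  limsup_infty (fun t => L2norm Omega (tilde_f f phit t)) = 0%E ->
  limsup_infty (fun t => H1norm Omega (phi t)) = 0%E ->
  forall e, 0 < e -> exists2 T, 0 < T &
    forall t, T < t -> gfrak al Omega f phit phi t <= e.
Proof.
move=> l0 f0 phi0 e e0; have e20 : 0 < e / 2 by rewrite divr_gt0.
have [|T1 T10 fT] := @limsup_infty_lt _ (fun t => L2norm Omega (tilde_f f phit t))
    ((e / 2) `^ (lambda_exp al)^-1).
  by rewrite f0 lte_fin powR_gt0.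
have [|T2 T20 pT] := @limsup_infty_lt _ (fun t => H1norm Omega (phi t)) (Num.sqrt (e / 2)).
  by rewrite phi0 lte_fin sqrtr_gt0.
exists (Num.max T1 T2) => [|t]; first by rewrite lt_max T10.
rewrite gt_max => /andP[/fT f1 /pT p1]; rewrite (splitr e) lerD//.
  apply: (@le_trans _ _ (((e / 2) `^ (lambda_exp al)^-1) `^ lambda_exp al)).
    by apply: ge0_ler_powR; rewrite ?nnegrE ?powR_ge0 ?L2norm_ge0// ltW.
  by rewrite -powRrM mulVf ?gt_eqF// powRr1// ltW.
by rewrite -[leRHS]sqr_sqrtr ?(ltW e20)// ler_pXn2r ?nnegrE ?H1norm_ge0 ?sqrtr_ge0.
Qed.

Theorem theorem4p1 (R : realType) (d N : nat) (al a : 'I_N.+1 -> R)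
    (Omega : set 'rV[R]_d) (C0 C1 sigma : R)
    (hd : (2 <= d)%N) (hN : (1 <= N)%N)
    (hal0 : al ord0 = 0)
    (hal : forall i j : 'I_N.+1, (i < j)%N -> al i < al j)
    (ha : forall i, 0 <= a i) (ha0 : 0 < a ord0) (haN : 0 < a ord_max)
    (hdeg : a_exp al <= 4 / (d%:R + 2))
    (hO : open Omega) (hOb : bounded_set Omega) (hOs : smooth_boundary Omega)
    (hC0 : 0 < C0) (hC1 : 0 < C1) (hsigma : 0 < sigma) :
  exists C : R, 0 < C /\
  forall (r nT : nat) (F : 'I_nT -> 'rV[R]_d -> 'rV[R]_d)
    (P : ('rV[R]_d -> R) -> 'rV[R]_d -> R)
    (f phi phit : R -> 'rV[R]_d -> R) (psi : R -> 'rV[R]_d -> R)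
    (rho0 : 'rV[R]_d -> R) (rho : R -> 'rV[R]_d -> R),
  triangulation Omega F ->
  quasiuniform sigma F ->
  L2_projection Omega (in_FE Omega r F) P ->
  (forall s w, (s <= 1)%N -> in_W Omega s 2%:E w ->
    (W_norm Omega s 2%:E (P w) <= C0%:E * W_norm Omega s 2%:E w)%E) ->
  (forall m (q : \bar R) w, (m <= r.+1)%N -> (1%:E <= q)%E -> in_W Omega m q w ->
    (Lq_norm Omega q (P w \- w)%R
       <= (C1 * mesh_size F ^+ m)%:E * W_norm Omega m q w)%E) ->
  (forall t : R, 0 <= t -> in_Lq Omega 2%:E (f t)) ->
  (forall t : R, 0 <= t -> in_W Omega 1 2%:E (phi t)) ->
  (forall (t : R) x, 0 <= t -> topo_boundary Omega x -> phi t x = psi t x) ->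
  (forall t : R, 0 <= t -> in_Lq Omega 2%:E (phit t)
                       /\ L2_derivative_at Omega phi t (phit t)) ->
  in_Lq Omega 2%:E rho0 ->
  {within `[0, +oo[, continuous (gfrak al Omega f phit phi)} ->
  semidiscrete_solution al a Omega (in_FE Omega r F) P f phit phi rho rho0 ->
  [/\ forall E, is_envelope (gfrak al Omega f phit phi) E ->
        forall t : R, 0 < t ->
          L2norm Omega (tilde_rho P rho phi t)
            <= C * (1 + L2norm Omega (rho0 \- phi 0)
                      + E t `^ (beta_exp al)^-1),
      (limsup_infty (fun t => L2norm Omega (tilde_rho P rho phi t) ^+ 2)%R
        <= C%:E * (1 + limsup_infty (gfrak al Omega f phit phi))
                    `^ (2 / beta_exp al)%R)%E &
      limsup_infty (fun t => L2norm Omega (tilde_f f phit t)) = 0%E ->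
      limsup_infty (fun t => H1norm Omega (phi t)) = 0%E ->
      limsup_infty (fun t => L2norm Omega (tilde_rho P rho phi t) ^+ 2) = 0%E].
Proof.

move: Omega hdeg hO hOb hOs; case: d hd => [//|[//|n]] _ Omega hdeg hO hOb _.
have [c [C [c0 C0' diss]]] := dissipation hN hal0 hal ha ha0 hdeg hO hOb.
have a01 := a_exp_itv hN hal0 hal.
have /andP[b1 b2] := beta_exp_itv hN hal0 hal.
have b0 : 0 < beta_exp al by exact: lt_trans b1.
have l0 : 0 < lambda_exp al.
  by rewrite (lambda_expE hN hal0 hal) addr_gt0// invr_gt0 subr_gt0.
pose D (e : R) := 2 * C * C0 ^+ 2
  + 2 * (c * e `^ a_exp al / 2) `^ (- (beta_exp al - 1)^-1).
have D0 e : 0 <= D e.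
  by rewrite addr_ge0// mulr_ge0 ?powR_ge0 ?sqr_ge0// mulr_ge0// ltW.
have C20 : 0 < 2 * C by rewrite mulr_gt0.
pose Q := decay_const (a_exp al) c (2 * C) D.
have Q0 : 0 <= Q by exact: powR_ge0.
have q0 : 0 < 2 / beta_exp al by rewrite divr_gt0.
(* sqrt Q serves the bound on the norm, Q + 1 the one on its square, and 1 the
   initial datum *)
exists (Q + Num.sqrt Q + 1); split; first by rewrite ltr_wpDl// addr_ge0// sqrtr_ge0.
move=> r nT F P f phi phit psi rho0 rho _ _ hP hstab _ hf hphi _ hphit hrho0 _ sol.
have WH v : in_FE Omega r F v -> in_H10 Omega v by case.
have Lphit t : 0 <= t -> in_Lq Omega 2%:E (phit t) by move=> /hphit[].
have stab := hstab 1%N _ (leqnn 1).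
pose y t := L2norm Omega (tilde_rho P rho phi t) ^+ 2.
pose g := gfrak al Omega f phit phi.
have mO : measurable Omega by exact: open_row_measurable.
have energy (e t : R) : 0 < e <= 1 -> 0 < t -> exists2 z, is_derive t 1 y z &
    z <= 2 * C * e ^+ 2 + D e * g t - c * e `^ a_exp al * y t `^ (beta_exp al / 2).
  move=> e01 t0.
  exact: (energy_inequality hN hal0 hal hO hOb hC0 WH hP stab hf hphi Lphit sol c0 C0' e01 t0 diss).
pose z t := 'D_1 y t.
have dy (t : R) : 0 < t -> is_derive t 1 y (z t).
  move=> t0; have [|d dyt _] := energy 1 t _ t0; first by rewrite ltr01 lexx.
  by rewrite /z (@derive_val _ _ _ _ _ _ _ dyt).
have zy e t : 0 < e <= 1 -> 0 < t ->
    z t <= 2 * C * e ^+ 2 + D e * g t - c * e `^ a_exp al * y t `^ (beta_exp al / 2).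
  move=> e01 t0; have [d dyt] := energy e t e01 t0.
  by rewrite /z (@derive_val _ _ _ _ _ _ _ dyt).
have cy : {within `[0, +oo[, continuous y}.
  apply: continuous_sqr_L2norm => // t t0.
    exact: (solution_L2 WH sol t0).
  exact: (sol_continuous sol).
have y0 t : 0 <= y t by exact: sqr_ge0.
have g0 t : 0 <= g t by exact: gfrak_ge0.
have init := solution_initial_le hO hOb WH hP hphi hrho0 sol.
split.
- move=> E [_ Emono gE] T T0.
  have ET0 : 0 <= E T by apply: le_trans (g0 T) (gE T (ltW T0)).
  have gM t : 0 < t < T -> g t <= E T.
    move=> /andP[t0 tT]; apply: le_trans (gE t (ltW t0)) _.
    by apply: Emono; rewrite ?in_itv/= ?andbT ltW.
  have := decay_le a01 c0 C20 D0 cy y0 dy zy T0 gM ET0.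
  rewrite -/Q le_max; set m := Num.max 1 (E T).
  have m0 : 0 <= m by rewrite le_max ler01.
  set I := L2norm Omega (rho0 \- phi 0) in init *.
  set Eb := E T `^ (beta_exp al)^-1; set S := Num.sqrt Q.
  have S0 : 0 <= S by exact: sqrtr_ge0.
  have I0 : 0 <= I by exact: L2norm_ge0.
  have Eb0 : 0 <= Eb by exact: powR_ge0.
  have X0 : 0 <= 1 + I + Eb by rewrite !addr_ge0.
  case/orP => [yT|yT].
    apply: (@le_trans _ _ I).
      apply: le_trans init; move: yT; rewrite /y ler_pXn2r ?nnegrE ?L2norm_ge0//.
    apply: (@le_trans _ _ (1 * (1 + I + Eb))); first by lra.
    by rewrite ler_wpM2r// lerDr addr_ge0.
  have mE : m `^ (beta_exp al)^-1 <= 1 + I + Eb.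
    rewrite /m maxEle; case: ifP => _; first by rewrite /Eb; lra.
    by rewrite powR1; lra.
  apply: (@le_trans _ _ (S * m `^ (beta_exp al)^-1)).
    rewrite -(@ler_pXn2r _ 2) ?nnegrE ?L2norm_ge0 ?mulr_ge0 ?powR_ge0//.
    apply: (le_trans yT); rewrite exprMn sqr_sqrtr// -[X in _ <= _ * X]powR_mulrn ?powR_ge0//.
    by rewrite -powRrM (mulrC _ 2).
  apply: (@le_trans _ _ (S * (1 + I + Eb))); first by rewrite ler_wpM2l.
  by rewrite ler_wpM2r//; lra.
- apply: le_trans (limsup_decay_le a01 c0 C20 D0 cy y0 g0 dy zy) _.
  apply: lee_wpmul2r; first exact: poweR_ge0.
  by rewrite lee_fin -/Q lerD2r lerDl sqrtr_ge0.
- move=> f0 phi0; apply: (limsup_decay_eq0 a01 c0 C20 D0 cy y0 g0 dy zy).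
  exact: gfrak_vanish.
Qed.
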